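(* Let $(X,x)$ be an F-pure simple elliptic singularity over an algebraically closed field $k$ of characteristic $p>0$, presented as $X=\operatorname{Spec}R$ with $R=\bigoplus_{n\ge0}H^0(E,L^n)t^n$, where $E$ is the elliptic exceptional curve on the minimal resolution $\widetilde{X}$, and suppose $E^2\le-2$. Assume further that $d=-E^2$ is not a power of the characteristic $p$. Then $\widetilde{X}$ is the normalization of the $e$-th F-blowup $\mathrm{FB}_e(X)$ for all $e\ge1$. Moreover, if $E^2\le-3$, then $\widetilde{X}\cong\mathrm{FB}_e(X)$ for all $e\ge1$.
   Context: Blowup at a module: for a Noetherian integral scheme $X$ and a coherent sheaf $\mathcal{M}$, a modification $f:Y\to X$ is a flattening of $\mathcal{M}$ if the torsion-free pullback $f^{\star}\mathcal{M}=(f^*\mathcal{M})/\mathrm{tors}$ is flat (equivalently locally free); the blowup of $X$ at $\mathcal{M}$ is the universal flattening, through which every other flattening factors. The $e$-th F-blowup $\mathrm{FB}_e(X)$ is the blowup of $X$ at $F^e_*\mathcal{O}_X$ ($F$ the absolute Frobenius). Simple elliptic singularities: a simple elliptic singularity is a normal surface singularity whose minimal resolution has a single smooth elliptic curve $E$ as exceptional curve. It is quasi-homogeneous, so one takes $X=\operatorname{Spec}R$ with $R=R(E,L)=\bigoplus_{n\ge0}H^0(E,L^n)t^n$, $L$ an ample line bundle on the elliptic curve $E$, $\deg t=1$. The minimal resolution is $f:\widetilde{X}=\operatorname{Spec}_E\big(\bigoplus_{n\ge0}L^nt^n\big)\to X$, whose exceptional curve is the zero section, identified with $E$; $E^2=-\deg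 L$. F-pure means that $\mathcal{O}_X\to F_*\mathcal{O}_X$ is pure; this is equivalent to $E$ being an ordinary elliptic curve. *)

(* Defs.v *)
(* Integral schemes are handled in the language of models of Chevalley and
   Zariski (Zariski-Samuel, Commutative Algebra II, Ch. VI, par. 17; EGA I,
   par. 8): an integral separated scheme Y with function field K is identified
   with the set { O_(Y,y) : y in Y } of its local rings, seen as subrings of K.
   A point is its local ring, the generic point is K itself, and a morphism of
   such schemes inducing the identity on K is the domination of local rings;
   it is unique if it exists, and two models are isomorphic through it iff they
   are equal.  Subrings of K are Prop-valued sets.
   Recall that 0^-1 = 0 in MathComp. *)
From HB Require Import structures.
From mathcomp Require Import all_boot all_order all_algebra.
From mathcomp Require Import all_classical.

Set Implicit Arguments.
Unset Strict Implicit.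
Unset Printing Implicit Defensive.

Import Order.TTheory GRing.Theory Num.Theory.

Local Open Scope classical_set_scope.
Local Open Scope ring_scope.

Section LocalRings.
Variable K : fieldType.
Implicit Types (A B P V : set K) (X Y Z : set (set K)).

Definition subring A : Prop := subring_closed [in A].

Definition adjoin A (s : seq K) : set K := smallest subring (A `|` [set` s]).

Definition prime_ideal A P : Prop :=
  [/\ P `<=` A /\ P 0,
      ~ P 1,
      forall x y, P x -> P y -> P (x + y),
      forall a x, A a -> P x -> P (a * x)
    & forall a b, A a -> A b -> P (a * b) -> P a \/ P b].

Definition localization A P : set K :=
  [set a / s | a in A & s in A `\` P].

(* the local rings of Spec A *)
Definition aff A : set (set K) := [set localization A P | P in prime_ideal A].

Definition valuation_ring V : Prop := subring V /\ forall x, V x \/ V x^-1.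

(* the local ring B dominates the local ring A *)
Definition dominates B A : Prop :=
  A `<=` B /\ forall x, A x -> B x^-1 -> A x^-1.

(* Y is an integral scheme with function field K, proper (in particular
   separated and of finite type) over the spectrum of the subring A of K.
   Existence and uniqueness of the centre are the valuative criteria of
   properness and separatedness. *)
Definition complete_model A Y : Prop :=
  (exists l : seq (seq K),
      Y = \bigcup_(s in [set` l]) aff (adjoin A s) /\
      forall s, s \in l -> localization (adjoin A s) [set 0] = setT) /\
  (forall V, valuation_ring V -> A `<=` V ->
     exists! y, Y y /\ dominates V y).

(* there is a morphism Z -> Y inducing the identity on K *)
Definition model_dominates Z Y : Prop :=
  forall z, Z z -> exists2 y, Y y & dominates z y.

Definition integral_closure A : set K :=
  [set x | exists2 q : {poly K},
     q \is monic & (forall i, A q`_i) /\ root q x].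

Definition normalization Y : set (set K) :=
  \bigcup_(y in Y) aff (integral_closure y).

Definition uniformizer A (u : K) : Prop :=
  [/\ A u, ~ A u^-1 &
    forall x, x != 0 -> exists n : int, A (x / u ^ n) /\ A (u ^ n / x)].

Definition dvr A : Prop := subring A /\ exists u, uniformizer A u.

(* the normalized valuation of the discrete valuation ring A (for x != 0) *)
Definition ord A (x : K) : int :=
  xget 0 [set n : int | exists2 u, uniformizer A u &
                          A (x / u ^ n) /\ A (u ^ n / x)].

End LocalRings.

Section Modules.
Variables (K : fieldType) (V : lmodType K).
Implicit Types (A O : set K) (M : set V) (Y Z : set (set K)).

(* A torsion-free module over a domain R with fraction field K is given as an
   R-submodule M of a K-vector space V.  Then the torsion-free pullback of M to
   a local ring O containing R, i.e. (M (x)_R O) / torsion, is the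
   O-submodule O.M of V, since the kernel of M (x)_R O -> M (x)_R K is the
   torsion. *)
Definition tf_pullback O M : set V :=
  [set v | exists (n : nat) (a : 'I_n -> K) (m : 'I_n -> V),
     (forall i, O (a i) /\ M (m i)) /\ v = \sum_i a i *: m i].

Definition free_module O M : Prop :=
  exists (n : nat) (b : 'I_n -> V),
    (forall i, M (b i)) /\
    forall v, M v -> exists! c : {ffun 'I_n -> K},
      (forall i, O (c i)) /\ v = \sum_i c i *: b i.

(* Y -> Spec A is a modification flattening M: the torsion-free pullback, being
   coherent, is locally free iff its stalks are free. *)
Definition flattening A M Y : Prop :=
  complete_model A Y /\ forall y, Y y -> free_module y (tf_pullback y M).

Definition universal_flattening A M Y : Prop :=
  flattening A M Y /\ forall Z, flattening A M Z -> model_dominates Z Y.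

(* the blowup of Spec A at M; a universal flattening is unique, the value set0
   is used only if there is none *)
Definition blowup_at A M : set (set K) :=
  xget set0 (universal_flattening A M).

(* act makes N an A-module; only scalars in A matter *)
Definition is_module A (N : zmodType) (act : K -> N -> N) : Prop :=
  [/\ forall a x y, A a -> act a (x + y) = act a x + act a y,
      forall a b x, A a -> A b -> act (a + b) x = act a x + act b x,
      forall a b x, A a -> A b -> act (a * b) x = act a (act b x)
    & forall x, act 1 x = x].

Definition bilinear_on A (N : zmodType) (act : K -> N -> N) M
    (W : zmodType) (actW : K -> W -> W) (beta : N -> V -> W) : Prop :=
  [/\ forall x y m, M m -> beta (x + y) m = beta x m + beta y m,
      forall x m m', M m -> M m' -> beta x (m + m') = beta x m + beta x m',
      forall a x m, A a -> M m -> beta (act a x) m = actW a (beta x m)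
    & forall a x m, A a -> M m -> beta x (a *: m) = actW a (beta x m)].

(* The A-linear map A -> M, a |-> a *: m0, is pure: for every A-module N,
   N -> N (x)_A M, x |-> x (x) m0, is injective.  By the universal property of
   the tensor product, x (x) m0 = 0 iff every A-bilinear map on N x M kills
   (x, m0). *)
Definition pure_at A M (m0 : V) : Prop :=
  forall (N : zmodType) (act : K -> N -> N), is_module A act ->
  forall x : N,
    (forall (W : zmodType) (actW : K -> W -> W), is_module A actW ->
       forall beta : N -> V -> W, bilinear_on A act M actW beta ->
         beta x m0 = 0) ->
    x = 0.

End Modules.

(* F^e_* K : the field K with scalar action a *: v = a ^+ (p ^ e) * v *)
Definition frob_push (K : fieldType) (p : nat) (_ : p \in [pchar K]) (e : nat)
  : Type := K.

Section FrobeniusPushforward.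
Variables (K : fieldType) (p : nat) (hp : p \in [pchar K]) (e : nat).

HB.instance Definition _ := GRing.Zmodule.copy (frob_push hp e) K.

Definition frob_scale (a : K) (v : frob_push hp e) : frob_push hp e :=
  a ^+ (p ^ e) * (v : K).

Lemma frob_scaleA a b v : frob_scale a (frob_scale b v) = frob_scale (a * b) v.
Proof. by rewrite /frob_scale exprMn mulrA. Qed.

Lemma frob_scale1 : left_id 1 frob_scale.
Proof. by move=> v; rewrite /frob_scale expr1n mul1r. Qed.

Lemma frob_scaleDr : right_distributive frob_scale +%R.
Proof. by move=> a u v; rewrite /frob_scale mulrDr. Qed.

Lemma frob_scaleDl v : {morph frob_scale^~ v : a b / a + b}.
Proof.
move=> a b; rewrite /frob_scale exprDn_pchar ?mulrDl //.
by rewrite (eq_pnat _ (pcharf_eq hp)) pnatX pnat_id ?(pcharf_prime hp).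
Qed.

HB.instance Definition _ := GRing.Zmodule_isLmodule.Build K (frob_push hp e)
  frob_scaleA frob_scale1 frob_scaleDr frob_scaleDl.

(* FB_e (Spec A), for A a domain with fraction field K; the set A is here
   F^e_* A inside F^e_* K *)
Definition Fblowup (A : set K) : set (set K) :=
  blowup_at A (A : set (frob_push hp e)).

End FrobeniusPushforward.

(* purity of A -> F_* A, 1 |-> 1 *)
Definition F_pure (K : fieldType) (p : nat) (hp : p \in [pchar K])
    (A : set K) : Prop :=
  pure_at A (A : set (frob_push hp 1)) (1 : K).

Section Curves.
Variables (k F : fieldType) (iota : {rmorphism k -> F}).
Implicit Types (E : set (set F)) (P : set F) (D : set F -> int).

Definition closed_points E : set (set F) := E `\ setT.

(* for k perfect: proper, one-dimensional, with all local rings regular *)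
Definition smooth_projective_curve E : Prop :=
  [/\ complete_model (range iota) E,
      closed_points E !=set0
    & forall P, closed_points E P -> dvr P].

(* families in the product over the closed points P of F, integral at almost
   all P; modulo integral ones they form the direct sum of the F / O_P *)
Definition repartition E (a : set F -> F) : Prop :=
  finite_set [set P | closed_points E P /\ ~ P (a P)].

(* dim_k H^1(E, O_E) = g, where H^1(E, O_E) is the cokernel of
   F -> (+)_P F / O_P, computed by the flasque resolution
   0 -> O_E -> F -> F / O_E -> 0 of sheaves on E; r is a basis. *)
Definition has_genus E (g : nat) : Prop :=
  exists r : 'I_g -> set F -> F,
    (forall i, repartition E (r i)) /\
    forall a, repartition E a -> exists! c : {ffun 'I_g -> k},
      exists f : F, forall P, closed_points E P ->
        P (a P - f - \sum_i iota (c i) * r i P).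

(* used for k algebraically closed, where rational points exist *)
Definition elliptic_curve E : Prop :=
  smooth_projective_curve E /\ has_genus E 1.

(* A line bundle on E is O_E(D) for a divisor D; D is a function on the closed
   points of E, its values elsewhere are irrelevant. *)
Definition divisor E D : Prop :=
  finite_set [set P | closed_points E P /\ D P != 0].

(* for k algebraically closed, where all closed points have degree 1 *)
Definition deg E D : int := \sum_(P \in closed_points E) D P.

(* the stalk of L^n at P, for L = O_E(D) *)
Definition stalk D (n : nat) P : set F :=
  [set x | x = 0 \/ - (n%:Z * D P) <= ord P x].

(* H^0(E, L^n) *)
Definition global_sections E D (n : nat) : set F :=
  \bigcap_(P in closed_points E) stalk D n P.

(* R = (+)_n H^0(E, L^n) t^n inside F[t] inside F(t) *)
Definition section_ring E D : set {fraction {poly F}} :=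
  [set tofrac q | q in [set q : {poly F} | forall n, global_sections E D n q`_n]].

(* the stalk at P of the sheaf of algebras (+)_n L^n t^n *)
Definition section_algebra D P : set {fraction {poly F}} :=
  [set tofrac q | q in [set q : {poly F} | forall n, stalk D n P q`_n]].

(* Spec_E ((+)_n L^n t^n), the minimal resolution of Spec (section_ring E D) for
   E elliptic and D ample; its points over the generizations of P are the
   primes of the stalk at P of the sheaf of algebras. *)
Definition relative_spec E D : set (set {fraction {poly F}}) :=
  \bigcup_(P in closed_points E) aff (section_algebra D P).

(* E^2 on Spec_E ((+)_n L^n t^n), where E is the zero section: its normal
   bundle is the dual of L. *)
Definition self_intersection E D : int := - deg E D.

Lemma pchar_ratfun (p : nat) :
  p \in [pchar k] -> p \in [pchar {fraction {poly F}}].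
Proof.
move=> hp.
apply: (rmorph_pchar (@tofrac {poly F})).
apply: (rmorph_pchar (@polyC F)).
exact: (rmorph_pchar iota).
Qed.

End Curves.

(* Main.v *)
(* Write q = p ^ e, L = O_E(D), d = deg L, and let X~ be the relative spectrum.
   It suffices that X~ is the universal flattening of F^e_* R, since X~ is normal.
   In residue i < q modulo q, the module F^e_* R is the graded module of sections
   of the bundle V_i = F^e_* (L ^ i) of rank q and degree i d, twisted by the powers
   of L. Its fibre at P is L ^ i / m_P ^ q L ^ i, so Riemann-Roch on E gives: if
   i d > q then V_i is globally generated; if i d < q then H^0(L ^ i) spans a
   subbundle, because H^0(L ^ i (- q P)) = 0; the case i d = q is excluded as d is
   not a power of p. Hence the torsion-free pullback to X~ is locally free.
   Conversely let z be a local ring of another flattening, dominated by a valuation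
   ring V, and let V be centred at a point of X~ over P. The local basis at P is a
   V-basis, hence a z-basis because its transition matrix has unit determinant.
   So z contains the coordinates of all sections; for i = q - 1 we have i d > q, and
   these coordinates embed E, so z contains O_P and then the whole chart of X~. *)
Require Import Defs.
From HB Require Import structures.
From mathcomp Require Import all_boot all_order all_algebra.
From mathcomp Require Import all_classical.
From mathcomp Require Import ring zify.

Set Implicit Arguments.
Unset Strict Implicit.
Unset Printing Implicit Defensive.

Import Order.TTheory GRing.Theory Num.Theory.

Local Open Scope classical_set_scope.
Local Open Scope ring_scope.

(** * Local rings in a field *)

Section Subrings.
Variable K : fieldType.
Implicit Types (A B P Q R V : set K) (x y : K).

(** Bases are found and coordinates bounded through orders at [P] alone. If the orders of [s_j],
    [j < q], are pairwise distinct modulo [q], the terms [c_j ^ q s_j] cannot cancel, so each is as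
    regular as their sum. Where [L ^ i] has no section of the required order, one of [L ^ (i + q)]
    is taken; on an element of degree [i] its coefficient would need [t ^ -1], so it has to vanish.
    This is where [i d = q] hurts: [L ^ i (- q P)] may then be trivial, and its section, of order
    [q] at [P], need not lie in the span of the available [s_j]. In the converse, the ring [C]
    generated by coordinates is only known to lie in [O_P]; it need not be noetherian or a
    localization a priori. Hence the detour by valuations: orders show that [O_P] is the only
    valuation ring dominating [C], so [O_P] is integral and then finite over [C]. The same existence
    theorem for valuation rings shows that global functions are constant, that residue fields are
    [k], and that models dominating each other coincide. *)

Lemma subringP A : subring A <->
  [/\ A 1, forall x y, A x -> A y -> A (x - y) & forall x y, A x -> A y -> A (x * y)].
Proof.
split=> [[h1 h2 h3]|[h1 h2 h3]]; split.
- by rewrite -in_setE.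
- by move=> x y Ax Ay; have := h2 x y; rewrite !in_setE; apply.
- by move=> x y Ax Ay; have := h3 x y; rewrite !in_setE; apply.
- by rewrite in_setE.
- by move=> x y; rewrite !in_setE; apply: h2.
- by move=> x y; rewrite !in_setE; apply: h3.
Qed.

Lemma subring1 A : subring A -> A 1.
Proof. by case/subringP. Qed.

Lemma subringB A x y : subring A -> A x -> A y -> A (x - y).
Proof. by case/subringP=> _ h _; apply: h. Qed.

Lemma subringM A x y : subring A -> A x -> A y -> A (x * y).
Proof. by case/subringP=> _ _; apply. Qed.

Lemma subring0 A : subring A -> A 0.
Proof. by move=> sA; rewrite -(subrr 1); apply: subringB => //; apply: subring1. Qed.

Lemma subringN A x : subring A -> A x -> A (- x).
Proof. by move=> sA Ax; rewrite -sub0r; apply: subringB => //; apply: subring0. Qed.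

Lemma subringD A x y : subring A -> A x -> A y -> A (x + y).
Proof. by move=> sA Ax Ay; rewrite -[y]opprK; apply: subringB => //; apply: subringN. Qed.

Lemma subringX A x n : subring A -> A x -> A (x ^+ n).
Proof.
move=> sA Ax; elim: n => [|n IH]; first by rewrite expr0; apply: subring1.
by rewrite exprS; apply: subringM.
Qed.

Lemma subring_sum A (I : Type) (r : seq I) (S : pred I) (f : I -> K) :
  subring A -> (forall i, S i -> A (f i)) -> A (\sum_(i <- r | S i) f i).
Proof.
move=> sA h; apply: big_ind => //; first exact: subring0.
by move=> x y; apply: subringD.
Qed.

Lemma subring_prod A (I : Type) (r : seq I) (S : pred I) (f : I -> K) :
  subring A -> (forall i, S i -> A (f i)) -> A (\prod_(i <- r | S i) f i).
Proof.
move=> sA h; apply: big_ind => //; first exact: subring1.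
by move=> x y; apply: subringM.
Qed.

Lemma subring_horner A (q : {poly K}) x :
  subring A -> (forall i, A q`_i) -> A x -> A q.[x].
Proof.
move=> sA h Ax; rewrite horner_coef; apply: subring_sum => // i _.
by apply: subringM => //; apply: subringX.
Qed.

Lemma subring_setT : subring [set: K].
Proof. by apply/subringP. Qed.

Lemma adjoin_subring A (s : seq K) : subring (adjoin A s).
Proof.
apply/subringP; split.
- by move=> B [sB _]; apply: subring1.
- by move=> x y hx hy B [sB h]; apply: subringB => //; [apply: hx|apply: hy].
- by move=> x y hx hy B [sB h]; apply: subringM => //; [apply: hx|apply: hy].
Qed.

Lemma adjoin_sub A (s : seq K) : A `<=` adjoin A s.
Proof. by move=> x Ax B [_ h]; apply: h; left. Qed.

Lemma adjoin_mem A (s : seq K) x : x \in s -> adjoin A s x.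
Proof. by move=> Ax B [_ h]; apply: h; right. Qed.

Lemma adjoin_min A B (s : seq K) :
  subring B -> A `<=` B -> (forall x, x \in s -> B x) -> adjoin A s `<=` B.
Proof. by move=> sB AB sB' x; apply; split=> // y [/AB|/sB']. Qed.

(** Zero is listed apart because [0^-1 = 0] would make it look invertible. *)
Definition nonunit R x := R x /\ (x = 0 \/ ~ R x^-1).

Definition is_local R :=
  subring R /\ forall x y, nonunit R x -> nonunit R y -> nonunit R (x + y).

Lemma nonunit0 R : subring R -> nonunit R 0.
Proof. by move=> sR; split; [apply: subring0|left]. Qed.

Lemma nonunitM R a x : subring R -> R a -> nonunit R x -> nonunit R (a * x).
Proof.
move=> sR Ra [Rx nx]; split; first exact: subringM.
have [->|a0] := eqVneq a 0; first by left; rewrite mul0r.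
case: nx => [->|nx]; first by left; rewrite mulr0.
right=> h; apply: nx; have -> : x^-1 = a * (a * x)^-1.
  by rewrite invfM mulrA mulfV ?mul1r.
exact: subringM.
Qed.

Lemma nonunit1 R : subring R -> ~ nonunit R 1.
Proof. by move=> sR [R1 []]; [apply/eqP/oner_neq0|rewrite invr1]. Qed.

Lemma not_nonunit R x : R x -> ~ nonunit R x -> x != 0 /\ R x^-1.
Proof.
move=> Rx h; split; first by apply/eqP => x0; apply: h; split=> //; left.
by apply: contrapT => nx; apply: h; split=> //; right.
Qed.

Lemma unit_not_nonunit R x : x != 0 -> R x^-1 -> ~ nonunit R x.
Proof. by move=> /eqP x0 Rx [_ []]. Qed.

Lemma localD R x y : is_local R -> nonunit R x -> nonunit R y -> nonunit R (x + y).
Proof. by case=> _; apply. Qed.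

Lemma local_prime R x y : subring R -> R x -> R y -> nonunit R (x * y) ->
  nonunit R x \/ nonunit R y.
Proof.
move=> sR Rx Ry h; apply: contrapT => /not_orP[].
move=> /(not_nonunit Rx)[x0 Rx'] /(not_nonunit Ry)[y0 Ry'].
apply: unit_not_nonunit h; first by rewrite mulf_neq0.
by rewrite invfM; apply: subringM.
Qed.

Lemma valuation_local V : valuation_ring V -> is_local V.
Proof.
move=> [sV hV]; split=> // x y hx hy.
have [->|x0] := eqVneq x 0; first by rewrite add0r.
have [->|y0] := eqVneq y 0; first by rewrite addr0.
have [h|h] := hV (x / y).
  have -> : x + y = (x / y + 1) * y by field.
  by apply: nonunitM => //; apply: subringD => //; apply: subring1.
have -> : x + y = (1 + (x / y)^-1) * x by field; rewrite ?x0 ?y0.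
by apply: nonunitM => //; apply: subringD => //; apply: subring1.
Qed.

Lemma localization_subring B Q : subring B -> prime_ideal B Q ->
  subring (localization B Q).
Proof.
move=> sB [[QB Q0] Q1 QD QM Qp]; have B1 := subring1 sB.
have BQ s t : (B `\` Q) s -> (B `\` Q) t -> (B `\` Q) (s * t).
  by move=> [Bs Qs] [Bt Qt]; split; [apply: subringM|move=> /Qp []].
have B0 s : (B `\` Q) s -> s != 0 by case=> _; apply: contra_not_neq => ->.
apply/subringP; split.
- by exists 1 => //; exists 1; rewrite ?divr1.
- move=> _ _ [a Ba [s hs <-]] [b Bb [t ht <-]].
  exists (a * t - b * s); last exists (s * t) => //.
  + by apply: subringB => //; apply: subringM => //; [case: ht|case: hs].
  + exact: BQ.
  + by field; rewrite !B0.
- move=> _ _ [a Ba [s hs <-]] [b Bb [t ht <-]].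
  exists (a * b); first exact: subringM.
  by exists (s * t); [exact: BQ|field; rewrite !B0].
Qed.

Lemma sub_localization B Q : subring B -> prime_ideal B Q -> B `<=` localization B Q.
Proof.
move=> sB [_ Q1 _ _ _] x Bx; exists x => //; exists 1; last by rewrite divr1.
by split=> //; apply: subring1.
Qed.

Lemma localization_unit B Q s : subring B -> prime_ideal B Q -> B s -> ~ Q s ->
  localization B Q s^-1.
Proof.
by move=> sB _ Bs Qs; exists 1; [apply: subring1|exists s; rewrite ?div1r].
Qed.

Lemma nonunit_localization B Q a s : subring B -> prime_ideal B Q ->
  B a -> B s -> ~ Q s -> nonunit (localization B Q) (a / s) <-> Q a.
Proof.
move=> sB pQ Ba Bs Qs; have [[QB Q0] Q1 QD QM Qp] := pQ.
have s0 : s != 0 by apply: contra_not_neq Qs => ->.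
split=> [[_ [|]]|Qa].
- by move=> /eqP; rewrite mulf_eq0 invr_eq0 (negPf s0) orbF => /eqP ->.
- move=> h; apply: contrapT => Qa; apply: h; rewrite invfM invrK.
  by exists s => //; exists a => //; rewrite mulrC.
split; first by exists a => //; exists s.
have [->|a0] := eqVneq a 0; first by left; rewrite mul0r.
right=> -[b Bb [t [Bt Qt] e]]; apply: Qt.
have t0 : t != 0.
  apply/eqP => t0; move/esym/eqP: e; rewrite t0 invr0 mulr0.
  by rewrite invr_eq0 mulf_eq0 invr_eq0 (negPf s0) (negPf a0).
have /QM/(_ Qa) : B b by [].
have -> : b * a = s * t.
  have -> : b = (b / t) * t by field.
  by rewrite e; field; rewrite a0 s0.
by case/Qp.
Qed.

Lemma localization_local B Q : subring B -> prime_ideal B Q ->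
  is_local (localization B Q).
Proof.
move=> sB pQ; have [[QB Q0] Q1 QD QM Qp] := pQ.
split; first exact: localization_subring.
move=> x y hx hy; case: (hx) (hy) => -[a Ba [s [Bs Qs] ex]] _.
case=> -[b Bb [t [Bt Qt] ey]] _.
rewrite -{}ex -{}ey in hx hy *.
have Qa : Q a by apply/(nonunit_localization sB pQ Ba Bs Qs).
have Qb : Q b by apply/(nonunit_localization sB pQ Bb Bt Qt).
have s0 : s != 0 by apply: contra_not_neq Qs => ->.
have t0 : t != 0 by apply: contra_not_neq Qt => ->.
have -> : a / s + b / t = (t * a + s * b) / (s * t) by field; rewrite ?s0 ?t0.
apply/nonunit_localization => //.
- by apply: subringD => //; apply: subringM.
- exact: subringM.
- by move=> /Qp [].
by apply: QD; apply: QM.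
Qed.

(* the local ring of Spec B at the centre of the local ring R *)
Definition centre R B := localization B [set x | B x /\ nonunit R x].

Lemma centre_prime R B : is_local R -> subring B -> B `<=` R ->
  prime_ideal B [set x | B x /\ nonunit R x].
Proof.
move=> lR sB BR; have sR := lR.1; split=> /=.
- by split=> [x []//|]; split; [apply: subring0|apply: nonunit0].
- by case=> _; apply: nonunit1.
- by move=> x y [Bx nx] [By ny]; split; [apply: subringD|apply: localD].
- move=> a x Ba [Bx nx]; split; first exact: subringM.
  by apply: nonunitM => //; apply: BR.
- move=> a b Ba Bb [_ h]; have [] := local_prime sR (BR _ Ba) (BR _ Bb) h.
    by left.
  by right.
Qed.

Lemma centre_sub R B : is_local R -> subring B -> B `<=` R -> B `<=` centre R B.
Proof. by move=> *; apply: sub_localization => //; apply: centre_prime. Qed.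

Lemma centreP R B x : subring B -> B `<=` R -> (centre R B) x <->
  exists a s, [/\ B a, B s, s != 0, R s^-1 & x = a / s].
Proof.
move=> sB BR; split=> [[a Ba [s [Bs hs] <-]]|[a [s [Ba Bs s0 Rs ->]]]].
  have [s0 Rs] : s != 0 /\ R s^-1.
    by apply: not_nonunit => [|ns]; [apply: BR|apply: hs].
  by exists a, s.
exists a => //; exists s => //; split=> //= -[_].
exact: unit_not_nonunit.
Qed.

Lemma centre_scale R B m b s : subring R -> subring B -> B `<=` R ->
  m != 0 -> s != 0 -> R m^-1 -> R s^-1 -> B (m * b) -> B (m * s) -> centre R B (b / s).
Proof.
move=> sR sB BR m0 s0 Rm Rs Bb Bs; apply/centreP => //; exists (m * b), (m * s).
split=> //; first by rewrite mulf_neq0.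
  by rewrite invfM; apply: subringM.
by field; rewrite m0 s0.
Qed.

Lemma centre_dominated R B : is_local R -> subring B -> B `<=` R ->
  dominates R (centre R B).
Proof.
move=> lR sB BR; have sR := lR.1; split=> [x /centreP|x /centreP].
  by case=> // a [s [Ba Bs s0 Rs ->]]; apply: subringM => //; apply: BR.
case=> // a [s [Ba Bs s0 Rs ->]] h; apply/centreP => //.
have [->|a0] := eqVneq a 0.
  by exists 0, 1; rewrite invr1 !mul0r invr0 oner_neq0; split=> //;
     [apply: subring0|apply: subring1|apply: subring1].
exists s, a; split=> //; last by rewrite invfM invrK mulrC.
have -> : a^-1 = (a / s)^-1 * s^-1 by field; rewrite ?a0 ?s0.
exact: subringM.
Qed.

Lemma dominates_refl A : dominates A A.
Proof. by split. Qed.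

Lemma dominates_trans B A C : dominates C B -> dominates B A -> dominates C A.
Proof.
move=> [BC h] [AB h']; split=> x Ax; first by apply/BC/AB.
by move=> Cx; apply: h' => //; apply: h => //; apply: AB.
Qed.

(** Domination forces [Q] to be the contraction of the maximal ideal of [R], so a local ring of
    [Spec B] dominated by [R] is determined by [R]. *)
Lemma dominated_centre R B Q : subring B -> prime_ideal B Q -> subring R ->
  dominates R (localization B Q) ->
  B `<=` R /\ localization B Q = centre R B.
Proof.
move=> sB pQ sR [LR h]; have BL := sub_localization sB pQ.
have BR : B `<=` R by move=> x /BL/LR.
split=> //; congr localization; have [[QB Q0] _ _ _ _] := pQ.
apply/seteqP; split=> x.
  move=> Qx; split; first exact: QB.
  have nx : nonunit (localization B Q) x.
    by rewrite -[x]divr1; apply/nonunit_localization => //;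
       [apply: QB|apply: subring1|case: pQ].
  split; first exact/LR/BL/QB.
  case: nx => Lx [|nx]; [by left|right=> Rx; apply: nx].
  exact: h.
case=> Bx [Rx nx]; apply: contrapT => Qx.
have x0 : x != 0 by apply: contra_not_neq Qx => ->.
case: nx => [/eqP|]; first by rewrite (negPf x0).
by apply; apply: LR; apply: localization_unit.
Qed.

Lemma localization_centre B Q : subring B -> prime_ideal B Q ->
  localization B Q = centre (localization B Q) B.
Proof.
move=> sB pQ; apply: (dominated_centre sB pQ _ (dominates_refl _)).2.
exact: localization_subring.
Qed.

(** The elements added by [B'] are already fractions over [B] with denominators invertible in [R].
    This compares overlapping charts. *)
Lemma centre_eq R B B' : subring R -> subring B -> subring B' -> B `<=` B' ->
  B' `<=` R -> B' `<=` centre R B -> centre R B' = centre R B.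
Proof.
move=> sR sB sB' BB' B'R hB'; have BR := subset_trans BB' B'R.
apply/seteqP; split=> x /centreP.
  case=> // a [s [/hB' + + s0 Rs ->]] => /centreP [] // a1 [s1 [Ba1 Bs1 s10 Rs1 ea]].
  move=> /hB' /centreP [] // a2 [s2 [Ba2 Bs2 s20 Rs2 es]].
  have a20 : a2 != 0 by apply/eqP => a20; move: s0; rewrite es a20 mul0r eqxx.
  apply/centreP => //; exists (a1 * s2), (s1 * a2); split.
  - exact: subringM.
  - exact: subringM.
  - by rewrite mulf_neq0.
  - rewrite invfM; apply: subringM => //.
    have -> : a2^-1 = s^-1 * s2^-1 by rewrite es; field; rewrite ?a20 ?s20.
    exact: subringM.
  - by rewrite ea es; field; rewrite ?s10 ?s20 ?a20.
case=> // a [s [Ba Bs s0 Rs ->]]; apply/centreP => //.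
by exists a, s; split=> //; apply: BB'.
Qed.

Lemma aff_centre R B : is_local R -> subring B -> B `<=` R -> aff B (centre R B).
Proof.
move=> lR sB BR; exists [set x | B x /\ nonunit R x] => //.
exact: centre_prime.
Qed.

Lemma affE B (y : set K) : subring B -> aff B y -> [/\ is_local y, B `<=` y & y = centre y B].
Proof.
move=> sB [Q pQ <-]; split; first exact: localization_local.
  exact: sub_localization.
exact: localization_centre.
Qed.

Lemma aff_dominated R B (y : set K) : subring B -> aff B y -> subring R -> dominates R y ->
  B `<=` R /\ y = centre R B.
Proof. by move=> sB [Q pQ <-]; apply: dominated_centre. Qed.

End Subrings.

(** * Existence of dominating valuation rings *)

Section Chevalley.
Variable K : fieldType.
Implicit Types (A B I J R V : set K) (x y : K) (p r : {poly K}).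

Definition is_ideal B I : Prop :=
  [/\ I `<=` B, I 0, forall x y, I x -> I y -> I (x + y)
    & forall a x, B a -> I x -> I (a * x)].

Definition coefs_in (S : set K) p := forall i, S p`_i.

(** For a subring this is [S[x]]; for an ideal [J] of [R] it is the extended ideal [J R[x]]. *)
Definition values (S : set K) x := [set p.[x] | p in coefs_in S].

Lemma values_subring R x : subring R -> subring (values R x).
Proof.
move=> sR; apply/subringP; split.
- exists 1; last by rewrite hornerC.
  move=> i; rewrite coef1; case: eqP => _; [exact: subring1|exact: subring0].
- move=> _ _ [p hp <-] [r hr <-]; exists (p - r); last by rewrite hornerD hornerN.
  by move=> i; rewrite coefB; apply: subringB.
- move=> _ _ [p hp <-] [r hr <-]; exists (p * r); last by rewrite hornerM.
  by move=> i; rewrite coefM; apply: subring_sum => // j _; apply: subringM.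
Qed.

Lemma values_sub R x : subring R -> R `<=` values R x.
Proof.
move=> sR a Ra; exists a%:P; last by rewrite hornerC.
by move=> i; rewrite coefC; case: eqP => // _; apply: subring0.
Qed.

Lemma values_mem R x : subring R -> values R x x.
Proof.
move=> sR; exists 'X; last by rewrite hornerX.
move=> i; rewrite coefX; case: eqP => _; [exact: subring1|exact: subring0].
Qed.

Lemma ideal_sum B I (T : Type) (s : seq T) (S : pred T) (f : T -> K) :
  is_ideal B I -> (forall i, S i -> I (f i)) -> I (\sum_(i <- s | S i) f i).
Proof. by move=> [_ I0 ID _] h; apply: big_ind. Qed.

Lemma values_ideal R J x : subring R -> is_ideal R J ->
  is_ideal (values R x) (values J x).
Proof.
move=> sR iJ; have [JR J0 JD JM] := iJ; split.
- by move=> _ [p hp <-]; exists p => // i; apply: JR.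
- by exists 0; rewrite ?horner0 // => i; rewrite coef0.
- move=> _ _ [p hp <-] [r hr <-]; exists (p + r); last by rewrite hornerD.
  by move=> i; rewrite coefD; apply: JD.
- move=> _ _ [p hp <-] [r hr <-]; exists (p * r); last by rewrite hornerM.
  by move=> i; rewrite coefM; apply: (ideal_sum (B := R)) => // j _; apply: JM.
Qed.

Section Maximal.
Variables (R J : set K).
Hypotheses (sR : subring R) (iJ : is_ideal R J) (J1 : ~ J 1).
Hypothesis maxRJ : forall R' J', subring R' -> is_ideal R' J' -> ~ J' 1 ->
  R `<=` R' -> J `<=` J' -> R' `<=` R.

Let J_sub1 j : J j -> 1 - j != 0.
Proof. by move=> Jj; apply/eqP => /subr0_eq e; apply: J1; rewrite e. Qed.

(** Localizing at the multiplicative set [1 + J] keeps the extension of [J] proper, so by maximality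
    it adds nothing to [R]. *)
Lemma maximal_unit j : J j -> R (1 - j)^-1.
Proof.
move=> Jj; have [JR J0 JD JM] := iJ; have R1 := subring1 sR.
have JN i : J i -> J (- i).
  by move=> Ji; rewrite -mulN1r; apply: JM => //; apply: subringN.
pose M (S : set K) := [set a / (1 - i) | a in S & i in J].
have e (i i' : K) : (1 - i) * (1 - i') = 1 - (i + i' - i * i') by ring.
have JJ i i' : J i -> J i' -> J (i + i' - i * i').
  by move=> Ji Ji'; apply: (JD); [apply: JD|apply/JN/JM => //; apply: JR].
have RJ i : J i -> R (1 - i) by move=> Ji; apply: subringB => //; apply: JR.
suff MR : M R `<=` R by apply: MR; exists 1 => //; exists j; rewrite ?div1r.
apply: (maxRJ (J' := M J)).
- apply/subringP; split.
  + by exists 1 => //; exists 0; rewrite // subr0 divr1.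
  + move=> _ _ [a Ra [i Ji <-]] [b Rb [i' Ji' <-]].
    exists (a * (1 - i') - b * (1 - i)).
      by apply: subringB => //; apply: subringM => //; apply: RJ.
    exists (i + i' - i * i'); first exact: JJ.
    by rewrite -e; field; rewrite !J_sub1.
  + move=> _ _ [a Ra [i Ji <-]] [b Rb [i' Ji' <-]].
    exists (a * b); first exact: subringM.
    exists (i + i' - i * i'); first exact: JJ.
    by rewrite -e; field; rewrite !J_sub1.
- split.
  + by move=> _ [a Ja [i Ji <-]]; exists a; [apply: JR|exists i].
  + by exists 0 => //; exists 0; rewrite // mul0r.
  + move=> _ _ [a Ra [i Ji <-]] [b Rb [i' Ji' <-]].
    exists (a * (1 - i') + b * (1 - i)).
      by apply: JD => //; rewrite mulrC; apply: JM => //; apply: RJ.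
    exists (i + i' - i * i'); first exact: JJ.
    by rewrite -e; field; rewrite !J_sub1.
  + move=> _ _ [a Ra [i Ji <-]] [b Rb [i' Ji' <-]].
    exists (a * b); first exact: JM.
    exists (i + i' - i * i'); first exact: JJ.
    by rewrite -e; field; rewrite !J_sub1.
- case=> a Ja [i Ji e1]; apply: J1.
  have -> : 1 = a + i :> K.
    by have := divfK (J_sub1 Ji) a; rewrite e1 mul1r => <-; rewrite subrK.
  exact: JD.
- by move=> a Ra; exists a => //; exists 0; rewrite // subr0 divr1.
- by move=> a Ra; exists a => //; exists 0; rewrite // subr0 divr1.
Qed.

(** Otherwise [R[x]] with the ideal [J R[x]] would be a larger pair. *)
Lemma maximal_values x : ~ R x -> values J x 1.
Proof.
move=> Rx; apply: contrapT => J1'; apply: Rx.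
suff h : values R x `<=` R by apply/h/values_mem.
apply: (maxRJ (J' := values J x)) => //.
- exact: values_subring.
- exact: values_ideal.
- exact: values_sub.
move=> a Ja; exists a%:P; last by rewrite hornerC.
by move=> i; rewrite coefC; case: eqP => // _; case: iJ.
Qed.

(** Since [1 - r_0] is a unit, the relation in [x^-1], multiplied by [x ^ n], expresses [x ^ n]
    through lower powers with coefficients in [J]; substituting this for the top term of [p] lowers
    its degree. Degree zero is impossible because [J] does not contain 1. *)
Lemma maximal_reduce x n m p r : x != 0 -> (m <= n)%N ->
  coefs_in J p -> coefs_in J r -> (size p <= n.+1)%N -> (size r <= m.+1)%N ->
  p.[x] = 1 -> r.[x^-1] = 1 ->
  exists n', [/\ n = n'.+1 & exists p', [/\ coefs_in J p', (size p' <= n'.+1)%N & p'.[x] = 1]].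
Proof.
move=> x0 mn Jp Jr sp sr px rx; have [JR J0 JD JM] := iJ.
case: n => [|n'] in mn sp *.
  by case: J1; rewrite -px (size1_polyC sp) hornerC.
exists n'; split=> //; set n := n'.+1 in mn sp *.
pose c := (1 - r`_0)^-1.
exists (\poly_(i < n) (p`_i + p`_n * c * r`_(n - i))); split.
- move=> i; rewrite coef_poly; case: ifP => // _; apply: JD => //.
  rewrite mulrAC mulrC; apply: (JM); first exact: maximal_unit.
  by apply: JM => //; apply: JR.
- exact: size_poly.
have er : \sum_(i < n) r`_(n - i) * x ^+ i = (1 - r`_0) * x ^+ n.
  have {rx} : 1 - r`_0 = \sum_(i < n) r`_i.+1 * x^-1 ^+ i.+1.
    rewrite -rx (@horner_coef_wide _ n.+1) ?(leq_trans sr) // big_ord_recl.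
    by rewrite expr0 mulr1 addrAC subrr add0r.
  move=> ->; rewrite mulr_suml [LHS](reindex_inj rev_ord_inj) /=.
  apply: eq_bigr => i _; rewrite subKn //.
  rewrite -mulrA; congr (_ * _); rewrite exprVn.
  apply: (mulfI (expf_neq0 i.+1 x0)); rewrite -exprD mulrA mulfV ?expf_neq0 //.
  by rewrite mul1r subnKC.
rewrite horner_poly; under eq_bigr do rewrite mulrDl -(mulrA (p`_n * c)).
rewrite big_split -mulr_sumr er /= -(mulrA p`_n) (mulrA c) mulVf ?J_sub1 // mul1r.
by rewrite -px (horner_coef_wide _ sp) [RHS]big_ord_recr.
Qed.

Lemma maximal_valuation : valuation_ring R.
Proof.
split=> // x; apply: contrapT => /not_orP[Rx Rx'].
have x0 : x != 0 by apply/eqP => x0; apply: Rx; rewrite x0; apply: subring0.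
have [p Jp px] := maximal_values Rx; have [r Jr rx] := maximal_values Rx'.
(* The descent is on [n + m]: the larger of the two degrees drops, and [x] and [x^-1] exchange roles
   when [n < m]. *)
suff main N : forall x n m p r, x != 0 -> (size p <= n.+1)%N ->
    (size r <= m.+1)%N -> coefs_in J p -> coefs_in J r -> p.[x] = 1 ->
    r.[x^-1] = 1 -> (n + m < N)%N -> False.
  exact: (main _ x _ _ p r x0 (leqnSn _) (leqnSn _) Jp Jr px rx (ltnSn _)).
move=> {x Rx Rx' x0 p r Jp Jr px rx}.
elim: N => // N IH x n m p r x0 sp sr Jp Jr px rx nmN.
have [mn|nm] := leqP m n.
  have [n' [en [p' [Jp' sp' px']]]] := maximal_reduce x0 mn Jp Jr sp sr px rx.
  by apply: (IH x n' m p' r) => //; lia.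
have px' : p.[x^-1^-1] = 1 by rewrite invrK.
have x0' : x^-1 != 0 by rewrite invr_eq0.
have [m' [em [r' [Jr' sr' rx']]]] :=
  maximal_reduce x0' (ltnW nm) Jr Jp sr sp rx px'.
by apply: (IH x n m' p r') => //; lia.
Qed.

End Maximal.

Theorem chevalley B I : subring B -> is_ideal B I -> ~ I 1 ->
  exists V, [/\ valuation_ring V, B `<=` V & I `<=` nonunit V].
Proof.
move=> sB iI I1.
pose rng (S : set (K * bool)) := [set x | S (x, true)].
pose idl (S : set (K * bool)) := [set x | S (x, false)].
pose good S := [/\ subring (rng S), is_ideal (rng S) (idl S), ~ idl S 1,
                   B `<=` rng S & I `<=` idl S].
pose mk (R J : set K) := [set u : K * bool | if u.2 then R u.1 else J u.1].
have good_mk R J : subring R -> is_ideal R J -> ~ J 1 -> B `<=` R -> I `<=` J ->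
  good (mk R J) by [].
have [F FP Ftot|S [PS maxS]] := @Zorn_bigcup (K * bool)%type
    [set S | S = set0 \/ good S].
  have [[S0 FS0 gS0]|noF] := pselect (exists2 S, F S & good S); last first.
    left; apply/seteqP; split=> // u [S FS Su].
    case: (FP _ FS) => [S0|gS]; first by rewrite S0 in Su.
    by apply: noF; exists S.
  have mem1 u : (\bigcup_(X in F) X) u -> exists S, [/\ F S, good S & S u].
    move=> [S FS Su]; exists S; split=> //.
    by case: (FP _ FS) => // S1; rewrite S1 in Su.
  have mem2 u v : (\bigcup_(X in F) X) u -> (\bigcup_(X in F) X) v ->
      exists S, [/\ F S, good S, S u & S v].
    move=> /mem1[S [FS gS Su]] /mem1[S' [FS' gS' Sv]].
    have [h|h] := Ftot _ _ FS FS'; first by exists S'; split=> //; apply: h.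
    by exists S; split=> //; apply: h.
  right; split.
  - apply/subringP; split.
    + by exists S0 => //; case: gS0 => s _ _ _ _; apply: (subring1 s).
    + move=> x y hx hy; have [S [FS gS Sx Sy]] := mem2 _ _ hx hy.
      by exists S => //; case: gS => s _ _ _ _; apply: (subringB s).
    + move=> x y hx hy; have [S [FS gS Sx Sy]] := mem2 _ _ hx hy.
      by exists S => //; case: gS => s _ _ _ _; apply: (subringM s).
  - split.
    + move=> x [S FS Sx]; exists S => //.
      by case: (FP _ FS) => [S1|[_ [h _ _ _] _ _ _]];
        [rewrite S1 in Sx|apply: h].
    + by exists S0 => //; case: gS0 => _ [].
    + move=> x y hx hy; have [S [FS gS Sx Sy]] := mem2 _ _ hx hy.
      by exists S => //; case: gS => _ [_ _ h _] _ _ _; apply: h.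
    + move=> x y hx hy; have [S [FS gS Sx Sy]] := mem2 _ _ hx hy.
      by exists S => //; case: gS => _ [_ _ _ h] _ _ _; apply: h.
  - by move=> /mem1[S [_ [_ _ h _ _]]].
  - by move=> x Bx; exists S0 => //; case: gS0 => _ _ _ h _; apply: h.
  - by move=> x Bx; exists S0 => //; case: gS0 => _ _ _ _ h; apply: h.
have {PS} [S0|gS] := PS.
  (* The empty set is not maximal, being strictly contained in the code of [B] and [I]. *)
  case: (maxS (mk B I)); last by right; apply: good_mk.
  rewrite S0; split; first by [].
  by move=> h; have /h : (mk B I) (1, true) by apply: subring1.
have [sR iJ J1 BR IJ] := gS.
have maxRJ R' J' : subring R' -> is_ideal R' J' -> ~ J' 1 ->
    rng S `<=` R' -> idl S `<=` J' -> R' `<=` rng S.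
  move=> sR' iJ' J'1 RR' JJ'; apply: contrapT => h.
  apply: (maxS (mk R' J')); last first.
    by right; apply: good_mk => //; apply: subset_trans; eassumption.
  split; first by case=> x [] /=; [apply: RR'|apply: JJ'].
  by move=> h'; apply: h => x Rx; apply: (h' (x, true)).
exists (rng S); split=> //; first exact: maximal_valuation maxRJ.
move=> x Ix; have [JR _ _ JM] := iJ; split; first exact/JR/IJ.
have [->|x0] := eqVneq x 0; [by left|right=> Rx].
by apply: J1; rewrite -(mulVf x0); apply: JM => //; apply: IJ.
Qed.

End Chevalley.

(** * Discrete valuations *)

Section DiscreteValuations.
Variable F : fieldType.
Implicit Types (A R W : set F) (x y u : F) (n m : int).

(** [ord A 0] is an arbitrary value, so zero is given infinite order by hand. *)
Definition val_ge A n x := x = 0 \/ n <= ord A x.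

Lemma uniformizer_neq0 A u : subring A -> uniformizer A u -> u != 0.
Proof.
by move=> sA [Au nAu _]; apply/eqP => u0; apply: nAu; rewrite u0 invr0; apply: subring0.
Qed.

Lemma uniformizer_exp_ge0 A u n : subring A -> uniformizer A u -> A (u ^ n) -> 0 <= n.
Proof.
move=> sA uu Aun; case: n Aun => // m Aun; case: (uu) => Au nAu _; case: nAu.
have u0 := uniformizer_neq0 sA uu.
have -> : u^-1 = u ^+ m * u ^ (Negz m).
  by rewrite /exprz exprS; field; rewrite u0 expf_neq0.
by apply: subringM => //; apply: subringX.
Qed.

Lemma uniformizer_exp_eq A u x n m : subring A -> uniformizer A u -> x != 0 ->
  A (x / u ^ n) -> A (u ^ n / x) -> A (x / u ^ m) -> A (u ^ m / x) -> n = m.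
Proof.
move=> sA uu x0 h1 h2 h3 h4; have u0 := uniformizer_neq0 sA uu.
have key i j : A (x / u ^ i) -> A (u ^ j / x) -> i <= j.
  move=> hi hj; rewrite -subr_ge0; apply: (uniformizer_exp_ge0 sA uu).
  have -> : u ^ (j - i) = (u ^ j / x) * (x / u ^ i).
    by rewrite expfzDr // -invr_expz mulrA divfK.
  exact: subringM.
by apply/eqP; rewrite eq_le !key.
Qed.

(** Up to units [u'] is [u ^ n] and [u] is [u' ^ m] with [n] and [m] positive, whence [n m = 1].
    This makes [ord] independent of the chosen uniformizer. *)
Lemma uniformizer_associate A u u' : subring A -> uniformizer A u ->
  uniformizer A u' -> A (u' / u) /\ A (u / u').
Proof.
move=> sA uu uu'; have u0 := uniformizer_neq0 sA uu.
have u0' := uniformizer_neq0 sA uu'.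
have [Au nAu hu] := uu; have [Au' nAu' hu'] := uu'.
have pos v w n : uniformizer A v -> w != 0 -> A w -> ~ A w^-1 ->
    A (w / v ^ n) -> A (v ^ n / w) -> 1 <= n.
  move=> vv w0 Aw nAw h1 h2.
  have : 0 <= n.
    apply: (uniformizer_exp_ge0 sA vv).
    by rewrite -(divfK w0 (v ^ n)); apply: subringM.
  rewrite le_eqVlt => /orP[/eqP n0|]; last by rewrite -gtz0_ge1.
  by case: nAw; move: h2; rewrite -n0 expr0z div1r.
have [n [h1 h2]] := hu _ u0'; have [m [h3 h4]] := hu' _ u0.
have n1 := pos _ _ _ uu u0' Au' nAu' h1 h2.
have m1 := pos _ _ _ uu' u0 Au nAu h3 h4.
case: m m1 h3 h4 => // m m1 h3 h4.
have e : n * m = 1.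
  apply/eqP; rewrite eq_le; apply/andP; split; rewrite -subr_ge0;
    apply: (uniformizer_exp_ge0 sA uu); rewrite expfzDr // -invr_expz -exprz_exp expr1z.
    have -> : u / (u ^ n) ^ m = (u' / u ^ n) ^+ m * (u / u' ^ m).
      rewrite -!exprnP exprMn exprVn; field.
      by rewrite !expf_neq0 ?expfz_neq0.
    by apply: subringM => //; apply: subringX.
  have -> : (u ^ n) ^ m / u = (u ^ n / u') ^+ m * (u' ^ m / u).
    rewrite -!exprnP exprMn exprVn; field.
    by rewrite u0 !expf_neq0 ?expfz_neq0.
  by apply: subringM => //; apply: subringX.
have n1' : n = 1 by nia.
by move: h1 h2; rewrite n1' expr1z.
Qed.

Lemma ordP A u x : dvr A -> uniformizer A u -> x != 0 ->
  A (x / u ^ ord A x) /\ A (u ^ ord A x / x).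
Proof.
move=> [sA _] uu x0; rewrite /ord; case: xgetP => [n _ [u' uu' [h1 h2]]|]; last first.
  by case: (uu) => _ _ /(_ _ x0)[n h] /(_ n) []; exists u.
have u0 := uniformizer_neq0 sA uu; have u0' := uniformizer_neq0 sA uu'.
have [a1 a2] := uniformizer_associate sA uu uu'.
have A1 j : A ((u' / u) ^ j).
  by case: j => j; rewrite /exprz -?exprVn ?invf_div; apply: subringX.
split.
  have -> : x / u ^ n = (x / u' ^ n) * (u' / u) ^ n.
    by rewrite expfzMl exprz_inv -invr_expz mulrA divfK ?expfz_neq0.
  exact: subringM.
have -> : u ^ n / x = (u' ^ n / x) * (u' / u) ^ (- n).
  rewrite -exprz_inv invf_div expfzMl exprz_inv -invr_expz.
  by field; rewrite x0 expfz_neq0.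
exact: subringM.
Qed.

Lemma ord_eq A u x n : dvr A -> uniformizer A u -> x != 0 ->
  A (x / u ^ n) -> A (u ^ n / x) -> ord A x = n.
Proof.
move=> dA uu x0 h1 h2; have [h3 h4] := ordP dA uu x0.
exact: (uniformizer_exp_eq dA.1 uu x0).
Qed.

Lemma val_geE A u n x : dvr A -> uniformizer A u -> val_ge A n x <-> A (x / u ^ n).
Proof.
move=> dA uu; have sA := dA.1; have u0 := uniformizer_neq0 sA uu.
have [->|x0] := eqVneq x 0.
  by split=> _; [rewrite mul0r; apply: subring0|left].
have [h1 h2] := ordP dA uu x0; split=> [[/eqP|h]|h].
- by rewrite (negPf x0).
- rewrite -(subrK n (ord A x)) in h1.
  have -> : x / u ^ n = (x / u ^ ord A x) * u ^ (ord A x - n).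
    by rewrite expfzDr // -invr_expz mulrA divfK ?expfz_neq0.
  apply: subringM => //; first by rewrite subrK in h1.
  move: h; rewrite -subr_ge0; case: (ord A x - n) => // m _.
  by apply: subringX => //; case: uu.
- right; rewrite -subr_ge0; apply: (uniformizer_exp_ge0 sA uu).
  have -> : u ^ (ord A x - n) = (u ^ ord A x / x) * (x / u ^ n).
    by rewrite expfzDr // -invr_expz mulrA divfK.
  exact: subringM.
Qed.

Section Valuation.
Variable A : set F.
Hypothesis dA : dvr A.
Let sA : subring A := dA.1.

Lemma val_ge0 x : val_ge A 0 x <-> A x.
Proof. by case: dA => _ [u uu]; rewrite (val_geE _ _ dA uu) expr0z divr1. Qed.

Lemma val_ge_le n m x : m <= n -> val_ge A n x -> val_ge A m x.
Proof. by move=> mn [->|h]; [left|right; apply: le_trans h]. Qed.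

Lemma val_ge_zero n : val_ge A n 0.
Proof. by left. Qed.

Lemma val_geD n x y : val_ge A n x -> val_ge A n y -> val_ge A n (x + y).
Proof.
case: dA => _ [u uu]; rewrite !(val_geE _ _ dA uu) mulrDl; exact: subringD.
Qed.

Lemma val_geN n x : val_ge A n x -> val_ge A n (- x).
Proof.
case: dA => _ [u uu]; rewrite !(val_geE _ _ dA uu) mulNr; exact: subringN.
Qed.

Lemma val_geB n x y : val_ge A n x -> val_ge A n y -> val_ge A n (x - y).
Proof. by move=> hx hy; apply: val_geD => //; apply: val_geN. Qed.

Lemma val_ge_sum n (I : Type) (r : seq I) (S : pred I) (f : I -> F) :
  (forall i, S i -> val_ge A n (f i)) -> val_ge A n (\sum_(i <- r | S i) f i).
Proof.
by move=> h; apply: big_ind => //; [apply: val_ge_zero|apply: val_geD].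
Qed.

Lemma ordM x y : x != 0 -> y != 0 -> ord A (x * y) = ord A x + ord A y.
Proof.
case: dA => _ [u uu] x0 y0; have u0 := uniformizer_neq0 sA uu.
have [h1 h2] := ordP dA uu x0; have [h3 h4] := ordP dA uu y0.
apply: (ord_eq dA uu); rewrite ?mulf_neq0 // expfzDr //.
  by rewrite invfM mulrACA; apply: subringM.
by rewrite invfM mulrACA; apply: subringM.
Qed.

Lemma ord_one : ord A 1 = 0.
Proof.
by apply: (addrI (ord A 1)); rewrite -ordM ?oner_neq0 // mulr1 addr0.
Qed.

Lemma ordV x : x != 0 -> ord A x^-1 = - ord A x.
Proof.
move=> x0; apply: (addrI (ord A x)).
by rewrite -ordM ?invr_eq0 // mulfV // ord_one subrr.
Qed.

Lemma ordX x (n : nat) : x != 0 -> ord A (x ^+ n) = n%:Z * ord A x.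
Proof.
move=> x0; elim: n => [|n IH]; first by rewrite expr0 ord_one mul0r.
by rewrite exprS ordM ?expf_neq0 // IH -addn1 PoszD mulrDl mul1r addrC.
Qed.

Lemma ord_ge0 x : x != 0 -> 0 <= ord A x -> A x.
Proof. by move=> x0 h; apply/val_ge0; right. Qed.

Lemma val_ge_ord n x : x != 0 -> val_ge A n x -> n <= ord A x.
Proof. by move=> /eqP x0 []. Qed.

Lemma val_geM n m x y : val_ge A n x -> val_ge A m y -> val_ge A (n + m) (x * y).
Proof.
move=> hx hy; have [->|x0] := eqVneq x 0; first by rewrite mul0r; left.
have [->|y0] := eqVneq y 0; first by rewrite mulr0; left.
by right; rewrite ordM // lerD // val_ge_ord.
Qed.

Lemma val_geX n (m : nat) x : val_ge A n x -> (0 < m)%N -> val_ge A (m%:Z * n) (x ^+ m).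
Proof.
move=> [->|h] m0; first by left; rewrite expr0n; case: m m0.
have [->|x0] := eqVneq x 0; first by left; rewrite expr0n; case: m m0.
by right; rewrite ordX // ler_wpM2l.
Qed.

Lemma ord_uniformizer : exists2 u, u != 0 & forall n, ord A (u ^ n) = n.
Proof.
case: dA => _ [u uu]; have u0 := uniformizer_neq0 sA uu; exists u => // n.
by apply: (ord_eq dA uu); rewrite ?divff ?expfz_neq0 //; apply: subring1.
Qed.

Lemma dvr_valuation : valuation_ring A.
Proof.
split=> // x; have [->|x0] := eqVneq x 0; first by left; apply: subring0.
have [h|h] := leP 0 (ord A x); [left|right]; apply: ord_ge0; rewrite ?invr_eq0 //.
by rewrite ordV // oppr_ge0 ltW.
Qed.

Lemma nonunitE x : nonunit A x <-> val_ge A 1 x.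
Proof.
have [->|x0] := eqVneq x 0; first by split=> _; [left|apply: nonunit0].
split=> [[Ax [/eqP|h]]|h].
- by rewrite (negPf x0).
- right; rewrite -gtz0_ge1 ltNge; apply/negP => h'; apply: h.
  by apply: ord_ge0; rewrite ?invr_eq0 // ordV // oppr_ge0.
- split; first by apply/val_ge0; apply: val_ge_le h.
  right=> /val_ge0 /val_ge_ord; rewrite invr_eq0 => /(_ x0).
  by move: (val_ge_ord x0 h); rewrite ordV //; lia.
Qed.

(** An element of negative order yields [u^-1] in [W], and then every unit of [A] times every power
    of [u]. *)
Lemma dvr_max W x : subring W -> A `<=` W -> W x -> ~ A x -> W = setT.
Proof.
move=> sW AW Wx nAx; case: dA => _ [u uu]; have u0 := uniformizer_neq0 sA uu.
have x0 : x != 0 by apply/eqP => x0; apply: nAx; rewrite x0; apply: subring0.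
have [h1 h2] := ordP dA uu x0; have [Au nAu _] := uu.
have Wu : W u^-1.
  have : ord A x < 0.
    by rewrite ltNge; apply/negP => h; apply: nAx; apply: ord_ge0.
  move: h2; case: (ord A x) => // m h2 _.
  have -> : u^-1 = x * (u ^+ m * (u ^ (Negz m) / x)).
    by rewrite /exprz exprS; field; rewrite x0 u0 expf_neq0.
  apply: subringM => //; apply: AW; apply: subringM => //; exact: subringX.
apply/seteqP; split=> // y _; have [->|y0] := eqVneq y 0; first exact: subring0.
have [h3 _] := ordP dA uu y0; rewrite -(divfK (expfz_neq0 (ord A y) u0) y).
apply: subringM => //; first exact: AW.
by case: (ord A y) => j; rewrite /exprz -?exprVn; apply: subringX => //; apply: AW.
Qed.

Lemma dvr_proper : A <> setT.
Proof. by case: dA => _ [u [_ h _]] e; apply: h; rewrite e. Qed.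

(** A nonzero term of least order is isolated: every other term has strictly larger order, so
    nothing cancels it. *)
Lemma val_ge_distinct (I : finType) (f : I -> F) n :
  (forall i j, f i != 0 -> f j != 0 -> ord A (f i) = ord A (f j) -> i = j) ->
  val_ge A n (\sum_i f i) -> forall i, val_ge A n (f i).
Proof.
move=> hf hs i0; have [->|f0] := eqVneq (f i0) 0; first by left.
case: (@Order.TotalTheory.arg_minP _ _ _ i0 (fun i => f i != 0) (fun i => ord A (f i)) f0).
move=> i fi0 hmin; right; apply: le_trans (hmin _ f0).
rewrite leNgt; apply/negP => lt_i.
have : val_ge A (ord A (f i) + 1) (f i).
  have e : f i = (\sum_i f i) - \sum_(j | j != i) f j.
    by rewrite (bigD1 i) //= addrK.
  rewrite {2}e {e}.
  apply: val_geB; first by apply: val_ge_le hs; rewrite lezD1.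
  apply: val_ge_sum => j ji; have [->|fj0] := eqVneq (f j) 0; first by left.
  right; have := hmin _ fj0; rewrite le_eqVlt => /orP[/eqP e|]; last by rewrite lezD1.
  by move: ji; rewrite (hf _ _ fi0 fj0 e) eqxx.
by move=> /(val_ge_ord fi0); rewrite lezD1 ltxx.
Qed.

End Valuation.
End DiscreteValuations.

(** * Closed points of a complete curve *)

Section CompleteCurve.
Variables (k : closedFieldType) (F : fieldType) (iota : {rmorphism k -> F}).
Variable E : set (set F).
Hypothesis hE : smooth_projective_curve iota E.
Implicit Types (P Q V : set F) (f x : F) (p : {poly k}).
Let k0 : set F := range iota.
Let pt := closed_points E.

Lemma const_subring : subring k0.
Proof.
apply/subringP; split; first by exists 1; rewrite ?rmorph1.
- by move=> _ _ [a _ <-] [b _ <-]; exists (a - b); rewrite ?rmorphB.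
- by move=> _ _ [a _ <-] [b _ <-]; exists (a * b); rewrite ?rmorphM.
Qed.

Lemma curve_chart y : E y -> exists s : seq F,
  [/\ aff (adjoin k0 s) y, aff (adjoin k0 s) `<=` E &
      localization (adjoin k0 s) [set 0] = setT].
Proof.
have [[[l [-> hl]] _] _ _] := hE.
case=> s /= sl hs; exists s; split=> //; last exact: hl.
by move=> z hz; exists s.
Qed.

Lemma pt_dvr P : pt P -> dvr P.
Proof. by case: hE => _ _; apply. Qed.

Lemma const_sub y : E y -> k0 `<=` y.
Proof.
move=> /curve_chart[s [/(affE (adjoin_subring _ _)) [_ h _] _ _]].
exact: subset_trans (@adjoin_sub _ _ _) h.
Qed.

Lemma pt_const P c : pt P -> P (iota c).
Proof. by case=> /const_sub h _; apply: h; exists c. Qed.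

Lemma exists_pt : exists P, pt P.
Proof. by case: hE => _ [P hP] _; exists P. Qed.

(** The centre of [V] given by completeness is either the generic point, which forces [V] to be the
    whole field, or a discrete valuation ring inside [V]; such rings are maximal, so the centre is
    [V] itself. *)
Lemma valuation_pt V : valuation_ring V -> k0 `<=` V -> V <> setT -> pt V.
Proof.
move=> vV kV VT; have [[_ /(_ V vV kV) [y [[Ey [yV _]] _]]] _ _] := hE.
have [yT|yT] := pselect (y = setT).
  by case: VT; apply/seteqP; split=> // x _; apply: yV; rewrite yT.
have ply : pt y by split.
suff <- : y = V by [].
apply/seteqP; split=> // x Vx; apply: contrapT => nyx; apply: VT.
exact: (dvr_max (pt_dvr ply) vV.1 yV Vx nyx).
Qed.

Lemma pt_eq P Q : pt P -> pt Q -> P `<=` Q -> P = Q.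
Proof.
move=> hP hQ PQ; apply/seteqP; split=> // x Qx; apply: contrapT => nPx.
apply: (dvr_proper (pt_dvr hQ)).
exact: (dvr_max (pt_dvr hP) (pt_dvr hQ).1 PQ Qx nPx).
Qed.

(** [S] will be the zero ideal or a maximal ideal. As [p] splits over [k], a prime set containing
    its value contains that of a linear factor. *)
Lemma alg_root (S : set F) x p : p != 0 ->
  (forall a b : {poly k}, S (map_poly iota (a * b)).[x] ->
     S (map_poly iota a).[x] \/ S (map_poly iota b).[x]) ->
  (forall c, c != 0 -> ~ S (iota c)) ->
  S (map_poly iota p).[x] -> exists z, S (x - iota z).
Proof.
move=> p0 SM SC; have [r ->] := closed_field_poly_normal p.
rewrite -mul_polyC => /SM[|].
  rewrite map_polyC hornerC => /SC[]; by rewrite lead_coef_eq0.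
elim: r => [|z r IH].
  by rewrite big_nil rmorph1 hornerC -(rmorph1 iota) => /SC[]; rewrite oner_neq0.
rewrite big_cons => /SM[|//].
by rewrite map_polyXsubC hornerXsubC => h; exists z.
Qed.

Lemma coefs_constP q : coefs_in k0 q -> exists p, q = map_poly iota p.
Proof.
move=> hq; have {}hq i : {c | iota c = q`_i} by apply: cid; have [c _] := hq i; exists c.
exists (\poly_(i < size q) sval (hq i)); apply/polyP => i.
rewrite coef_map coef_poly /=; case: ltnP => h; first by rewrite (svalP (hq i)).
by rewrite rmorph0 nth_default.
Qed.

(** This is the ideal generated by [x] in [k[x]]; applied to the inverse of a function it produces a
    valuation ring where the function has a pole. *)
Lemma coefs_const0 x :
  is_ideal (values k0 x) (values k0 x `&`
    [set y | exists2 q, coefs_in k0 q & q`_0 = 0 /\ y = q.[x]]).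
Proof.
have sk := const_subring.
split.
- by move=> y [].
- split; first by apply: subring0; apply: values_subring.
  by exists 0; rewrite ?coef0 ?horner0 // => i; rewrite coef0; apply: subring0.
- move=> y z [vy [q hq [q0 ey]]] [vz [r hr [r0 ez]]].
  split; first by apply: subringD => //; apply: values_subring.
  exists (q + r); last by rewrite ey ez hornerD coefD q0 r0 addr0.
  by move=> i; rewrite coefD; apply: subringD.
- move=> _ z [a ha <-] [vz [r hr [r0 ez]]].
  split; first by apply: subringM => //; [apply: values_subring|exists a].
  exists (a * r); last by rewrite ez hornerM coef0M r0 mulr0.
  by move=> i; rewrite coefM; apply: subring_sum => // j _; apply: subringM.
Qed.

(** If [f] is not constant, [f^-1] generates a proper ideal of [k[f^-1]]: a relation [1 = q(f^-1)]
    with [q_0 = 0] would make [f^-1] algebraic over [k], hence constant. A valuation ring with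
    [f^-1] in its maximal ideal is then a closed point where [f] is not regular. *)
Lemma global_const f : (forall P, pt P -> P f) -> k0 f.
Proof.
move=> hf; apply: contrapT => nkf; have sk := const_subring.
have f0 : f != 0 by apply/eqP => f0; apply: nkf; rewrite f0; apply: subring0.
have [|V [vV kV IV]] := chevalley (values_subring f^-1 sk) (coefs_const0 f^-1).
  case=> _ [q /coefs_constP[p ->] [p0 e]].
  have [z] : exists z, [set 0] (f^-1 - iota z).
    apply: (@alg_root _ _ (1 - p)).
    - apply/eqP => /(congr1 (fun r : {poly k} => iota r`_0)).
      move: p0; rewrite coef_map coefB coef1 coef0 rmorphB rmorph1 /= => ->.
      by move/eqP; rewrite subr0 rmorph0 oner_eq0.
    - move=> a b /eqP; rewrite rmorphM hornerM mulf_eq0.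
      by move=> /orP[]/eqP; [left|right].
    - by move=> c c0 /eqP; rewrite fmorph_eq0 (negPf c0).
    - by rewrite rmorphB rmorph1 hornerD hornerN hornerC -e subrr.
  move=> /= /subr0_eq ez; apply: nkf; exists z^-1 => //.
  by rewrite fmorphV -ez invrK.
have kV' : k0 `<=` V by apply: subset_trans kV; apply: values_sub.
have nVf : ~ V f.
  have /IV [_ [/eqP|]] : (values k0 f^-1 `&` [set y | exists2 q,
      coefs_in k0 q & q`_0 = 0 /\ y = q.[f^-1]]) f^-1.
  - split; first exact: values_mem.
    exists 'X; last by rewrite hornerX coefX.
    by move=> i; rewrite coefX; case: eqP => _; [apply: subring1|apply: subring0].
  - by rewrite invr_eq0 (negPf f0).
  - by rewrite invrK.
by apply: (nVf); apply: hf; apply: valuation_pt => // e; apply: nVf; rewrite e.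
Qed.

(* Otherwise some valuation ring [V] contains [k[1/x] + m_P] and has [1/x] in its
   maximal ideal. By completeness [V] is discrete; but [x ^ n * u] lies in [m_P],
   hence in [V], for all [n], although [x] has negative order at [V]. *)
Lemma residue_const P x : pt P -> P x -> exists c, val_ge P 1 (x - iota c).
Proof.
move=> hP Px; have dP := pt_dvr hP; have sP := dP.1; apply: contrapT => nx.
have mP := @nonunitE _ _ dP.
have nxc c : ~ val_ge P 1 (x - iota c) by move=> h; apply: nx; exists c.
have [x0 Px'] : x != 0 /\ P x^-1.
  apply: not_nonunit => // /mP h; apply: (nxc 0).
  by rewrite rmorph0 subr0.
have Pp p : P (map_poly iota p).[x^-1].
  by apply: subring_horner => // i; rewrite coef_map; apply: pt_const.
pose B := [set b | exists p, val_ge P 1 (b - (map_poly iota p).[x^-1])].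
pose I := [set b | exists2 p : {poly k}, p`_0 = 0 & val_ge P 1 (b - (map_poly iota p).[x^-1])].
have vM a b : P a -> val_ge P 1 b -> val_ge P 1 (a * b).
  by move=> /(val_ge0 dP) Pa hb; rewrite -[1 : int]add0r; apply: val_geM.
have BP : B `<=` P.
  move=> b [p hp]; rewrite -(subrK (map_poly iota p).[x^-1] b).
  by apply: subringD => //; apply/(val_ge0 dP); apply: val_ge_le hp.
have sB : subring B.
  apply/subringP; split.
  - by exists 1; rewrite rmorph1 hornerC subrr; left.
  - move=> a b [p hp] [q hq]; exists (p - q).
    rewrite rmorphB hornerD hornerN.
    have -> : a - b - ((map_poly iota p).[x^-1] - (map_poly iota q).[x^-1]) =
      (a - (map_poly iota p).[x^-1]) - (b - (map_poly iota q).[x^-1]) by ring.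
    exact: val_geB.
  - move=> a b Ba [q hq]; have [p hp] := Ba; exists (p * q).
    rewrite rmorphM hornerM.
    have -> : a * b - (map_poly iota p).[x^-1] * (map_poly iota q).[x^-1] =
      a * (b - (map_poly iota q).[x^-1]) +
      (map_poly iota q).[x^-1] * (a - (map_poly iota p).[x^-1]) by ring.
    by apply: val_geD => //; apply: vM => //; apply: BP.
have iI : is_ideal B I.
  split.
  - by move=> b [p _ hp]; exists p.
  - by exists 0; rewrite ?coef0 // rmorph0 horner0 subrr; left.
  - move=> a b [p p0 hp] [q q0 hq]; exists (p + q); first by rewrite coefD p0 q0 addr0.
    rewrite rmorphD hornerD.
    have -> : a + b - ((map_poly iota p).[x^-1] + (map_poly iota q).[x^-1]) =
      (a - (map_poly iota p).[x^-1]) + (b - (map_poly iota q).[x^-1]) by ring.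
    exact: val_geD.
  - move=> a b Ba [q q0 hq]; have [p hp] := Ba; exists (p * q).
      by rewrite coef0M q0 mulr0.
    rewrite rmorphM hornerM.
    have -> : a * b - (map_poly iota p).[x^-1] * (map_poly iota q).[x^-1] =
      a * (b - (map_poly iota q).[x^-1]) +
      (map_poly iota q).[x^-1] * (a - (map_poly iota p).[x^-1]) by ring.
    by apply: val_geD => //; apply: vM => //; apply: BP.
have mB a : val_ge P 1 a -> B a by exists 0; rewrite rmorph0 horner0 subr0.
have [|V [vV BV IV]] := chevalley sB iI.
  case=> p p0 hp; have [z hz] : exists z, val_ge P 1 (x^-1 - iota z).
    apply: (@alg_root (val_ge P 1) _ (1 - p)).
    - apply/eqP => /(congr1 (fun r : {poly k} => r`_0)).
      by rewrite coefB coef1 coef0 p0 subr0 => /eqP; rewrite oner_eq0.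
    - move=> a b; rewrite rmorphM hornerM => /mP h.
      by have [] := local_prime sP (Pp a) (Pp b) h => /mP; [left|right].
    - move=> c c0 /mP; apply: unit_not_nonunit; first by rewrite fmorph_eq0.
      by rewrite -fmorphV; apply: pt_const.
    - by rewrite rmorphB rmorph1 hornerD hornerN hornerC.
  have z0 : z != 0.
    apply/eqP => z0; move: hz; rewrite z0 rmorph0 subr0 => /mP.
    by apply: unit_not_nonunit; rewrite ?invr_eq0 // invrK.
  apply: (nxc z^-1); have -> : x - iota z^-1 = - (x * iota z^-1) * (x^-1 - iota z).
    by rewrite fmorphV; field; rewrite fmorph_eq0 x0 z0.
  apply: vM => //; apply: subringN => //; apply: subringM => //; exact: pt_const.
have kV : k0 `<=` V.
  move=> _ [c _ <-]; apply: BV; exists c%:P.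
  by rewrite map_polyC hornerC subrr; left.
have nVx : ~ V x.
  have /IV [_ [/eqP|]] : I x^-1.
  - by exists 'X; rewrite ?coefX // map_polyX hornerX subrr; left.
  - by rewrite invr_eq0 (negPf x0).
  - by rewrite invrK.
have hV : pt V by apply: valuation_pt => // e; apply: nVx; rewrite e.
have dV := pt_dvr hV.
have [u u0 ordu] := ord_uniformizer dP.
have xu n : V (x ^+ n * u).
  apply: BV; apply: mB; apply: vM; first exact: subringX.
  by right; have := ordu 1; rewrite expr1z => ->.
have Vu : 0 <= ord V u.
  apply: val_ge_ord => //; apply/(val_ge0 dV).
  by have := xu 0%N; rewrite expr0 mul1r.
have ordx : ord V x < 0.
  by rewrite ltNge; apply/negP => h; apply: nVx; apply: ord_ge0.
have /(val_ge0 dV)/val_ge_ord := xu `|ord V u|.+1%N.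
rewrite mulf_neq0 ?expf_neq0 // => /(_ isT); rewrite (ordM dV) ?expf_neq0 //.
rewrite (ordX dV) // -addn1 PoszD gez0_abs //; nia.
Qed.

(* An ultrafilter on an infinite set of poles has a limit valuation ring [V], which
   is a closed point. Since the residue fields are [k], each coordinate takes the
   same value at [V] and at almost all of the poles, so these are equal to [V]. *)
Lemma finite_poles f : finite_set [set P | pt P /\ ~ P f].
Proof.
set T := [set _ | _]; apply: contrapT => infT.
pose Fr : set_system (set F) := [set W | finite_set (T `\` W)].
have prF : ProperFilter Fr.
  apply: Build_ProperFilter_ex; last split.
  - move=> W fW; apply: contrapT => nW; apply: infT; apply: sub_finite_set fW.
    by move=> x Tx; split=> // Wx; apply: nW; exists x.
  - by rewrite /Fr /= setDT; apply: finite_set0.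
  - by move=> A B; rewrite /Fr /= setDIr => hA hB; rewrite finite_setU.
  - by move=> A B AB; apply: sub_finite_set => x [Tx nB]; split=> // /AB.
have [U [uU FrU]] := ultraFilterLemma prF.
have UT : U T by apply: FrU; rewrite /Fr /= setDv; apply: finite_set0.
pose V := [set x | U [set P | P x]].
have UI A B : U A -> U B -> U (A `&` B) by move=> *; apply: filterI.
have US A B : A `<=` B -> U A -> U B by move=> h; apply: filterS.
have vV : valuation_ring V.
  split.
    apply/subringP; split.
    - by apply: US UT => P [/pt_dvr[/subring1]].
    - move=> x y Vx Vy; apply: US (UI _ _ UT (UI _ _ Vx Vy)).
      by move=> P [[/pt_dvr[sP _] _] []]; apply: subringB.
    - move=> x y Vx Vy; apply: US (UI _ _ UT (UI _ _ Vx Vy)).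
      by move=> P [[/pt_dvr[sP _] _] []]; apply: subringM.
  move=> x; have [h|h] := in_ultra_setVsetC [set P | P x] uU; [by left|right].
  apply: US (UI _ _ UT h) => P [[/pt_dvr/dvr_valuation[_ hP] _] nPx].
  by have [] := hP x.
have UN0 : ~ U set0 by apply: filter_not_empty.
have nVf : ~ V f.
  by move=> Vf; apply: UN0; apply: US (UI _ _ UT Vf) => P [[_ nPf] /nPf].
have kV : k0 `<=` V.
  by move=> _ [c _ <-]; apply: US UT => P [hP _]; apply: pt_const.
have hV : pt V by apply: valuation_pt => // e; apply: nVf; rewrite e.
have dV := pt_dvr hV; have [EV _] := hV.
have [s [aV _ _]] := curve_chart EV.
have [_ sV eV] := affE (adjoin_subring _ _) aV.
have sub_x x : x \in s -> V x by move=> xs; apply: sV; apply: adjoin_mem.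
have Ux x : V x -> U [set P | exists c, val_ge V 1 (x - iota c) /\
    (pt P -> val_ge P 1 (x - iota c))].
  move=> Vx; have [c hc] := residue_const hV Vx.
  have : ~ U [set P | x - iota c != 0 /\ P (x - iota c)^-1].
    move=> h; have xc : x - iota c != 0.
      by apply/negP => /negP e; apply: UN0; apply: US h => P [/negP].
    have h' : V (x - iota c)^-1 by apply: US h => P [].
    by apply: (unit_not_nonunit xc h'); apply/nonunitE.
  have [//|h _] := in_ultra_setVsetC [set P | x - iota c != 0 /\ P (x - iota c)^-1] uU.
  have hx : U [set P | P x] by [].
  apply: US (UI _ _ hx h) => P [Px hP]; exists c; split=> // ptP.
  have dP := pt_dvr ptP; apply/nonunitE => //; split.
    by apply: subringB => //; [apply: dP.1|apply: pt_const].
  have [->|xc] := eqVneq (x - iota c) 0; [by left|right=> h'; apply: hP].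
  by split.
have : U [set P | forall x, x \in s -> exists c, val_ge V 1 (x - iota c) /\
    (pt P -> val_ge P 1 (x - iota c))].
  elim: s sub_x {aV sV eV} => [|x s IH] sub_x; first by apply: US UT.
  have h1 := IH (fun y ys => sub_x y (mem_behead (s := x :: s) ys)).
  apply: US (UI _ _ (Ux x (sub_x x (mem_head _ _))) h1).
  by move=> P [hx hs] y; rewrite inE => /orP[/eqP ->|/hs].
have UV : U [set P | P <> V].
  apply: FrU; rewrite /Fr /=; apply: sub_finite_set (finite_set1 V) => P [_].
  by move=> /contrapT.
move=> /(UI _ _ UV) /(UI _ _ UT) h.
have [P [[ptP nPf] [PV hP]]] : exists P, (T `&` ([set P | P <> V] `&` [set P |
   forall x, x \in s -> exists c, val_ge V 1 (x - iota c) /\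
    (pt P -> val_ge P 1 (x - iota c))])) P.
  by apply: contrapT => ne; apply: UN0; apply: US h => P hP; apply: ne; exists P.
apply: PV; apply: esym; apply: pt_eq => //.
have dP := pt_dvr ptP; have [sP sV'] := (dP.1, dV.1).
(* Functions with the same residue at [V] and [P] form a ring. It contains the chart, and a
   denominator nonzero at [V] is therefore nonzero at [P]. *)
pose W := [set x | exists c, val_ge V 1 (x - iota c) /\ val_ge P 1 (x - iota c)].
have vM Q a b : pt Q -> Q a -> val_ge Q 1 b -> val_ge Q 1 (a * b).
  move=> /pt_dvr dQ /(val_ge0 dQ) Qa hb; rewrite -[1 : int]add0r; exact: val_geM.
have sW : subring W.
  apply/subringP; split.
  - by exists 1; rewrite rmorph1 subrr; split; left.
  - move=> x y [c [h1 h2]] [d [h3 h4]]; exists (c - d).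
    have -> : x - y - iota (c - d) = (x - iota c) - (y - iota d).
      by rewrite rmorphB; ring.
    by split; apply: val_geB.
  - move=> x y [c [h1 h2]] [d [h3 h4]]; exists (c * d).
    have -> : x * y - iota (c * d) =
       (y - iota d) * (x - iota c) + (iota d * (x - iota c) + iota c * (y - iota d)).
      by rewrite rmorphM; ring.
    have le1 Q z : pt Q -> val_ge Q 1 z -> Q z.
      by move=> /pt_dvr dQ h'; apply/(val_ge0 dQ); apply: val_ge_le h'.
    by split; apply: val_geD => //; [|apply: val_geD => //| |apply: val_geD => //];
      apply: vM => //; try exact: pt_const; apply: le1.
have BW : adjoin k0 s `<=` W.
  apply: adjoin_min => // [_ [c _ <-]|x /hP[c [h1 h2]]]; exists c.
    by rewrite subrr; split; left.
  by split=> //; apply: h2.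
have WP : W `<=` P.
  move=> x [c [_ h2]]; rewrite -(subrK (iota c) x); apply: subringD => //.
    by apply/(val_ge0 dP); apply: val_ge_le h2.
  exact: pt_const.
move=> x; rewrite eV => /centreP [|//|a [w [Ba Bw w0 Vw ->]]].
  exact: adjoin_subring.
apply: subringM => //; first exact/WP/BW.
have [c [h1 h2]] := BW _ Bw.
have [] // : w != 0 /\ P w^-1.
apply: not_nonunit; first exact/WP/BW.
move=> /nonunitE h3; apply: (unit_not_nonunit w0 Vw); apply/nonunitE => //.
have c0 : c = 0.
  apply: contrapT => /eqP c0.
  have : nonunit P (iota c).
    apply/nonunitE => //; rewrite -[iota c](subKr w); apply: val_geB => //.
    exact: h3.
  by apply: unit_not_nonunit; rewrite ?fmorph_eq0 // -fmorphV; apply: pt_const.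
by move: h1; rewrite c0 rmorph0 subr0.
Qed.

End CompleteCurve.

(** * Riemann-Roch on an elliptic curve *)

Lemma ord_near (F : fieldType) (A : set F) (x y : F) : dvr A -> x != 0 ->
  val_ge A (ord A x + 1) (x - y) -> y != 0 /\ ord A y = ord A x.
Proof.
move=> dA x0 h.
have y0 : y != 0.
  by apply/eqP => y0; move: h; rewrite y0 subr0 => /(val_ge_ord x0); rewrite lezD1 ltxx.
split=> //; apply/eqP; rewrite eq_le; apply/andP; split; last first.
  apply: val_ge_ord => //; rewrite -[y](subKr x); apply: val_geB => //; first by right.
  by apply: val_ge_le h; lia.
rewrite leNgt; apply/negP => lt_xy.
have : val_ge A (ord A x + 1) x.
  rewrite -{2}(subrK y x); apply: val_geD => //; right; rewrite lezD1.
  exact: lt_xy.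
by move=> /(val_ge_ord x0); rewrite lezD1 ltxx.
Qed.

Section RiemannRoch.
Variables (k : closedFieldType) (F : fieldType) (iota : {rmorphism k -> F}).
Variable E : set (set F).
Hypothesis hE : elliptic_curve iota E.
Implicit Types (P Q : set F) (G : set F -> int) (f x : F).
Local Notation pt := (closed_points E).
Let hS : smooth_projective_curve iota E := hE.1.
Let dv P : pt P -> dvr P := @pt_dvr _ _ _ _ hS P.

Definition sec G f : Prop := forall P, closed_points E P -> val_ge P (- G P) f.

(* H^1(E, O_E(G)) = 0 *)
Definition h1_zero G : Prop := forall a, repartition E a ->
  exists f, forall P, closed_points E P -> val_ge P (- G P) (a P - f).

Definition point_div P : set F -> int := fun Q => (Q == P)%:Z.

Lemma repartitionM a f : repartition E a -> repartition E (fun P => a P * f).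
Proof.
move=> ra; have pf := finite_poles hS f.
have : finite_set ([set P | pt P /\ ~ P (a P)] `|` [set P | pt P /\ ~ P f]).
  by rewrite finite_setU.
apply: sub_finite_set => P [hP n].
have [aP|aP] := pselect (P (a P)); [right; split=> // fP|by left].
by apply: n; apply: subringM => //; apply: (dv hP).1.
Qed.

Lemma repartition_single P x : repartition E (fun Q => if Q == P then x else 0).
Proof.
apply: sub_finite_set (finite_set1 P) => Q /= [hQ n].
apply: contrapT => /eqP QP; apply: n; rewrite (negPf QP).
by apply: subring0; apply: (dv hQ).1.
Qed.

Lemma genus_one : exists r, repartition E r /\ forall a, repartition E a ->
  exists c f, forall P, pt P -> P (a P - f - iota c * r P).
Proof.
case: hE => _ [r [hr h]]; exists (r ord0); split=> // a /h[c [[f hf] _]].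
by exists (c ord0), f => P /hf; rewrite big_ord1.
Qed.

Let vC n P c x : pt P -> val_ge P n x -> val_ge P n (iota c * x).
Proof.
move=> hP hx; rewrite -[n]add0r; apply: val_geM => //; first exact: dv.
by apply/(val_ge0 (dv hP)); apply: (pt_const hS).
Qed.

(* Let [r] span [H^1(E, O_E)]. If the class of [1/u] at [P] is a nonzero multiple of
   [r], we are done. Otherwise there is a function [f] with a simple pole at [P] only;
   then [f r = c r] in [H^1(E, O_E)] for some [c] in [k], so multiplication by [f - c],
   which maps [H^1(E, O_E)] onto [H^1(E, O_E(P))], kills [r]. *)
Lemma point_h1_zero P : pt P -> h1_zero (point_div P).
Proof.
move=> hP; have [r [rr hr]] := genus_one.
have ple Q x : pt Q -> Q x -> val_ge Q (- point_div P Q) x.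
  by move=> hQ /(val_ge0 (dv hQ)); apply: val_ge_le; rewrite oppr_le0.
suff [g hg] : exists g, forall Q, pt Q -> val_ge Q (- point_div P Q) (r Q - g).
  move=> a /hr[c [f hf]]; exists (f + iota c * g) => Q hQ.
  have -> : a Q - (f + iota c * g) = (a Q - f - iota c * r Q) + iota c * (r Q - g) by ring.
  apply: val_geD; [exact: dv|by apply: ple => //; apply: hf|].
  by apply: vC => //; apply: hg.
have [u u0 ordu] := ord_uniformizer (dv hP).
have ordu1 : ord P u = 1 by have := ordu 1; rewrite expr1z.
have au Q : pt Q -> val_ge Q (- point_div P Q) (if Q == P then u^-1 else 0).
  move=> hQ; rewrite /point_div; case: eqP => [->|_]; last by left.
  by right; rewrite (ordV (dv hP)) // ordu1.
have [c [f hf]] := hr _ (repartition_single P u^-1).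
have [c0|c0] := eqVneq c 0; last first.
  have ic0 : iota c != 0 by rewrite fmorph_eq0.
  exists (- f * iota c^-1) => Q hQ; set a := (if Q == P then u^-1 else 0).
  have -> : r Q - - f * iota c^-1 = iota c^-1 * (a - (a - f - iota c * r Q)).
    by rewrite fmorphV; field.
  apply: vC => //; apply: val_geB; [exact: dv|exact: au|by apply: ple => //; apply: hf].
have {}hf Q : pt Q -> Q ((if Q == P then u^-1 else 0) - f).
  by move=> /hf; rewrite c0 rmorph0 mul0r subr0.
have [c' [g hg]] := hr _ (repartitionM f rr).
pose h := f - iota c'.
have h0 : h != 0.
  apply/eqP => /subr0_eq fc; have := hf P hP; rewrite eqxx fc => h1.
  have : P u^-1.
    rewrite -(subrK (iota c') u^-1); apply: subringD => //; first exact: (dv hP).1.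
    exact: (pt_const hS).
  by move=> /(val_ge0 (dv hP)) /val_ge_ord; rewrite invr_eq0 (ordV (dv hP)) // ordu1 => /(_ u0).
have sh Q : pt Q -> val_ge Q (- point_div P Q) h.
  move=> hQ; have -> : h = (if Q == P then u^-1 else 0) -
    ((if Q == P then u^-1 else 0) - f) - iota c' by rewrite /h; ring.
  apply: val_geB; [exact: dv| |apply: ple => //; exact: (pt_const hS)].
  apply: val_geB; [exact: dv|exact: au|by apply: ple => //; apply: hf].
have [c'' [g'' hg'']] := hr _ (repartitionM h^-1 rr).
exists (g'' * h + iota c'' * g) => Q hQ.
have -> : r Q - (g'' * h + iota c'' * g) = h * (r Q * h^-1 - g'' - iota c'' * r Q) +
   iota c'' * (r Q * f - g - iota c' * r Q).
  by rewrite [X in iota c'' * (X - _ - _)](_ : _ = r Q * (h + iota c'));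
    [field|rewrite /h subrK].
apply: val_geD; first exact: dv.
  rewrite -[- _]addr0; apply: val_geM; [exact: dv|exact: sh|].
  by apply/(val_ge0 (dv hQ)); apply: hg''.
by apply: vC => //; apply: ple => //; apply: hg.
Qed.

Lemma h1_zero_le G G' : (forall P, pt P -> G P <= G' P) -> h1_zero G -> h1_zero G'.
Proof.
move=> GG' h a /h[f hf]; exists f => P hP; apply: val_ge_le (hf P hP).
by rewrite lerN2 GG'.
Qed.

Lemma h1_zero_approx G P x : h1_zero G -> pt P -> exists f,
  val_ge P (- G P) (x - f) /\ forall Q, pt Q -> Q != P -> val_ge Q (- G Q) f.
Proof.
move=> h hP; have [f hf] := h _ (repartition_single P x); exists f; split.
  by have := hf P hP; rewrite eqxx.
move=> Q hQ QP; have := hf Q hQ; rewrite (negPf QP) sub0r => h'.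
by rewrite -[f]opprK; apply: val_geN; first exact: dv.
Qed.

(** Without [H^1] a principal part can be prescribed freely at one point; [u ^ (- G P - 1)] is the
    first one that [G] forbids. *)
Lemma h1_zero_pole G P : h1_zero G -> pt P -> exists f,
  [/\ sec (fun Q => G Q + point_div P Q) f, f != 0 & ord P f = - G P - 1].
Proof.
move=> h hP; have dP := dv hP; have [u u0 ordu] := ord_uniformizer dP.
have [f [h1 h2]] := h1_zero_approx (u ^ (- G P - 1)) h hP; exists f.
have [f0 ordf] : f != 0 /\ ord P f = - G P - 1.
  rewrite -[RHS]ordu; apply: ord_near => //; first by rewrite expfz_neq0.
  by rewrite ordu subrK.
split=> // Q hQ; rewrite /point_div; have [->|QP] := eqVneq Q P.
  by right; rewrite ordf opprD.
by rewrite addr0; apply: h2.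
Qed.

Lemma sec_le G G' f : (forall P, pt P -> G P <= G' P) -> sec G f -> sec G' f.
Proof. by move=> h hf P hP; apply: val_ge_le (hf P hP); rewrite lerN2 h. Qed.

Lemma secD G f g : sec G f -> sec G g -> sec G (f + g).
Proof. by move=> hf hg P hP; apply: val_geD; [apply: dv|apply: hf|apply: hg]. Qed.

Lemma secB G f g : sec G f -> sec G g -> sec G (f - g).
Proof. by move=> hf hg P hP; apply: val_geB; [apply: dv|apply: hf|apply: hg]. Qed.

Lemma sec0 G : sec G 0.
Proof. by move=> P _; left. Qed.

Lemma secC G c f : sec G f -> sec G (iota c * f).
Proof. by move=> hf P hP; apply: vC => //; apply: hf. Qed.

Lemma sec_sum G (I : Type) (r : seq I) (S : pred I) (f : I -> F) :
  (forall i, S i -> sec G (f i)) -> sec G (\sum_(i <- r | S i) f i).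
Proof. by move=> h; apply: big_ind => //; [apply: sec0|apply: secD]. Qed.

Lemma sec_const f : sec (fun=> 0) f -> range iota f.
Proof.
move=> hf; apply: (global_const hS) => P hP; apply/(val_ge0 (dv hP)).
by have := hf P hP; rewrite oppr0.
Qed.

Definition free_family (T : finType) (v : T -> F) : Prop :=
  forall c : T -> k, \sum_i iota (c i) * v i = 0 -> forall i, c i = 0.

(* dim_k H^0(E, O_E(G)) >= m *)
Definition h0_ge G m : Prop :=
  exists v : 'I_m -> F, (forall i, sec G (v i)) /\ free_family v.

Lemma free_family_neq0 (T : finType) (v : T -> F) i : free_family v -> v i != 0.
Proof.
move=> fv; apply/eqP => vi0.
suff /eqP : (i == i)%:R = 0 :> k by rewrite eqxx oner_eq0.
apply: (fv (fun j => (j == i)%:R)); rewrite big1 // => j _.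
by have [->|_] := eqVneq j i; rewrite ?vi0 ?mulr0 // rmorph0 mul0r.
Qed.

Lemma h0_ge_sec G G' m : (forall P, pt P -> G P <= G' P) -> h0_ge G m -> h0_ge G' m.
Proof. by move=> h [v [vG fv]]; exists v; split=> // i; apply: sec_le (vG i). Qed.

(** The function with the newly allowed pole order at [P] is independent of all sections of [G]. *)
Lemma h0_ge_add G P m : h1_zero G -> pt P -> h0_ge G m ->
  h0_ge (fun Q => G Q + point_div P Q) m.+1.
Proof.
move=> hG hP [v [vG fv]]; have [f [sf f0 ordf]] := h1_zero_pole hG hP.
exists (fun i => if unlift ord0 i is Some j then v j else f); split=> [i|c].
  case: unliftP => [j _|_] //; apply: sec_le (vG j) => Q _.
  by rewrite lerDl /point_div; case: eqP.
rewrite big_ord_recl unlift_none; under eq_bigr do rewrite liftK.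
move=> e; have c0 : c ord0 = 0.
  apply: contrapT => /eqP c0.
  have : sec G f.
    have -> : f = iota (- (c ord0)^-1) * \sum_(i < m) iota (c (lift ord0 i)) * v i.
      rewrite rmorphN fmorphV; move/eqP: e; rewrite addrC addr_eq0 => /eqP ->.
      by field; rewrite fmorph_eq0.
    by apply: secC; apply: sec_sum => i _; apply: secC.
  move=> /(_ P hP) /(val_ge_ord f0); rewrite ordf; lia.
move=> i; have [->//|[j ->]] : i = ord0 \/ exists j, i = lift ord0 j.
  by case: (unliftP ord0 i) => [j ->|->]; [right; exists j|left].
move: j; apply: (fv (fun j => c (lift ord0 j))).
by move: e; rewrite c0 rmorph0 mul0r add0r.
Qed.

(** Leading coefficients at [P] lie in [k] because residue fields do, so one section serves as a
    pivot to eliminate them from the others. *)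
Lemma h0_ge_sub G P m : pt P -> h0_ge G m.+1 -> h0_ge (fun Q => G Q - point_div P Q) m.
Proof.
move=> hP [v [vG fv]]; have dP := dv hP; have [u u0 ordu] := ord_uniformizer dP.
have uG n : val_ge P n (u ^ n) by right; rewrite ordu.
have lead i : {c | val_ge P (- G P + 1) (v i - iota c * u ^ (- G P))}.
  apply: cid; have Pv : P (v i * u ^ (G P)).
    apply/(val_ge0 dP); rewrite -(addNr (G P)); apply: val_geM => //.
    exact: (vG i P hP).
  have [c hc] := residue_const hS hP Pv; exists c.
  have -> : v i - iota c * u ^ (- G P) = u ^ (- G P) * (v i * u ^ (G P) - iota c).
    rewrite -invr_expz; field; exact: expfz_neq0.
  exact: val_geM.
pose l i := sval (lead i); have hl i := svalP (lead i).
(* When all leading coefficients vanish any pivot will do: the quotients below are then zero and the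
   sections stay unchanged. *)
have [i0 hi0] : exists i0, l i0 != 0 \/ forall i, l i = 0.
  have [[i hi]|h] := pselect (exists i, l i != 0); first by exists i; left.
  exists ord0; right=> i; apply: contrapT => /eqP li; apply: h; by exists i.
exists (fun j => v (lift i0 j) - iota (l (lift i0 j) / l i0) * v i0); split.
  move=> j Q hQ; rewrite /point_div; have [->|QP] := eqVneq Q P; last first.
    rewrite subr0; apply: val_geB; [exact: dv|exact: vG|].
    by apply: vC => //; apply: vG.
  rewrite opprB addrC; case: hi0 => [li0|l0]; last first.
    by have := hl (lift i0 j); rewrite -/(l _) !l0 mul0r rmorph0 !mul0r !subr0.
  have -> : v (lift i0 j) - iota (l (lift i0 j) / l i0) * v i0 =
    (v (lift i0 j) - iota (l (lift i0 j)) * u ^ (- G P)) -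
    iota (l (lift i0 j) / l i0) * (v i0 - iota (l i0) * u ^ (- G P)).
    by rewrite fmorph_div; field; rewrite fmorph_eq0.
  by apply: (val_geB dP); [exact: hl|apply: vC => //; apply: hl].
move=> c e i.
pose c' i := if unlift i0 i is Some j then c j
  else - \sum_j c j * (l (lift i0 j) / l i0).
have := fv c'; rewrite (bigD1_ord i0) //=; under eq_bigr do rewrite /c' liftK.
rewrite /c' unlift_none => /(_ _ (lift i0 i)); rewrite liftK; apply.
rewrite -[RHS]e; under [in RHS]eq_bigr do rewrite mulrBr.
rewrite sumrB addrC rmorphN mulNr; congr (_ - _).
by rewrite rmorph_sum mulr_suml; apply: eq_bigr => j _; rewrite [in RHS]mulrA -rmorphM.
Qed.

Definition seq_div (s : seq (set F)) : set F -> int := fun P => (count_mem P s)%:Z.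

(** The degree is a relation witnessed by two lists of points, so that divisors can be built and
    dismantled one point at a time. *)
Definition has_degree G (n : int) : Prop := exists s t : seq (set F),
  [/\ forall P, P \in s -> pt P, forall P, P \in t -> pt P,
      forall P, pt P -> G P = seq_div s P - seq_div t P
    & n = (size s)%:Z - (size t)%:Z].

Lemma has_degree_ext G G' n : (forall P, pt P -> G P = G' P) ->
  has_degree G n -> has_degree G' n.
Proof.
by move=> e [s [t [h1 h2 h3 h4]]]; exists s, t; split=> // P hP; rewrite -e ?h3.
Qed.

Lemma has_degree0 : has_degree (fun=> 0) 0.
Proof. by exists [::], [::]. Qed.

Lemma has_degree_point P : pt P -> has_degree (point_div P) 1.
Proof.
move=> hP; exists [:: P], [::]; split=> // [Q|Q _]; first by rewrite inE => /eqP ->.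
by rewrite /point_div /seq_div /= addn0 subr0 eq_sym.
Qed.

Lemma has_degreeD G G' n n' : has_degree G n -> has_degree G' n' ->
  has_degree (fun P => G P + G' P) (n + n').
Proof.
move=> [s [t [h1 h2 h3 h4]]] [s' [t' [h1' h2' h3' h4']]].
exists (s ++ s'), (t ++ t'); split.
- by move=> P; rewrite mem_cat => /orP[/h1|/h1'].
- by move=> P; rewrite mem_cat => /orP[/h2|/h2'].
- move=> P hP; rewrite h3 // h3' // /seq_div !count_cat; lia.
- by rewrite h4 h4' !size_cat; lia.
Qed.

Lemma has_degreeN G n : has_degree G n -> has_degree (fun P => - G P) (- n).
Proof.
move=> [s [t [h1 h2 h3 h4]]]; exists t, s; split=> //; last by rewrite h4 opprB.
by move=> P hP; rewrite h3 // opprB.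
Qed.

Lemma has_degreeZ G n (m : int) : has_degree G n -> has_degree (fun P => m * G P) (m * n).
Proof.
move=> hG; have nat_case (i : nat) : has_degree (fun P => i%:Z * G P) (i%:Z * n).
  elim: i => [|i IH].
    by rewrite mul0r; apply: has_degree_ext has_degree0 => P _; rewrite mul0r.
  have -> : i.+1%:Z * n = i%:Z * n + n by lia.
  by apply: has_degree_ext (has_degreeD IH hG) => P _; lia.
case: m => i; first exact: nat_case.
have -> : Negz i * n = - (i.+1%:Z * n) by lia.
by apply: has_degree_ext (has_degreeN (nat_case i.+1)) => P _; lia.
Qed.

(** The lower bound of Riemann-Roch in genus one. Each point of the positive part gains a dimension,
    each point of the negative part costs at most one. *)
Lemma h0_ge_deg G n (m : nat) : has_degree G n -> m%:Z <= n -> h0_ge G m.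
Proof.
(* The auxiliary [P0] is added to [s] so that each divisor met on the way up contains a point and
   has no [H^1] by [point_h1_zero]; it is removed again together with [t]. *)
move=> [s [t [hs ht hG ->]]] mn; have [P0 hP0] := exists_pt hS.
have h1s s' : (forall P, P \in s' -> pt P) -> h1_zero (seq_div (P0 :: s')).
  move=> _; apply: h1_zero_le (point_h1_zero hP0) => P _.
  by rewrite /point_div /seq_div /= eq_sym; lia.
have h0s : h0_ge (seq_div (P0 :: s)) (size s).+1.
  elim: s hs {hG mn} => [|P s IH] hs.
    exists (fun=> 1); split=> [_ P hP|c].
      right; rewrite (ord_one (dv hP)); rewrite /seq_div /=; lia.
    by rewrite big_ord1 mulr1 => /eqP; rewrite fmorph_eq0 => /eqP c0 i; rewrite (ord1 i).
  have hs' Q : Q \in s -> pt Q by move=> Qs; apply: hs; rewrite inE Qs orbT.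
  have hP : pt P by apply: hs; rewrite mem_head.
  apply: h0_ge_sec (h0_ge_add (h1s s hs') hP (IH hs')) => Q _.
  by rewrite /point_div /seq_div /= (eq_sym P Q); lia.
have h0t t' : forall G' m', (forall P, P \in t' -> pt P) -> h0_ge G' (size t' + m') ->
    h0_ge (fun P => G' P - seq_div t' P) m'.
  elim: t' => [|P t' IH] G' m' ht'.
    by apply: h0_ge_sec => Q _; rewrite /seq_div /= subr0.
  move=> h; have hP : pt P by apply: ht'; rewrite mem_head.
  have ht'' Q : Q \in t' -> pt Q by move=> Qt; apply: ht'; rewrite inE Qt orbT.
  apply: h0_ge_sec (IH _ m' ht'' (h0_ge_sub hP h)) => Q _.
  by rewrite /point_div /seq_div /= (eq_sym P Q); lia.
have : h0_ge (seq_div (P0 :: s)) (size (P0 :: t) + m).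
  have [v [sv fv]] := h0s.
  have le : (size (P0 :: t) + m <= (size s).+1)%N by rewrite /=; lia.
  exists (fun i => v (widen_ord le i)); split=> // c e i.
  pose c' (j : 'I_(size s).+1) := if insub (j : nat) is Some i then c i else 0.
  have c'w i' : c' (widen_ord le i') = c i'.
    by rewrite /c' /=; case: insubP => [j _ ej|]; [congr c; apply: val_inj|rewrite ltn_ord].
  rewrite -c'w; apply: fv.
  rewrite (bigID (fun j : 'I_(size s).+1 => (j < size (P0 :: t) + m)%N)) /=.
  rewrite [X in _ + X]big1 ?addr0 => [|j nj]; last first.
    by rewrite /c'; case: insubP => [j' _ ej|_]; [rewrite -ej ltn_ord in nj|rewrite rmorph0 mul0r].
  rewrite -[RHS]e (big_ord_narrow le) /=.
  by apply: eq_bigr => j _; rewrite c'w.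
move=> /h0t h; apply: h0_ge_sec (h _) => [P hP|P]; last first.
  by rewrite inE => /orP[/eqP ->|/ht].
by rewrite hG // /seq_div /=; lia.
Qed.

(** The divisor [-2 G] has degree at least 2, hence two independent sections. Multiplied by [f ^ 2]
    they become global functions, that is constants, so a nonzero [f] would make them
    proportional. *)
Lemma sec_deg_lt0 G n f : has_degree G n -> n < 0 -> sec G f -> f = 0.
Proof.
move=> hG n0 sf; apply: contrapT => /eqP f0.
have h2 : (2%:Z : int) <= - (2%:Z * n) by lia.
have [v [sv fv]] := h0_ge_deg (has_degreeN (has_degreeZ 2%:Z hG)) h2.
have vf i : {c | iota c = v i * f ^+ 2}.
  apply: cid; have [] // : range iota (v i * f ^+ 2); last by move=> c _ <-; exists c.
  apply: sec_const => P hP.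
  have -> : - 0 = - (- (2%:Z * G P)) + 2%:Z * - G P :> int by lia.
  by apply: val_geM; [exact: dv|exact: sv|apply: val_geX => //; [exact: dv|exact: sf]].
have := fv (fun i => if i == ord0 then sval (vf ord_max) else - sval (vf ord0)).
rewrite !big_ord_recl big_ord0 addr0 /= rmorphN => h.
have /h /(_ ord_max) /= : iota (sval (vf ord_max)) * v ord0 +
    - iota (sval (vf ord0)) * v (lift ord0 ord0) = 0.
  rewrite !(svalP (vf _)); have -> : lift ord0 ord0 = ord_max :> 'I_2 by apply: val_inj.
  ring.
move=> /eqP; rewrite oppr_eq0 => /eqP e.
have := svalP (vf ord0); rewrite e rmorph0 => /esym/eqP.
by rewrite mulf_eq0 expf_eq0 (negPf f0) (negPf (free_family_neq0 _ fv)).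
Qed.

(** If a nonzero section [f] of [O_E(G)] vanishes at some [P], multiplication by [f] sends [O_E(P)]
    into [O_E(G)] and carries the vanishing of [H^1] over. If it vanishes nowhere, [f^-1] is a
    section of a divisor of negative degree. *)
Lemma h1_zero_deg G n : has_degree G n -> 0 < n -> h1_zero G.
Proof.
move=> hG n0; have [v [sv fv]] := h0_ge_deg hG (n0 : 1%:Z <= n).
set f := v ord0; have f0 : f != 0 by apply: free_family_neq0.
have sf : sec G f by apply: sv.
have [[P hP oP]|h] := pselect (exists2 P, pt P & - G P < ord P f).
  move=> a ra; have [g hg] := point_h1_zero hP (repartitionM f^-1 ra).
  exists (g * f) => Q hQ.
  have -> : a Q - g * f = (a Q * f^-1 - g) * f by field.
  have : val_ge Q (- point_div P Q + ord Q f) ((a Q * f^-1 - g) * f).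
    by apply: val_geM; [exact: dv|exact: hg|right].
  apply: val_ge_le; have := val_ge_ord f0 (sf Q hQ).
  by rewrite /point_div; have [e|_] := eqVneq Q P; [rewrite -e in oP|]; lia.
have : f^-1 = 0.
  apply: (sec_deg_lt0 (has_degreeN hG)); first by lia.
  move=> P hP; right; rewrite (ordV (dv hP)) //.
  suff : ord P f <= - G P by lia.
  by rewrite leNgt; apply/negP => h'; apply: h; exists P.
by move=> /eqP; rewrite invr_eq0 (negPf f0).
Qed.

(** Removing [n + 1] points loses at most [n + 1] dimensions and leaves degree [-1], where there is
    no section. *)
Lemma h0_lt G (n : nat) : has_degree G n%:Z -> ~ h0_ge G n.+2.
Proof.
have [P0 hP0] := exists_pt hS.
elim: n G => [|n IH] G hG; last first.
  move=> /(h0_ge_sub hP0); apply: IH.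
  have := has_degreeD hG (has_degreeN (has_degree_point hP0)).
  by have -> : n.+1%:Z + - 1 = n%:Z by lia.
move=> /(h0_ge_sub hP0)[v [sv fv]].
have /eqP := free_family_neq0 ord0 fv; apply.
apply: (sec_deg_lt0 (has_degreeD hG (has_degreeN (has_degree_point hP0)))) => //.
Qed.

Lemma sec_dependent G (n : nat) (T : finType) (v : T -> F) : has_degree G n%:Z ->
  (n.+2 <= #|T|)%N -> (forall i, sec G (v i)) ->
  exists c : T -> k, (exists i, c i != 0) /\ \sum_i iota (c i) * v i = 0.
Proof.
move=> hG le sv; apply: contrapT => h; apply: (h0_lt hG).
pose e i : T := enum_val (widen_ord le i).
exists (v \o e); split=> [i|c hc i]; first exact: sv.
apply: contrapT => /eqP ci; apply: h.
pose c' (x : T) := if insub (enum_rank x : nat) is Some i then c i else 0.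
have c'e j : c' (e j) = c j.
  by rewrite /c' /e enum_valK /=; case: insubP => [j' _ ej|];
     [congr c; apply: val_inj|rewrite ltn_ord].
exists c'; split; first by exists (e i); rewrite c'e.
rewrite -[RHS]hc (reindex_onto (@enum_val _ T) enum_rank) => [|x _]; last exact: enum_rankK.
rewrite (eq_bigl xpredT) => [|x]; last by rewrite enum_valK eqxx.
rewrite (bigID (fun j : 'I_#|T| => (j < n.+2)%N)) /=.
rewrite [X in _ + X]big1 ?addr0 => [|j nj]; last first.
  by rewrite /c' enum_valK; case: insubP => [j' _ ej|_]; [rewrite -ej ltn_ord in nj|rewrite rmorph0 mul0r].
rewrite (big_ord_narrow le) /=.
by apply: eq_bigr => j _; rewrite -/(e j) c'e.
Qed.

Lemma divisor_degree D : divisor E D -> has_degree D (deg E D).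
Proof.
move=> /finite_seqP[s0 es]; pose s := undup s0.
have {}es : [set P | pt P /\ D P != 0] = [set` s].
  by rewrite es; apply/seteqP; split=> P /=; rewrite mem_undup.
have ptS P : P \in s -> pt P.
  by move=> Ps; have : [set` s] P by []; rewrite -es => -[].
have -> : deg E D = \sum_(P <- s) D P.
  rewrite /deg (fsbigE s) ?undup_uniq // => [|P hP nP].
    rewrite big_seq_cond [RHS]big_seq; apply: eq_bigl => P.
    by apply/andb_idr => /ptS/mem_set.
  apply: contrapT => /eqP DP; move/negP: nP; apply.
  by have : [set` s] P; [rewrite -es|].
have {}es P : pt P -> D P = \sum_(Q <- s) D Q * point_div Q P.
  move=> hP; have [Ps|Ps] := boolP (P \in s).
    rewrite (bigD1_seq P) ?undup_uniq //= big1 /point_div ?eqxx ?mulr1 ?addr0 //.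
    by move=> Q; rewrite eq_sym => /negPf ->; rewrite mulr0.
  rewrite big_seq big1 => [|Q Qs].
    apply: contrapT => /eqP DP; move/negP: Ps; apply.
    by have : [set` s] P; [rewrite -es|].
  rewrite /point_div; have [e|_] := eqVneq P Q; last by rewrite mulr0.
  by rewrite e Qs in Ps.
apply: (@has_degree_ext (fun P => \sum_(Q <- s) D Q * point_div Q P)).
  by move=> P hP; rewrite -es.
elim: s ptS {es} => [|Q s IH] ptS.
  rewrite big_nil; apply: has_degree_ext has_degree0 => P _; by rewrite big_nil.
rewrite big_cons -[D Q]mulr1.
have h1 := has_degreeZ (D Q) (has_degree_point (ptS Q (mem_head _ _))).
have h2 := IH (fun P Ps => ptS P (mem_behead (s := Q :: s) Ps)).
by apply: has_degree_ext (has_degreeD h1 h2) => P _; rewrite big_cons.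
Qed.

End RiemannRoch.

(** * Finite modules and Frobenius powers *)

Section FiniteModules.
Variable F : fieldType.
Implicit Types (C N P : set F) (e : seq F) (x y : F).

Definition submodule C N : Prop :=
  [/\ N 0, forall x y, N x -> N y -> N (x + y) & forall a x, C a -> N x -> N (a * x)].

Definition span_over C e : set F := smallest (submodule C) [set` e].

Lemma span_over_submodule C e : submodule C (span_over C e).
Proof.
split; first by move=> N [[]].
- move=> x y hx hy N hN; have [[_ ND _] _] := hN.
  by apply: ND; [apply: hx|apply: hy].
- move=> a x Ca hx N hN; have [[_ _ NM] _] := hN.
  by apply: NM => //; apply: hx.
Qed.

Lemma span_over_mem C e x : x \in e -> span_over C e x.
Proof. by move=> xe N [_ h]; apply: h. Qed.

Lemma span_over_min C e N : submodule C N -> (forall x, x \in e -> N x) ->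
  span_over C e `<=` N.
Proof. by move=> sN h x; apply; split. Qed.

Lemma submodule_sum C N (I : Type) (r : seq I) (S : pred I) (f : I -> F) :
  submodule C N -> (forall i, S i -> N (f i)) -> N (\sum_(i <- r | S i) f i).
Proof. by move=> [N0 ND _] h; apply: big_ind. Qed.

Lemma submodule_preim C N y : submodule C N -> submodule C [set x | N (x * y)].
Proof.
move=> [N0 ND NM]; split=> /=; first by rewrite mul0r.
- by move=> a b Na Nb; rewrite mulrDl; apply: ND.
- by move=> a b Ca Nb; rewrite -mulrA; apply: NM.
Qed.

Definition integral_over C x : Prop := exists (n : nat) (c : nat -> F),
  [/\ (0 < n)%N, forall i, C (c i) & x ^+ n = \sum_(i < n) c i * x ^+ i].

(** The generators are the products of the earlier ones with [x ^ i], [i < n]; the power [x ^ n] is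
    reduced by the integral equation of [x]. *)
Lemma finite_extension C P (l : seq F) : subring C -> subring P -> C `<=` P ->
  (forall x, x \in l -> P x /\ integral_over C x) ->
  exists e, [/\ forall x, x \in e -> P x, span_over C e 1 &
    forall x y, x \in l -> span_over C e y -> span_over C e (x * y)].
Proof.
move=> sC sP CP; elim: l => [|x l IH] hl.
  exists [:: 1]; split=> //; last by apply: span_over_mem; rewrite mem_head.
  by move=> x; rewrite inE => /eqP ->; apply: subring1.
have [y yl|e [eP e1 el]] := IH; first by apply: hl; rewrite inE yl orbT.
have [Px [n [c [n0 hc ex]]]] := hl x (mem_head _ _).
pose e' := [seq a * x ^+ i | a <- e, i <- iota 0 n].
have [N0 ND NM] := span_over_submodule C e'.
have he' a i : (i < n)%N -> span_over C e a -> span_over C e' (a * x ^+ i).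
  move=> i_n; apply: (@span_over_min _ _ [set a | span_over C e' (a * x ^+ i)]).
    exact/submodule_preim/span_over_submodule.
  move=> b be; apply: span_over_mem; apply/allpairsP; exists (b, i).
  by rewrite /= mem_iota.
exists e'; split.
- move=> _ /allpairsP[[a i] /= [ae _ ->]].
  by apply: subringM => //; [apply: eP|apply: subringX].
- by rewrite -[1]mulr1 -(expr0 x); apply: he'.
move=> y z yl; rewrite mulrC.
apply: (@span_over_min _ _ [set z | span_over C e' (z * y)]).
  exact/submodule_preim/span_over_submodule.
move=> _ /allpairsP[[a i] /= [ae i_n ->]].
rewrite mem_iota add0n /= in i_n.
have sa : span_over C e a by apply: span_over_mem.
move: yl; rewrite inE => /orP[/eqP ->|yl]; last first.
  by rewrite mulrC mulrA; apply: he' => //; apply: el.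
rewrite -mulrA -exprSr; have [i_n'|n_i] := ltnP i.+1 n; first exact: he'.
have -> : i.+1 = n by apply/eqP; rewrite eqn_leq i_n n_i.
rewrite ex mulr_sumr; apply: (submodule_sum (C := C)) => // j _.
by rewrite mulrCA; apply: NM => //; apply: he'.
Qed.

(** Generators other than 1 are dropped one by one. Writing [a = c0 + u b] and [b = c1 a + y] gives
    [(1 - u c1) a = c0 + u y], and [1 - u c1] is a unit. *)
Lemma nakayama C P (u : F) e : subring C -> subring P -> C `<=` P -> C u ->
  (forall c, C c -> 1 - u * c != 0 /\ C (1 - u * c)^-1) ->
  (forall a, P a -> exists2 c, C c & exists2 b, P b & a = c + u * b) ->
  (forall x, x \in e -> P x) -> P `<=` span_over C (1 :: e) -> P `<=` C.
Proof.
move=> sC sP CP Cu hu hP; elim: e => [|a e IH] eP h.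
  apply: subset_trans h _; apply: span_over_min => [|x]; last first.
    by rewrite inE => /eqP ->; apply: subring1.
  by split; [apply: subring0|move=> x y; apply: subringD|move=> x y; apply: subringM].
have eP' x : x \in e -> P x by move=> xe; apply: eP; rewrite inE xe orbT.
apply: IH => //; apply: subset_trans (h) _.
have [N0 ND NM] := span_over_submodule C (1 :: e).
have N1 : span_over C (1 :: e) 1 by apply: span_over_mem; rewrite mem_head.
apply: span_over_min => // x; rewrite !inE => /or3P[/eqP -> //|/eqP ->|xe]; last first.
  by apply: span_over_mem; rewrite inE xe orbT.
have [c0 Cc0 [b Pb ea]] := hP a (eP a (mem_head _ _)).
have [c1 Cc1 [y Ny eb]] : exists2 c1, C c1 & exists2 y, span_over C (1 :: e) y & b = c1 * a + y.
  apply: (@span_over_min _ _ [set b | exists2 c1, C c1 &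
    exists2 y, span_over C (1 :: e) y & b = c1 * a + y] _ _ b (h _ Pb)).
    split.
    - by exists 0; [apply: subring0|exists 0; rewrite ?mul0r ?addr0].
    - move=> _ _ [c Cc [z Nz ->]] [d Cd [t Nt ->]]; exists (c + d); first exact: subringD.
      by exists (z + t); [apply: ND|rewrite mulrDl addrACA].
    - move=> f _ Cf [c Cc [z Nz ->]]; exists (f * c); first exact: subringM.
      by exists (f * z); [apply: NM|rewrite mulrDr mulrA].
  move=> z; rewrite !inE => /or3P[/eqP ->|/eqP ->|ze].
  - by exists 0; [apply: subring0|exists 1; rewrite ?mul0r ?add0r].
  - by exists 1; [apply: subring1|exists 0; rewrite ?mul1r ?addr0].
  - exists 0; first exact: subring0.
    by exists z; rewrite ?mul0r ?add0r //; apply: span_over_mem; rewrite inE ze orbT.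
have [v0 Cv] := hu _ Cc1.
have -> : a = (1 - u * c1)^-1 * (c0 * 1 + u * y).
  by apply: (mulfI v0); rewrite mulrA mulfV // mul1r mulrBl mul1r {1}ea eb; ring.
by apply: (NM) => //; apply: ND; apply: (NM).
Qed.

End FiniteModules.

Lemma frobD (R : idomainType) (p e : nat) (x y : R) : p \in [pchar R] ->
  (x + y) ^+ (p ^ e) = x ^+ (p ^ e) + y ^+ (p ^ e).
Proof.
move=> hp; rewrite exprDn_pchar //.
by rewrite (eq_pnat _ (pcharf_eq hp)) pnatX pnat_id ?(pcharf_prime hp).
Qed.

Lemma frob_sum (R : idomainType) (p e : nat) (I : Type) (r : seq I) (S : pred I)
    (f : I -> R) : p \in [pchar R] ->
  (\sum_(i <- r | S i) f i) ^+ (p ^ e) = \sum_(i <- r | S i) f i ^+ (p ^ e).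
Proof.
move=> hp; apply: (big_morph (fun x => x ^+ (p ^ e))) => [x y|]; first exact: frobD.
by rewrite expr0n expn_eq0; have /prime_gt0 := pcharf_prime hp; case: p {hp}.
Qed.

Lemma frobN (R : idomainType) (p e : nat) (x : R) : p \in [pchar R] ->
  (- x) ^+ (p ^ e) = - x ^+ (p ^ e).
Proof.
move=> hp; apply/eqP; rewrite -addr_eq0 -frobD // addNr expr0n expn_eq0.
by have /prime_gt0 := pcharf_prime hp; case: p {hp}.
Qed.

Lemma frob_root (k : closedFieldType) (n : nat) (c : k) : (0 < n)%N -> exists d, d ^+ n = c.
Proof.
move=> n0; have [d hd] := solve_monicpoly (fun i => if i == 0%N then c else 0) n0.
exists d; rewrite hd; case: n n0 {hd} => // n _.
by rewrite big_ord_recl expr0 mulr1 big1 ?addr0 // => i _; rewrite mul0r.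
Qed.

(** * Frobenius on the curve *)

Section FrobeniusOnCurve.
Variables (k : closedFieldType) (F : fieldType) (iota : {rmorphism k -> F}).
Variable E : set (set F).
Hypothesis hE : elliptic_curve iota E.
Variables (p e : nat).
Hypotheses (hp : p \in [pchar k]) (e0 : (0 < e)%N).
Implicit Types (P Q : set F) (G : set F -> int) (f x : F).
Local Notation pt := (closed_points E).
Local Notation q := (p ^ e)%N.
Let hS : smooth_projective_curve iota E := hE.1.
Let dv P : pt P -> dvr P := @pt_dvr _ _ _ _ hS P.
Let hpF : p \in [pchar F] := rmorph_pchar iota hp.

Lemma frob_gt1 : (1 < q)%N.
Proof.
have p2 := prime_gt1 (pcharf_prime hp).
by rewrite -(expn0 p) ltn_exp2l.
Qed.
Let q1 := frob_gt1.
Let q_neq0 : (q == 0%N) = false.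
Proof. by apply/negbTE; rewrite -lt0n ltnW. Qed.

Lemma digit_inj (n : nat) (a b : int) (i j : 'I_n) :
  n%:Z * a + i%:Z = n%:Z * b + j%:Z -> i = j.
Proof.
move=> h; apply: val_inj => /=; have := ltn_ord i; have := ltn_ord j => hj hi.
have : a = b by nia.
by move=> ab; move: h; rewrite ab => /addrI [].
Qed.

(* The orders of the terms [c_j ^+ q * s_j] are pairwise distinct modulo [q]. *)
Definition adapted P (b : int) (s : 'I_q -> F) : Prop :=
  forall j, s j != 0 /\ exists m : int, ord P (s j) = b + q%:Z * m + j%:Z.

Lemma adapted_val_ge P b s (c : 'I_q -> F) n : pt P -> adapted P b s ->
  val_ge P n (\sum_j c j ^+ q * s j) -> forall j, val_ge P n (c j ^+ q * s j).
Proof.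
move=> hP hs; apply: val_ge_distinct; first exact: dv.
move=> i j; rewrite !mulf_eq0 !expf_eq0 !negb_or !(ltnW q1) /=.
move=> /andP[ci si] /andP[cj sj]; have dP := dv hP.
rewrite !(ordM dP) ?expf_neq0 // !(ordX dP) //.
have [_ [m ->]] := hs i; have [_ [m' ->]] := hs j => h.
by apply: (@digit_inj q (ord P (c i) + m) (ord P (c j) + m')); lia.
Qed.

Lemma adapted_free P b s (c : 'I_q -> F) : pt P -> adapted P b s ->
  \sum_j c j ^+ q * s j = 0 -> forall j, c j = 0.
Proof.
move=> hP hs h j; apply: contrapT => /eqP cj; have [sj _] := hs j.
have cs0 : c j ^+ q * s j != 0 by rewrite mulf_neq0 ?expf_neq0.
have : val_ge P (ord P (c j ^+ q * s j) + 1) (c j ^+ q * s j).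
  by apply: (adapted_val_ge hP hs); rewrite h; left.
by move=> /(val_ge_ord cs0); rewrite lezD1 ltxx.
Qed.

(** The pole divisors of the given functions are added up. None has negative degree, since 1 is a
    section of each. *)
Lemma sec_bound (l : seq F) : exists G (n : nat),
  [/\ has_degree E G n%:Z, forall P, pt P -> 0 <= G P & forall f, f \in l -> sec E G f].
Proof.
elim: l => [|f l [G [n [hG G0 hl]]]].
  by exists (fun=> 0), 0%N; split=> //; apply: has_degree0.
pose H P : int := if `[< P f >] then 0 else - ord P f.
have H0 P : pt P -> 0 <= H P.
  move=> hP; rewrite /H; case: asboolP => // nP.
  rewrite oppr_ge0 leNgt; apply/negP => h; apply: nP.
  have [->|f0] := eqVneq f 0; first by apply: subring0; apply: (dv hP).1.
  by apply: (ord_ge0 (dv hP)) => //; apply: ltW.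
have dH : divisor E H.
  apply: sub_finite_set (finite_poles hS f) => P /= [hP]; rewrite /H.
  by case: asboolP => // _; rewrite eqxx.
have hH := divisor_degree dH.
have degH : 0 <= deg E H.
  rewrite leNgt; apply/negP => h.
  suff /eqP : (1 : F) = 0 by rewrite oner_eq0.
  apply: (sec_deg_lt0 hE hH h) => P hP.
  by right; rewrite (ord_one (dv hP)) oppr_le0 H0.
exists (fun P => G P + H P), (n + `|deg E H|)%N; split.
- by rewrite PoszD gez0_abs //; apply: has_degreeD.
- by move=> P hP; apply: addr_ge0; [apply: G0|apply: H0].
move=> g; rewrite inE => /orP[/eqP ->|/hl sg].
  apply: (sec_le (G := H)) => [P hP|P hP]; first by rewrite lerDr G0.
  rewrite /H; case: asboolP => [Pf|_]; last by right; rewrite opprK.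
  by rewrite oppr0; apply/(val_ge0 (dv hP)).
by apply: sec_le sg => P hP; rewrite lerDl H0.
Qed.

(* [F] has degree [q] over [F ^ q]: the products of [q]-th powers of sections of
   [n P] with [q + 1] given functions are too many to be independent. *)
Lemma adapted_span P b s x : pt P -> adapted P b s ->
  exists c : 'I_q -> F, x = \sum_j c j ^+ q * s j.
Proof.
move=> hP hs; pose w t := if t is Some j then s j else x.
have [G [n0 [hG G0 hw]]] := sec_bound (codom w).
(* The [(q + 1) n] products lie in a space of dimension at most [q n + n0 + 1], so this [n] is just
   large enough. *)
pose n := n0.+2.
have [v [sv fv]] : h0_ge iota E (fun Q => n%:Z * point_div P Q) n.
  apply: (h0_ge_deg hE (has_degreeZ n%:Z (has_degree_point hP))).
  by rewrite mulr1.
have hd : has_degree E (fun Q => q%:Z * (n%:Z * point_div P Q) + G Q) (q * n + n0)%N%:Z.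
  rewrite PoszD PoszM -[n%:Z in X in has_degree _ _ (X + _)]mulr1.
  apply: has_degreeD hG; do 2 apply: has_degreeZ.
  exact: has_degree_point.
have [||g [[[t1 a1] gi] hg]] := sec_dependent hE
  (v := fun ta : option 'I_q * 'I_n => v ta.2 ^+ q * w ta.1) hd.
- by rewrite card_prod card_option !card_ord mulSn /n; lia.
- move=> [t a] /= Q hQ.
  rewrite opprD -mulrN; apply: val_geM; first exact: dv.
    by apply: val_geX => //; [exact: dv|exact: sv|exact: ltnW].
  by apply: hw => //; apply: codom_f.
(* Coefficients in [k] have [q]-th roots, so the relation over [k] becomes a relation over [F ^ q]
   between the functions [w t]. *)
have root ta : {d | d ^+ q = g ta} by apply: cid; apply: frob_root; apply: ltnW.
pose h t := \sum_a iota (sval (root (t, a))) * v a.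
have hh : \sum_t h t ^+ q * w t = 0.
  rewrite -[RHS]hg (eq_bigr (fun ta => iota (g (ta.1, ta.2)) * (v ta.2 ^+ q * w ta.1)));
    last by case.
  rewrite -(pair_bigA _ (fun t a => iota (g (t, a)) * (v a ^+ q * w t))) /=.
  apply: eq_bigr => t _; rewrite frob_sum // mulr_suml; apply: eq_bigr => a _.
  by rewrite exprMn -rmorphXn (svalP (root _)) mulrA.
have hw0 : h None ^+ q * x + \sum_j h (Some j) ^+ q * s j = 0.
  rewrite -[RHS]hh (bigD1 None) //= (reindex_omap Some id) /=; last by case.
  by congr (_ + _); apply: eq_bigl => j; rewrite eqxx.
(* If the coefficient of [x] vanished, freeness of [s] over [F ^ q], then of [v] over [k], would
   make the whole relation trivial. *)
have hn0 : h None != 0.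
  apply/eqP => h0.
  have hS0 : forall j, h (Some j) = 0.
    apply: (adapted_free hP hs).
    by move: hw0; rewrite h0 expr0n q_neq0 mul0r add0r.
  have : h t1 = 0 by case: (t1) => [j|]; [exact: hS0|].
  move=> /fv /(_ a1) r0; have := svalP (root (t1, a1)).
  by rewrite r0 expr0n q_neq0 => /esym; apply/eqP.
exists (fun j => - (h (Some j) / h None)).
have -> : x = - (h None ^+ q)^-1 * \sum_j h (Some j) ^+ q * s j.
  move/eqP: hw0; rewrite addrC addr_eq0 => /eqP ->.
  by field; rewrite expf_neq0.
rewrite mulr_sumr; apply: eq_bigr => j _.
by rewrite frobN // expr_div_n; field; rewrite expf_neq0.
Qed.

(** In degree at least 2, [O_E(G - Q)] still has no [H^1] and order exactly [- G Q] is reached. In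
    degree 1, a nonzero section vanishing twice at [Q] would be a section of a divisor of degree
    [-1]. *)
Lemma sec_ord_le G n Q : has_degree E G n -> 0 < n -> pt Q -> exists f,
  [/\ sec E G f, f != 0 & ord Q f <= - G Q + 1].
Proof.
move=> hG n0 hQ; have [n2|n1] := ltP 1 n.
  have hG' := has_degreeD hG (has_degreeN (has_degree_point hQ)).
  have n1 : 0 < n + - 1 by lia.
  have [f [sf f0 ordf]] := h1_zero_pole hE (h1_zero_deg hE hG' n1) hQ.
  exists f; split=> //; first by apply: sec_le sf => R hR; lia.
  by rewrite ordf /point_div eqxx; lia.
have [v [sv fv]] := h0_ge_deg hE hG (n0 : 1%:Z <= n).
exists (v ord0); have v0 : v ord0 != 0 := free_family_neq0 ord0 fv.
split; [exact: sv|exact: v0|].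
rewrite leNgt; apply/negP => h.
have hG' := has_degreeD hG (has_degreeN (has_degreeZ 2%:Z (has_degree_point hQ))).
have n1' : n + - (2%:Z * 1) < 0 by lia.
suff /eqP : v ord0 = 0 by rewrite (negPf v0).
apply: (sec_deg_lt0 hE hG' n1') => R hR; right; have := val_ge_ord v0 (sv ord0 R hR).
by rewrite /point_div; have [->|_] := eqVneq R Q; lia.
Qed.

(** * The local ring of the curve recovered from coordinates of sections *)

Section Immersion.
Variables (P : set F) (G : set F -> int) (n : int) (s : 'I_q -> F) (C : set F).
Hypotheses (hP : pt P) (hG : has_degree E G n) (qn : q%:Z < n).
Hypotheses (sG : forall j, sec E G (s j))
  (os : forall j, s j != 0 /\ ord P (s j) = - G P + j%:Z).
Hypotheses (sC : subring C) (kC : range iota `<=` C) (CP : C `<=` P)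
  (domC : forall x, C x -> P x^-1 -> C x^-1).
Hypothesis coordC : forall c : 'I_q -> F,
  sec E G (\sum_j c j ^+ q * s j) -> forall j, C (c j).
Let dP := dv hP.

Let adP : adapted P (- G P) s.
Proof. by move=> j; have [sj oj] := os j; split=> //; exists 0; rewrite oj mulr0 addr0. Qed.

Let H Q : int := G Q - q%:Z * point_div P Q.

Let H_degree : has_degree E H (n - q%:Z).
Proof.
have := has_degreeD hG (has_degreeN (has_degreeZ q%:Z (has_degree_point hP))).
by rewrite mulr1.
Qed.

(** Passing from [G] to [H = G - q P] raises the required order at [P] by [q]. The terms have order
    [q ord(c_j) + j - G P] with [j < q], so every nonzero coordinate gains at least one order. *)
Let coord_sec f : sec E H f -> exists c : 'I_q -> F,
  [/\ f = \sum_j c j ^+ q * s j, forall j, C (c j) & forall j, val_ge P 1 (c j)].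
Proof.
move=> sf; have [c ec] := adapted_span f hP adP; exists c; split=> //.
  apply: coordC; rewrite -ec; apply: sec_le sf => Q _.
  by rewrite /H gerBl mulr_ge0.
move=> j; have [->|cj] := eqVneq (c j) 0; first by left.
have := adapted_val_ge (c := c) (n := - H P) hP adP.
rewrite -ec => /(_ (sf P hP) j).
have [sj oj] := os j; move=> /val_ge_ord; rewrite mulf_neq0 ?expf_neq0 // => /(_ isT).
rewrite (ordM dP) ?expf_neq0 // (ordX dP) // oj /H /point_div eqxx => h.
by right; have := ltn_ord j; nia.
Qed.

Let nonunitC x : C x -> nonunit C x <-> val_ge P 1 x.
Proof.
move=> Cx; rewrite -(nonunitE dP); split=> -[_ h]; split=> //; first exact: CP.
  by case: h => [|h]; [left|right=> /(domC Cx)].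
by case: h => [|h]; [left|right=> /CP].
Qed.

(** If all coordinates vanished twice at [P], every section of [H] would have order at least
    [- H P + q] there, while some section has order at most [- H P + 1]; and [q > 1]. *)
Let uniformizerC : exists u, [/\ C u, u != 0 & ord P u = 1].
Proof.
have n0 : 0 < n - q%:Z by lia.
have [f [sf f0 of_]] := sec_ord_le H_degree n0 hP.
have [c [ef Cc mc]] := coord_sec sf.
apply: contrapT => h.
have c2 j : val_ge P 2 (c j).
  have [->|cj] := eqVneq (c j) 0; first by left.
  right; have := val_ge_ord cj (mc j); rewrite le_eqVlt => /orP[/eqP e1|]; last by lia.
  by case: h; exists (c j).
have : val_ge P (- H P + q%:Z) f.
  rewrite ef; apply: val_ge_sum => // j _.
  have : val_ge P (q%:Z * 2 + - G P) (c j ^+ q * s j).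
    apply: val_geM => //; last exact: sG.
    by apply: val_geX => //; apply: ltnW.
  by apply: val_ge_le; rewrite /H /point_div eqxx; lia.
by move=> /(val_ge_ord f0); move: of_ (q1); lia.
Qed.

(** At a point [V] other than [P], domination makes the coordinates of every section of [H] vanish
    at [V], so that all these sections would have order at least [- G V + q]. Again some section has
    order at most [- G V + 1]. *)
Let dominating_valuation V : valuation_ring V -> C `<=` V ->
  (forall x, nonunit C x -> nonunit V x) -> V = P.
Proof.
move=> vV CV domV.
have [u [Cu u0 ou]] := uniformizerC.
have nu : nonunit V u by apply: domV; apply/(nonunitC Cu); right; rewrite ou.
have hV : pt V.
  apply: (valuation_pt hS) => //; first exact: subset_trans CV.
  by move=> VT; apply: (unit_not_nonunit u0 _ nu); rewrite VT.
have dV := dv hV; apply: contrapT => /eqP VP.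
have n0 : 0 < n - q%:Z by lia.
have [f [sf f0 of_]] := sec_ord_le H_degree n0 hV.
have [c [ef Cc mc]] := coord_sec sf.
have : val_ge V (- G V + q%:Z) f.
  rewrite ef; apply: val_ge_sum => // j _; rewrite addrC -[q%:Z]mulr1.
  apply: val_geM => //; last exact: sG.
  apply: val_geX => //; last exact: ltnW.
  by apply/(nonunitE dV)/domV/(nonunitC (Cc j)).
move=> /(val_ge_ord f0); move: of_ (q1); rewrite /H /point_div (negPf VP); lia.
Qed.

(** Consider the ideal of [C[x^-1]] generated by [x^-1] and the maximal ideal of [C]. If it is
    proper, a valuation ring dominating [C] has [x^-1] in its maximal ideal; this ring is [O_P],
    which contains [x]. If not, a relation [1 = r(x^-1)] with [1 - r_0] a unit becomes an integral
    equation. *)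
Let integralC x : P x -> integral_over C x.
Proof.
move=> Px; have [->|x0] := eqVneq x 0.
  exists 1%N, (fun=> 0); split=> // [i|]; first exact: subring0.
  by rewrite big_ord1 mul0r expr1.
apply: contrapT => nint.
pose I := [set y | exists2 r, coefs_in C r & val_ge P 1 r`_0 /\ y = r.[x^-1]].
have CX : coefs_in C 'X.
  by move=> i; rewrite coefX; case: eqP => _; [apply: subring1|apply: subring0].
have iI : is_ideal (values C x^-1) I.
  split.
  - by move=> _ [r hr [_ ->]]; exists r.
  - exists 0; first by move=> i; rewrite coef0; apply: subring0.
    by rewrite coef0 horner0; split=> //; left.
  - move=> _ _ [r hr [r0 ->]] [t ht [t0 ->]]; exists (r + t).
      by move=> i; rewrite coefD; apply: subringD.
    by rewrite hornerD coefD; split=> //; apply: val_geD.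
  - move=> _ _ [r hr <-] [t ht [t0 ->]]; exists (r * t).
      by move=> i; rewrite coefM; apply: subring_sum => // j _; apply: subringM.
    rewrite hornerM coef0M; split=> //; rewrite -[1 : int]add0r; apply: val_geM => //.
    exact/(val_ge0 dP)/CP.
have [|V [vV CV IV]] := chevalley (values_subring x^-1 sC) iI.
  case=> r hr [r0 e1]; apply: nint.
  have [v0 Cv] : 1 - r`_0 != 0 /\ C (1 - r`_0)^-1.
    have C1r : C (1 - r`_0) by apply: subringB => //; apply: subring1.
    apply: not_nonunit => // /(nonunitC C1r) h.
    have /(nonunitE dP) : val_ge P 1 1.
      by rewrite -(subrK r`_0 1); apply: (val_geD dP).
    by apply: nonunit1; apply: dP.1.
  exists (size r), (fun i => r`_(size r - i) * (1 - r`_0)^-1); split.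
  - rewrite lt0n size_poly_eq0; apply/eqP => rz.
    by move: e1; rewrite rz horner0 => /eqP; rewrite oner_eq0.
  - by move=> i; apply: subringM.
  have e2 : 1 - r`_0 = \sum_(i < size r) r`_i.+1 * x^-1 ^+ i.+1.
    rewrite e1 (@horner_coef_wide _ (size r).+1) // big_ord_recl.
    by rewrite expr0 mulr1 addrAC subrr add0r.
  apply: (mulfI v0); rewrite mulr_sumr {1}e2 mulr_suml.
  rewrite [RHS](reindex_inj rev_ord_inj) /=; apply: eq_bigr => i _.
  rewrite subKn // -mulrA exprVn.
  have -> : (1 - r`_0) * (r`_i.+1 / (1 - r`_0) * x ^+ (size r - i.+1)) =
    r`_i.+1 * x ^+ (size r - i.+1) by field.
  congr (_ * _); apply: (mulfI (expf_neq0 i.+1 x0)).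
  by rewrite mulrA mulfV ?expf_neq0 // mul1r -exprD subnKC.
have VP : V = P.
  apply: dominating_valuation => //; first exact: subset_trans (values_sub _ sC) CV.
  move=> y hy; apply: IV; exists y%:P; last rewrite hornerC coefC eqxx.
    by move=> i; rewrite coefC; case: eqP => _; [case: hy|apply: subring0].
  by split=> //; apply/nonunitC => //; case: hy.
have : nonunit V x^-1.
  by apply: IV; exists 'X => //; rewrite coefX hornerX; split=> //; left.
by apply: unit_not_nonunit; rewrite ?invr_eq0 // invrK VP.
Qed.

(* [O_P] is the only valuation ring dominating [C], hence integral over [C]; it
   is then finite over [C], with the same residue field and uniformizer. *)
Lemma immersion : P `<=` C.
Proof.
have [EP _] := hP; have [l [lP _ _]] := curve_chart hS EP.
have sk := adjoin_subring (range iota) l.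
have [_ klP eP] := affE sk lP.
have lint x : x \in l -> P x /\ integral_over C x.
  by move=> xl; have Px : P x; [apply: klP; apply: adjoin_mem|split=> //; apply: integralC].
have [g [gP g1 gl]] := finite_extension sC dP.1 CP lint.
have [N0 ND NM] := span_over_submodule C g.
have [u [Cu u0 ou]] := uniformizerC.
have mu x : P x -> val_ge P 1 (u * x).
  move=> /(val_ge0 dP) hx; rewrite -[1 : int]addr0; apply: (val_geM dP) => //.
  by right; rewrite ou.
apply: (nakayama sC dP.1 CP Cu) gP _.
- move=> c Cc; have C1 : C (1 - u * c).
    by apply: subringB => //; [apply: subring1|apply: subringM].
  apply: not_nonunit => // /(nonunitC C1) h.
  have /(nonunitE dP) : val_ge P 1 1.
    by rewrite -(subrK (u * c) 1); apply: (val_geD dP) => //; apply/mu/CP.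
  by apply: nonunit1; apply: dP.1.
- move=> a Pa; have [c hc] := residue_const hS hP Pa.
  exists (iota c); first by apply: kC; exists c.
  exists ((a - iota c) / u); last by field.
  apply/(val_ge0 dP); rewrite -(subrr 1); apply: (val_geM dP) => //.
  by right; rewrite (ordV dP) // ou.
(* The multipliers of the finite module form a ring. Since 1 lies in the module, it is enough that
   all of [O_P] consists of multipliers. *)
pose M := [set y | forall z, span_over C g z -> span_over C g (y * z)].
have sM : subring M.
  apply/subringP; split.
  - by move=> z; rewrite mul1r.
  - move=> y y' hy hy' z hz; rewrite mulrBl -[X in _ - X]mul1r -mulNr.
    apply: (ND); first exact: hy.
    by apply: (NM); [apply: subringN => //; apply: subring1|apply: hy'].
  - by move=> y y' hy hy' z hz; rewrite -mulrA; apply: hy; apply: hy'.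
have CM : C `<=` M by move=> c Cc z hz; exact: (NM _ _ Cc hz).
have klM : adjoin (range iota) l `<=` M.
  apply: adjoin_min => //; first exact: subset_trans CM.
  by move=> x xl z hz; apply: gl.
(* The inverse of [w] is again integral over [C]; its equation multiplied by [w ^ (m - 1)] writes
   [w^-1] as a polynomial in [w] over [C]. *)
have invM w : adjoin (range iota) l w -> w != 0 -> P w^-1 -> M w^-1.
  move=> kw w0 /integralC [m [c [m0 hc ew]]].
  have -> : w^-1 = \sum_(i < m) c i * w ^+ (m.-1 - i).
    have -> : w^-1 = w^-1 ^+ m * w ^+ m.-1.
      case: m m0 {hc ew} => // m _; rewrite exprS -mulrA -exprMn mulVf //.
      by rewrite expr1n mulr1.
    rewrite ew mulr_suml; apply: eq_bigr => i _; rewrite -mulrA; congr (_ * _).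
    have im : (i <= m.-1)%N by have := ltn_ord i; lia.
    by rewrite -{1}(subnKC im) exprD mulrA -exprMn mulVf // expr1n mul1r.
  apply: (subring_sum _ sM) => i _.
  by apply: (subringM sM); [apply: CM|apply: (subringX _ sM); apply: klM].
apply: (@subset_trans _ (span_over C g)); last first.
  apply: span_over_min; first exact: span_over_submodule.
  by move=> x xg; apply: span_over_mem; rewrite inE xg orbT.
move=> x; rewrite eP => /centreP [//|//|a [w [ka kw w0 Pw ->]]].
have h1 : M (a / w) by apply: (subringM sM); [apply: klM|apply: invM].
by rewrite -[_ / _]mulr1; apply: h1.
Qed.

End Immersion.
End FrobeniusOnCurve.

(** * The section ring and its charts *)

Lemma fraction_split (R : idomainType) (x : {fraction R}) :
  exists n d : R, d != 0 /\ x = tofrac n / tofrac d.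
Proof.
elim/quotW: x => r; exists \n_r, \d_r; have d0 := denom_ratioP r; split=> //.
have d0' : tofrac \d_r != 0 by rewrite tofrac_eq0.
apply: (canRL (mulfK d0')); unlock tofrac; rewrite -[LHS]FracField.pi_mul.
apply/eqP; rewrite FracField.equivf_def /FracField.mulf.
rewrite !numden_Ratio ?oner_eq0 ?mulf_neq0 ?oner_eq0 //.
by rewrite !mulr1 mulrC.
Qed.

Section Monomials.
Variable F : fieldType.
Local Notation K := {fraction {poly F}}.
Implicit Types (x y : F) (a : {poly F}).

Definition mono (n : nat) x : K := tofrac (x *: 'X^n).

Lemma monoM n m x y : mono n x * mono m y = mono (n + m) (x * y).
Proof. by rewrite /mono -tofracM -scalerAl -scalerAr scalerA exprD. Qed.

Lemma monoD n x y : mono n (x + y) = mono n x + mono n y.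
Proof. by rewrite /mono scalerDl tofracD. Qed.

Lemma monoB n x y : mono n (x - y) = mono n x - mono n y.
Proof. by rewrite /mono scalerBl tofracB. Qed.

Lemma mono0 n : mono n 0 = 0.
Proof. by rewrite /mono scale0r tofrac0. Qed.

Lemma mono_one : mono 0 1 = 1.
Proof. by rewrite /mono scale1r expr0 tofrac1. Qed.

Lemma mono_eq0 n x : (mono n x == 0) = (x == 0).
Proof. by rewrite /mono tofrac_eq0 scaler_eq0 expf_eq0 polyX_eq0 andbF orbF. Qed.

Lemma monoX n x (m : nat) : mono n x ^+ m = mono (n * m) (x ^+ m).
Proof. by rewrite /mono -tofracXn exprZn -exprM. Qed.

Lemma monoV x : (mono 0 x)^-1 = mono 0 x^-1.
Proof.
have [->|x0] := eqVneq x 0; first by rewrite invr0 mono0 invr0.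
have m0 : mono 0 x != 0 by rewrite mono_eq0.
by apply: (mulfI m0); rewrite mulfV // monoM mulfV // mono_one.
Qed.

Lemma mono_sum n (I : Type) (r : seq I) (S : pred I) (f : I -> F) :
  mono n (\sum_(i <- r | S i) f i) = \sum_(i <- r | S i) mono n (f i).
Proof. by apply: (big_morph (mono n)) => [x y|]; [apply: monoD|apply: mono0]. Qed.

Lemma tofrac_mono a : tofrac a = \sum_(i < size a) mono i a`_i.
Proof. by rewrite -{1}[a]coefK poly_def rmorph_sum. Qed.

(** The trace of [R] on the subfield [F] of [F(t)]. On local rings it reflects the projection of the
    relative spectrum to [E]. *)
Definition constants (R : set K) : set F := [set x | R (mono 0 x)].

Lemma constants_subring R : subring R -> subring (constants R).
Proof.
move=> sR; apply/subringP; split.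
- by rewrite /constants /= mono_one; apply: subring1.
- by move=> x y; rewrite /constants /= monoB; apply: subringB.
- by move=> x y; rewrite /constants /= => hx; rewrite -[0%N]/(0 + 0)%N -monoM;
    apply: subringM.
Qed.

Lemma constants_nonunit R x : nonunit (constants R) x <-> nonunit R (mono 0 x).
Proof.
rewrite /nonunit /constants /= monoV.
split=> -[Rx [h|h]]; split=> //; [left|by right|left|by right].
  by rewrite h mono0.
by move/eqP: h; rewrite mono_eq0 => /eqP.
Qed.

Lemma constants_local R : is_local R -> is_local (constants R).
Proof.
move=> [sR h]; split; first exact: constants_subring.
by move=> x y /constants_nonunit hx /constants_nonunit hy;
   apply/constants_nonunit; rewrite monoD; apply: h.
Qed.

Lemma constants_valuation R : valuation_ring R -> valuation_ring (constants R).
Proof.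
move=> [sR h]; split; first exact: constants_subring.
by move=> x; have := h (mono 0 x); rewrite monoV.
Qed.

End Monomials.

Section SectionRing.
Variables (k : closedFieldType) (F : fieldType) (iota : {rmorphism k -> F}).
Variable E : set (set F).
Hypothesis hE : elliptic_curve iota E.
Variable D : set F -> int.
Local Notation K := {fraction {poly F}}.
Local Notation pt := (closed_points E).
Implicit Types (P Q : set F) (R V : set K) (x y : F) (n : nat).
Let hS : smooth_projective_curve iota E := hE.1.
Let dv P : pt P -> dvr P := @pt_dvr _ _ _ _ hS P.
Local Notation A := (section_ring E D).
Local Notation S := (section_algebra D).

Definition multiple n : set F -> int := fun P => n%:Z * D P.

Lemma section_ringP (z : K) : A z <-> exists2 a, z = tofrac a & forall n, sec E (multiple n) a`_n.
Proof. by split=> -[a h1 h2]; exists a. Qed.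

Lemma section_ring_mono n x : sec E (multiple n) x -> A (mono n x).
Proof.
move=> sx; exists (x *: 'X^n) => // m P hP /=; rewrite coefZ coefXn.
by case: eqP => [->|_]; [rewrite mulr1; apply: sx|left; rewrite mulr0].
Qed.

Lemma section_algebraP P (z : K) :
  S P z <-> exists2 a, z = tofrac a & forall n, val_ge P (- multiple n P) a`_n.
Proof. by split=> -[a h1 h2]; exists a. Qed.

Lemma section_algebra_mono P n x : val_ge P (- multiple n P) x -> S P (mono n x).
Proof.
move=> sx; exists (x *: 'X^n) => // m /=; rewrite coefZ coefXn.
by case: eqP => [->|_]; [rewrite mulr1|left; rewrite mulr0].
Qed.

Lemma section_ring_sub P : pt P -> A `<=` S P.
Proof.
by move=> hP z /section_ringP[a -> ha]; apply/section_algebraP; exists a => // n; apply: ha.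
Qed.

Lemma section_algebra_subring P : pt P -> subring (S P).
Proof.
move=> hP; have dP := dv hP; apply/subringP; split.
- rewrite -mono_one; apply: section_algebra_mono; rewrite /multiple mul0r oppr0.
  by right; rewrite (ord_one dP).
- move=> _ _ /section_algebraP[a -> ha] /section_algebraP[b -> hb].
  apply/section_algebraP; exists (a - b); first by rewrite tofracB.
  by move=> n; rewrite coefB; apply: val_geB.
- move=> _ _ /section_algebraP[a -> ha] /section_algebraP[b -> hb].
  apply/section_algebraP; exists (a * b); first by rewrite tofracM.
  move=> n; rewrite coefM; apply: val_ge_sum => // i _.
  have -> : - multiple n P = - multiple i P + - multiple (n - i) P.
    by rewrite /multiple -subzn ?leq_ord //; ring.
  exact: val_geM.
Qed.

(** For a local generator [w] of [L] the stalk is [O_P[w t]], as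
    [a t ^ i = (a / w ^ i) (w t) ^ i]. *)
Lemma section_algebra_gen P R (w : F) : pt P -> subring R ->
  (forall x, P x -> R (mono 0 x)) -> w != 0 -> ord P w = - D P -> R (mono 1 w) ->
  S P `<=` R.
Proof.
move=> hP sR PR w0 ow Rw _ /section_algebraP[a -> ha]; have dP := dv hP.
rewrite tofrac_mono; apply: subring_sum => // i _.
have -> : mono i a`_i = mono 0 (a`_i / w ^+ i) * mono 1 w ^+ i.
  by rewrite monoX monoM add0n mul1n divfK ?expf_neq0.
apply: subringM => //; last exact: subringX.
apply: PR; apply/(val_ge0 dP).
have -> : 0 = - multiple i P + multiple i P by rewrite addNr.
apply: val_geM => //; right.
by rewrite (ordV dP) ?expf_neq0 // (ordX dP) // ow mulrN opprK lexx.
Qed.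

Lemma section_ring_const x : range iota x -> A (mono 0 x).
Proof.
case=> c _ <-; apply: section_ring_mono => P hP; rewrite /multiple mul0r oppr0.
by apply/(val_ge0 (dv hP)); apply: (pt_const hS).
Qed.

(** A polynomial has finitely many coefficients, so a high enough order at [P] compensates all their
    poles and the twists by [D P]. *)
Lemma section_algebra_scale P (a : {poly F}) : pt P -> exists N : nat,
  forall x, N%:Z <= ord P x -> S P (mono 0 x * tofrac a).
Proof.
move=> hP; have dP := dv hP.
pose c i := (`|ord P a`_i| + i * `|D P|)%N.
exists (\sum_(i < size a) c i)%N => x hx.
rewrite tofrac_mono mulr_sumr; apply: (subring_sum _ (section_algebra_subring hP)) => i _.
rewrite monoM add0n; apply: section_algebra_mono.
have [->|x0] := eqVneq x 0; first by rewrite mul0r; left.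
have [->|a0] := eqVneq a`_i 0; first by rewrite mulr0; left.
right; rewrite (ordM dP) // /multiple.
have le_c : (c i)%:Z <= ord P x.
  by apply: le_trans hx; rewrite lez_nat (bigD1 i) //= leq_addr.
have := ler_norm (- ord P a`_i); have := ler_wpM2l (ler0n int i) (ler_norm (- D P)).
move: le_c; rewrite /c PoszD PoszM !abszE !normrN mulrN; lia.
Qed.

(** Every nonzero element of [F] is a unit of [V]. Numerator and denominator can thus be multiplied
    by a power of a uniformizer at [Q] that brings both into the other chart. *)
Lemma centre_generic P Q V : is_local V -> constants V = setT -> pt P -> pt Q ->
  S P `<=` V -> S Q `<=` V -> centre V (S P) `<=` centre V (S Q).
Proof.
move=> lV cV hP hQ PV QV z /centreP [|//|b [s [hb hs s0 Vs ->]]].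
  exact: section_algebra_subring.
have sV := lV.1; case/section_algebraP: hb => a ea _.
case/section_algebraP: hs => r er _.
have [N hN] := section_algebra_scale a hQ; have [M hM] := section_algebra_scale r hQ.
have [u u0 ou] := ord_uniformizer (dv hQ).
pose x := u ^ (N + M)%N%:Z; have x0 : x != 0 by rewrite expfz_neq0.
have m0 : mono 0 x != 0 by rewrite mono_eq0.
apply: (centre_scale sV (section_algebra_subring hQ) QV m0 s0 _ Vs).
- have : constants V x^-1 by rewrite cV.
  by rewrite /constants /= -monoV.
- by rewrite ea; apply: hN; rewrite /x ou; lia.
- by rewrite er; apply: hM; rewrite /x ou; lia.
Qed.

(** The trace of [V] on [F] is either all of [F], where charts agree generically, or a closed point,
    which then equals both [P] and [Q]. *)
Lemma centre_unique P Q V : valuation_ring V -> pt P -> pt Q ->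
  S P `<=` V -> S Q `<=` V -> centre V (S P) = centre V (S Q).
Proof.
move=> vV hP hQ PV QV; have lV := valuation_local vV.
have cst R Z : pt Z -> S Z `<=` R -> Z `<=` constants R.
  move=> hZ ZR x Zx; apply: ZR; apply: section_algebra_mono.
  by rewrite /multiple mul0r oppr0; apply/(val_ge0 (dv hZ)).
have [e|ne] := pselect (constants V = setT).
  by apply/seteqP; split; apply: centre_generic.
have hV : pt (constants V).
  apply: (valuation_pt hS) => //; first exact: constants_valuation.
  by apply: subset_trans (cst _ _ hP PV); apply: (const_sub hS); case: hP.
by rewrite (pt_eq hS hP hV (cst _ _ hP PV)) (pt_eq hS hQ hV (cst _ _ hQ QV)).
Qed.

Lemma relative_spec_centre R P : is_local R -> pt P -> S P `<=` R ->
  relative_spec E D (centre R (S P)).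
Proof.
by move=> lR hP PR; exists P => //; apply: aff_centre => //; apply: section_algebra_subring.
Qed.

Lemma relative_spec_dominated R (y : set K) : relative_spec E D y -> subring R -> dominates R y ->
  exists P, [/\ pt P, S P `<=` R & y = centre R (S P)].
Proof.
move=> [P hP hy] sR Ry; exists P.
by have [] := aff_dominated (section_algebra_subring hP) hy sR Ry.
Qed.

Hypotheses (hD : divisor E D) (hd : 2%:Z <= deg E D).

Lemma multiple_degree n : has_degree E (multiple n) (n%:Z * deg E D).
Proof. exact/has_degreeZ/divisor_degree. Qed.

(** As [d >= 2], [O_E(D - P)] has positive degree and no [H^1], so [L] is globally generated. *)
Lemma generator_at P : pt P -> exists w, [/\ sec E (multiple 1) w, w != 0 & ord P w = - D P].
Proof.
move=> hP.
have hG := has_degreeD (multiple_degree 1) (has_degreeN (has_degree_point hP)).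
have n0 : 0 < 1%:Z * deg E D + - 1 by lia.
have [w [sw w0 ow]] := h1_zero_pole hE (h1_zero_deg hE hG n0) hP.
exists w; split=> //; first by apply: sec_le sw => Q _; lia.
by rewrite ow /multiple /point_div eqxx; lia.
Qed.

Lemma valuation_center V : valuation_ring V -> A `<=` V ->
  exists P, pt P /\ S P `<=` V.
Proof.
move=> vV AV; have vVF := constants_valuation vV.
have kVF : range iota `<=` constants V by move=> x /section_ring_const/AV.
have [P [hP PV]] : exists P, pt P /\ P `<=` constants V.
  have [e|ne] := pselect (constants V = setT).
    by have [P hP] := exists_pt hS; exists P; rewrite e.
  by exists (constants V); split=> //; apply: (valuation_pt hS).
exists P; split=> //; have [w [sw w0 ow]] := generator_at hP.
by apply: (section_algebra_gen hP vV.1 PV w0 ow); apply/AV/section_ring_mono.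
Qed.

Lemma relative_spec_valuation V : valuation_ring V -> A `<=` V ->
  exists! y : set K, relative_spec E D y /\ dominates V y.
Proof.
move=> vV AV; have lV := valuation_local vV.
have [P [hP PV]] := valuation_center vV AV.
exists (centre V (S P)); split.
  split; first exact: relative_spec_centre.
  by apply: centre_dominated => //; apply: section_algebra_subring.
move=> y [/relative_spec_dominated h /h [|Q [hQ QV ->]]]; first exact: vV.1.
exact: centre_unique.
Qed.

End SectionRing.

(** * Finitely many affine charts for the relative spectrum *)

Section Charts.
Variables (k : closedFieldType) (F : fieldType) (iota : {rmorphism k -> F}).
Variable E : set (set F).
Hypothesis hE : elliptic_curve iota E.
Variable D : set F -> int.
Hypotheses (hD : divisor E D) (hd : 2%:Z <= deg E D).
Local Notation K := {fraction {poly F}}.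
Local Notation pt := (closed_points E).
Local Notation k0 := (range iota).
Implicit Types (P Q : set F) (R V : set K) (x y : F) (n : nat).
Let hS : smooth_projective_curve iota E := hE.1.
Let dv P : pt P -> dvr P := @pt_dvr _ _ _ _ hS P.
Local Notation A := (section_ring E D).
Local Notation S := (section_algebra D).

Lemma pt_centre (l : seq F) P : aff (adjoin k0 l) `<=` E -> pt P ->
  adjoin k0 l `<=` P -> P = centre P (adjoin k0 l).
Proof.
move=> lE hP lP; have lcP := valuation_local (dvr_valuation (dv hP)).
have sl := adjoin_subring k0 l.
have [cP _] := centre_dominated lcP sl lP.
apply: esym; apply: (pt_eq hS) => //; split; first exact/lE/aff_centre.
by move=> e; apply: (dvr_proper (dv hP)); apply/seteqP; split=> // x _; apply: cP; rewrite e.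
Qed.

(** Otherwise every denominator allowed at [Q] would be allowed at [P], and [O_Q] would be contained
    in [O_P]. *)
Lemma separate_points (l : seq F) P Q : aff (adjoin k0 l) `<=` E -> pt P -> pt Q -> P <> Q ->
  adjoin k0 l `<=` P -> adjoin k0 l `<=` Q ->
  exists h, [/\ adjoin k0 l h, val_ge P 1 h & ~ val_ge Q 1 h].
Proof.
move=> lE hP hQ PQ lP lQ; apply: contrapT => no; apply: PQ; apply: esym.
apply: (pt_eq hS hQ hP); rewrite (pt_centre lE hQ lQ).
have sl := adjoin_subring k0 l.
move=> x /centreP [//|//|a [s [la ls s0 Qs ->]]].
apply: (subringM (dv hP).1); first exact: lP.
suff ns : ~ nonunit P s by have [] := not_nonunit (lP _ ls) ns.
move=> /(nonunitE (dv hP)) h; apply: no; exists s; split=> //.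
by move=> /(nonunitE (dv hQ)); apply: unit_not_nonunit.
Qed.

(** Inverting the resulting product removes the points of [T] from an affine chart while keeping
    [Q]. *)
Lemma separate_finite (l : seq F) Q (T : seq (set F)) : aff (adjoin k0 l) `<=` E ->
  pt Q -> adjoin k0 l `<=` Q -> (forall P, P \in T -> pt P /\ P <> Q) ->
  exists h, [/\ adjoin k0 l h, ~ val_ge Q 1 h &
    forall P, P \in T -> adjoin k0 l `<=` P -> val_ge P 1 h].
Proof.
move=> lE hQ lQ; have sl := adjoin_subring k0 l; have dQ := dv hQ.
elim: T => [|P T IH] hT.
  exists 1; split=> //; first exact: subring1.
  by move=> /(nonunitE dQ); apply: nonunit1; apply: dQ.1.
have [R RT|h [lh nh hh]] := IH; first by apply: hT; rewrite inE RT orbT.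
have [hP PQ] := hT P (mem_head _ _).
have [lP|nlP] := pselect (adjoin k0 l `<=` P); last first.
  by exists h; split=> // R; rewrite inE => /orP[/eqP -> /nlP|/hh].
have [g [lg vg ng]] := separate_points lE hP hQ PQ lP lQ.
exists (g * h); split; first exact: (subringM sl).
  move=> /(nonunitE dQ) /(local_prime dQ.1 (lQ _ lg) (lQ _ lh)).
  by case=> /(nonunitE dQ).
have le (R : set F) a b : pt R -> val_ge R 1 a -> R b -> val_ge R 1 (b * a).
  move=> /dv dR va /(val_ge0 dR) vb; rewrite -[1 : int]add0r; exact: val_geM.
move=> R; rewrite inE => /orP[/eqP ->|RT] lR.
  by rewrite mulrC; apply: le => //; apply: lR.
have [hR _] : pt R /\ R <> Q by apply: hT; rewrite inE RT orbT.
by apply: le => //; [apply: hh|apply: lR].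
Qed.

Lemma finite_non_generating (w : F) : w != 0 -> finite_set [set P | pt P /\ ord P w != - D P].
Proof.
move=> w0.
have h : finite_set ([set P | pt P /\ D P != 0] `|`
    ([set P | pt P /\ ~ P w] `|` [set P | pt P /\ ~ P w^-1])).
  by rewrite !finite_setU; split=> //; split; apply: (finite_poles hS).
apply: sub_finite_set h => P [hP nP]; have dP := dv hP.
have [DP|DP] := eqVneq (D P) 0; [right|by left].
have [Pw|Pw] := pselect (P w); [right|by left]; split=> // Pw'.
move/eqP: nP; apply; rewrite DP oppr0.
apply/eqP; rewrite eq_le; apply/andP; split; last first.
  exact/(val_ge_ord w0)/(val_ge0 dP).
have := val_ge_ord _ ((val_ge0 dP _).2 Pw'); rewrite invr_eq0 (ordV dP) // => /(_ w0).
by rewrite oppr_ge0.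
Qed.

Definition good_for (l : seq F) P := pt P /\ forall x, x \in l -> P x.

Lemma finite_bad (l : seq F) : finite_set [set P | pt P /\ ~ good_for l P].
Proof.
elim: l => [|x l IH].
  by apply: sub_finite_set (finite_set0 _) => P [hP n]; apply: n.
have h : finite_set ([set P | pt P /\ ~ P x] `|` [set P | pt P /\ ~ good_for l P]).
  by rewrite finite_setU; split=> //; apply: (finite_poles hS).
apply: sub_finite_set h => P [hP nP].
have [Px|Px] := pselect (P x); [right|by left]; split=> // -[_ Pl]; apply: nP.
by split=> // y; rewrite inE => /orP[/eqP ->|/Pl].
Qed.

(* Near a closed point, [S_P] is the polynomial ring [O_P[w t]] for a local
   generator [w] of [L], and [O_P] is a localization of a coordinate ring. *)
Lemma relative_spec_chart P0 : pt P0 -> exists (s : seq K) (l : seq F),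
  [/\ good_for l P0,
      aff (adjoin A s) `<=` relative_spec E D,
      forall P, good_for l P -> aff (S P) `<=` aff (adjoin A s)
    & localization (adjoin A s) [set 0] = setT].
Proof.
move=> hP0; have [EP0 _] := hP0; have dP0 := dv hP0.
have [l [lP0 lE lK]] := curve_chart hS EP0; have sl := adjoin_subring k0 l.
have [_ klP0 _] := affE sl lP0.
have [u u0 ou] := ord_uniformizer dP0; pose w := u ^ (- D P0).
have w0 : w != 0 by rewrite expfz_neq0.
have /finite_seqP[T eT] := finite_non_generating w0.
(* [T] holds the points where [w] fails to generate [L]. Inverting [h] leaves an open set around
   [P0] over which [w] is a generator. *)
have [|h [lh nh hT]] := separate_finite (T := T) lE hP0 klP0.
  move=> P PT; have [hP nP] : [set P | pt P /\ ord P w != - D P] P by rewrite eT.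
  by split=> // e; move: nP; rewrite e ou eqxx.
have [h0 P0h] : h != 0 /\ P0 h^-1.
  apply: not_nonunit; first exact: klP0.
  by move=> /(nonunitE dP0).
pose l' := h^-1 :: l.
have gP0 : good_for l' P0.
  split=> // x; rewrite inE => /orP[/eqP -> //|xl].
  by apply: klP0; apply: adjoin_mem.
have kP P : good_for l' P -> adjoin k0 l `<=` P.
  move=> [hP Pl]; apply: adjoin_min; first exact: (dv hP).1.
    by apply: (const_sub hS); case: hP.
  by move=> x xl; apply: Pl; rewrite inE xl orbT.
have ow P : good_for l' P -> ord P w = - D P.
  move=> gP; have [hP Pl] := gP; apply: contrapT => /eqP nP.
  have PT : P \in T by have : [set` T] P by rewrite -eT.
  have /(nonunitE (dv hP)) := hT P PT (kP P gP).
  by apply: unit_not_nonunit => //; apply: Pl; rewrite mem_head.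
pose s : seq K := mono 1 w :: [seq mono 0 x | x <- l'].
have sB := adjoin_subring A s; set B := adjoin A s in sB *.
have Bw : B (mono 1 w) by apply: adjoin_mem; rewrite mem_head.
have Bl x : x \in l' -> B (mono 0 x).
  by move=> xl; apply: adjoin_mem; rewrite inE map_f ?orbT.
have Bkl x : adjoin k0 l x -> B (mono 0 x).
  apply: (adjoin_min (constants_subring sB)) => [y ky|y yl].
    by apply: adjoin_sub; apply: (section_ring_const hE).
  by apply: Bl; rewrite inE yl orbT.
have SB P : good_for l' P -> B `<=` S P.
  move=> gP; have [hP Pl] := gP.
  apply: adjoin_min; [exact: (section_algebra_subring hE)|exact: section_ring_sub|].
  move=> z; rewrite inE => /orP[/eqP ->|/mapP[x /Pl Px ->]].
    by apply: section_algebra_mono; right; rewrite ow // /multiple mul1r.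
  apply: section_algebra_mono; rewrite /multiple mul0r oppr0.
  exact/(val_ge0 (dv hP)).
have genS P R : good_for l' P -> subring R -> B `<=` R -> P `<=` constants R ->
    S P `<=` R.
  move=> gP sR BR PR; have [hP _] := gP.
  by apply: (section_algebra_gen hE hP sR PR w0 (ow P gP)); apply: BR.
exists s, l'; split=> //.
- move=> z hz; have [lz Bz ez] := affE sB hz.
  have lzF := constants_local lz.
  have klz : adjoin k0 l `<=` constants z by move=> x /Bkl /Bz.
  have Ey := lE _ (aff_centre lzF sl klz).
  have [yz dy] := centre_dominated lzF sl klz.
  have [P [gP Pz]] : exists P, good_for l' P /\ P `<=` constants z.
    (* When [z] lies over the generic point of [E], every good point has its local ring in the trace
       of [z], so [P0] is chosen. *)
    have [e|ne] := pselect (centre (constants z) (adjoin k0 l) = setT).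
      by exists P0; split=> // x _; apply: yz; rewrite e.
    exists (centre (constants z) (adjoin k0 l)); split=> //; split=> // x.
    have cs := centre_sub lzF sl klz.
    rewrite inE => /orP[/eqP ->|xl]; last by apply: cs; apply: adjoin_mem.
    by apply: dy; [exact: cs|apply: Bz; apply: Bl; rewrite mem_head].
  have Sz := genS P z gP lz.1 Bz Pz; have [hP _] := gP.
  exists P => //.
  have -> : z = centre z (S P).
    rewrite [LHS]ez; apply: esym; apply: (centre_eq lz.1 sB) => //.
    - exact: (section_algebra_subring hE).
    - exact: SB.
    - by rewrite -ez.
  by apply: aff_centre => //; apply: (section_algebra_subring hE).
- move=> P gP y hy; have [hP Pl] := gP.
  have sS : subring (S P) by apply: (section_algebra_subring hE).
  have [ly Sy ey] := affE sS hy.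
  have By := subset_trans (SB P gP) Sy.
  rewrite ey (centre_eq ly.1 sB sS (SB P gP) Sy); first exact: aff_centre.
  have sc : subring (centre y B) by apply: localization_subring => //; apply: centre_prime.
  apply: (genS P _ gP sc); first exact: centre_sub.
  rewrite (pt_centre lE hP (kP P gP)) => x /centreP [//||a [c [ka kc c0 Pc ->]]].
    exact: kP.
  rewrite /constants /= -[0%N]/(0 + 0)%N -monoM; apply/centreP => //.
  exists (mono 0 a), (mono 0 c); split; [exact: Bkl|exact: Bkl|by rewrite mono_eq0| |].
    rewrite monoV; apply: Sy; apply: section_algebra_mono.
    by rewrite /multiple mul0r oppr0; apply/(val_ge0 (dv hP)).
  by rewrite monoV.
- have p0 : prime_ideal B [set 0].
    split=> //.
    - by split=> // _ ->; apply: subring0.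
    - by move=> /eqP; rewrite oner_eq0.
    - by move=> x y -> ->; rewrite /= addr0.
    - by move=> a x _ ->; rewrite /= mulr0.
    - move=> a b _ _ /eqP; rewrite mulf_eq0 => /orP[]/eqP; [by left|by right].
  have sL := localization_subring sB p0; have BL := sub_localization sB p0.
  have LV z : localization B [set 0] z -> localization B [set 0] z^-1.
    move=> [a Ba [c [Bc c0] <-]]; have [->|a0] := eqVneq a 0.
      by rewrite mul0r invr0; apply: subring0.
    exists c => //; exists a; first by split=> //; apply/eqP.
    by rewrite invfM invrK mulrC.
  have LF x : localization B [set 0] (mono 0 x).
    have : localization (adjoin k0 l) [set 0] x by rewrite lK.
    case=> a ka [c [kc _] <-]; rewrite -[0%N]/(0 + 0)%N -monoM -monoV.
    by apply: subringM => //; [apply: BL; apply: Bkl|apply: LV; apply: BL; apply: Bkl].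
  have Lp a : localization B [set 0] (tofrac a).
    rewrite tofrac_mono; apply: (subring_sum _ sL) => i _.
    have -> : mono i a`_i = mono 0 (a`_i / w ^+ i) * mono 1 w ^+ i.
      by rewrite monoX monoM add0n mul1n divfK ?expf_neq0.
    apply: (subringM sL); first exact: LF.
    by apply: (subringX _ sL); apply: BL.
  apply/seteqP; split=> // z _; have [a [b [_ ->]]] := fraction_split z.
  by apply: (subringM sL); [apply: Lp|apply: LV; apply: Lp].
Qed.

(** A single chart covers all but finitely many points of [E], and each exception receives a chart
    of its own. *)
Lemma relative_spec_model : complete_model A (relative_spec E D).
Proof.
split; last by move=> V; apply: (relative_spec_valuation hE).
have cover (T : seq (set F)) : exists ss : seq (seq K),
    (forall s, s \in ss -> aff (adjoin A s) `<=` relative_spec E D /\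
       localization (adjoin A s) [set 0] = setT) /\
    forall P, P \in T -> pt P -> exists2 s, s \in ss & aff (S P) `<=` aff (adjoin A s).
  elim: T => [|P T [ss [h1 h2]]]; first by exists [::].
  have [hP|nP] := pselect (pt P); last first.
    by exists ss; split=> // Q; rewrite inE => /orP[/eqP -> /nP|/h2].
  have [s [l [gP hs hl hf]]] := relative_spec_chart hP.
  exists (s :: ss); split.
    by move=> s'; rewrite inE => /orP[/eqP ->|/h1].
  move=> Q; rewrite inE => /orP[/eqP -> _|QT hQ].
    by exists s; [rewrite mem_head|apply: hl].
  by have [s' s's h] := h2 Q QT hQ; exists s' => //; rewrite inE s's orbT.
have [P0 hP0] := exists_pt hS.
have [s [l [gP hs hl hf]]] := relative_spec_chart hP0.
have /finite_seqP[T eT] := finite_bad l.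
have [ss [h1 h2]] := cover T.
exists (s :: ss); split; last by move=> s'; rewrite inE => /orP[/eqP ->|/h1 []].
apply/seteqP; split=> [y [P hP hy]|y [s' /=]]; last first.
  by rewrite inE => /orP[/eqP -> /hs|/h1[h _] /h].
have [gl|ngl] := pselect (good_for l P).
  by exists s; [rewrite /= mem_head|apply: hl hy].
have PT : P \in T by have : [set` T] P by rewrite -eT.
have [s' s's h] := h2 P PT hP.
by exists s'; [rewrite /= inE s's orbT|apply: h].
Qed.

End Charts.

(** * Normality *)

Section IntegralClosure.
Variable K : fieldType.
Implicit Types (A B R : set K) (x y s : K).

Lemma integral_closure_over A x : subring A -> integral_closure A x -> integral_over A x.
Proof.
move=> sA [q qm [Aq /rootP qx]].
exists (size q).-1, (fun i => - q`_i); split.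
- have [|//] := posnP (size q).-1 => q0.
  have q1 : size q = 1%N.
    by have := monic_neq0 qm; rewrite -size_poly_gt0; case: (size q) q0 => // -[].
  move/monicP: qm qx; rewrite lead_coefE q1 /= => q0'.
  have /size_poly1P[c _ ec] : size q == 1%N by rewrite q1.
  by move: q0'; rewrite ec coefC eqxx hornerC => -> /eqP; rewrite oner_eq0.
- by move=> i; apply: subringN.
apply/eqP; rewrite -subr_eq0 -sumrN; apply/eqP.
rewrite -[RHS]qx horner_coef.
have -> : size q = (size q).-1.+1 by rewrite prednK // size_poly_gt0 monic_neq0.
rewrite big_ord_recr /= (monicP qm : q`_(size q).-1 = 1) mul1r addrC; congr (_ + _).
by apply: eq_bigr => i _; rewrite mulNr opprK.
Qed.

Lemma sub_integral_closure A : subring A -> A `<=` integral_closure A.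
Proof.
move=> sA x Ax; exists ('X - x%:P); first exact: monicXsubC.
split=> [i|]; last by rewrite root_XsubC.
rewrite coefB coefX coefC; apply: subringB => //.
  by case: eqP => _; [apply: subring1|apply: subring0].
by case: eqP => // _; apply: subring0.
Qed.

Lemma centre_common_denominator R B (c : nat -> K) n : subring R -> subring B -> B `<=` R ->
  (forall i, centre R B (c i)) ->
  exists s, [/\ B s, s != 0, R s^-1 & forall i, (i < n)%N -> B (s * c i)].
Proof.
move=> sR sB BR hc; elim: n => [|n [s [Bs s0 Rs hs]]].
  by exists 1; rewrite oner_eq0 invr1; split=> //; apply: subring1.
have [//|//|a [t [Ba Bt t0 Rt ec]]] := (centreP _ _ _).1 (hc n).
exists (s * t); split; [exact: subringM|by rewrite mulf_neq0| |].
  by rewrite invfM; apply: subringM.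
move=> i; rewrite ltnS leq_eqVlt => /orP[/eqP ->|/hs h].
  rewrite ec; have -> : s * t * (a / t) = s * a by field.
  exact: subringM.
by rewrite mulrAC; apply: subringM.
Qed.

(** Multiplying [x] by a common denominator [s] of the coefficients makes it integral over [B], the
    coefficient of index [i] being scaled by [s ^ (n - i)]. *)
Lemma centre_integrally_closed R B : subring R -> subring B -> B `<=` R ->
  (forall x, integral_over B x -> B x) ->
  forall x, integral_over (centre R B) x -> centre R B x.
Proof.
move=> sR sB BR hB x [n [c [n0 hc ex]]].
have [s [Bs s0 Rs hs]] := centre_common_denominator n sR sB BR hc.
apply/centreP => //; exists (s * x), s; split=> //; last by field.
(* Indices past [n] are set to zero because [integral_over] constrains the whole sequence of
   coefficients. *)
apply: hB; exists n, (fun i => if (i < n)%N then s ^+ (n - i).-1 * (s * c i) else 0).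
split=> //.
  move=> i; case: ifP => [i_n|_]; last exact: subring0.
  by apply: subringM => //; [apply: subringX|apply: hs].
rewrite exprMn ex mulr_sumr; apply: eq_bigr => i _; rewrite ltn_ord.
have {1}-> : n = ((n - i).-1 + 1 + i)%N.
  by rewrite addn1 prednK ?subn_gt0 // subnK // ltnW.
by rewrite !exprD expr1 exprMn; ring.
Qed.

Lemma aff_refl R : is_local R -> aff R R.
Proof.
move=> lR; have sR := lR.1.
have {2}-> : R = centre R R by apply/seteqP; split=> x;
  [apply: (centre_sub lR sR)|move=> /centreP [//|//|a [s [Ra _ _ Rs ->]]]; apply: subringM].
exact: aff_centre.
Qed.

Lemma aff_trans B (y z : set K) : subring B -> aff B y -> aff y z -> aff B z.
Proof.
move=> sB By yz; have [ly By' ey] := affE sB By.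
have [lz yz' ez] := affE ly.1 yz; have Bz := subset_trans By' yz'.
rewrite ez (centre_eq lz.1 sB ly.1 By' yz'); first exact: aff_centre.
rewrite ey => x /centreP [//|//|a [s [Ba Bs s0 ys ->]]].
by apply/centreP => //; exists a, s; split=> //; apply: yz'.
Qed.

End IntegralClosure.

(** The rational root argument: in lowest terms the denominator divides a power of the numerator, so
    it is constant. *)
Lemma poly_integrally_closed (F : fieldType) (x : {fraction {poly F}})
    (c : nat -> {poly F}) (n : nat) : (0 < n)%N ->
  x ^+ n = \sum_(i < n) tofrac (c i) * x ^+ i -> exists a, x = tofrac a.
Proof.
move=> n0 ex; have [a [b [b0 eab]]] := fraction_split x.
pose g := gcdp a b.
have ea : a %/ g * g = a by rewrite divpK // dvdp_gcdl.
have eb : b %/ g * g = b by rewrite divpK // dvdp_gcdr.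
have g0 : g != 0 by rewrite gcdp_eq0 negb_and b0 orbT.
have cop : coprimep (a %/ g) (b %/ g) by rewrite coprimep_div_gcd // b0 orbT.
have exab : x = tofrac (a %/ g) / tofrac (b %/ g).
  rewrite eab -{1}ea -{1}eb !tofracM -mulf_div divff ?mulr1 //.
  by rewrite tofrac_eq0.
have b0' : b %/ g != 0 by apply: contraNneq b0 => b0'; rewrite -eb b0' mul0r.
move: (a %/ g) (b %/ g) cop exab b0' {ea eb eab g0} => a' b' cop exab b0'.
have tb : tofrac b' != 0 by rewrite tofrac_eq0.
have exb : x * tofrac b' = tofrac a' by rewrite exab divfK.
have eq : a' ^+ n = b' * \sum_(i < n) c i * a' ^+ i * b' ^+ (n - i).-1.
  apply/eqP; rewrite -tofrac_eq; apply/eqP.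
  rewrite tofracXn -exb exprMn ex mulr_suml tofracM rmorph_sum mulr_sumr.
  apply: eq_bigr => i _ /=.
  rewrite !tofracM !tofracXn -exb exprMn.
  have -> : tofrac b' ^+ n = tofrac b' ^+ i * (tofrac b' * tofrac b' ^+ (n - i).-1).
    by rewrite -exprS -exprD prednK ?subn_gt0 // subnKC // ltnW.
  rewrite -!mulrA [RHS]mulrCA; congr (_ * _).
  by rewrite [RHS]mulrCA; congr (_ * _); rewrite mulrCA.
have db : b' %| a' ^+ n by rewrite eq dvdp_mulIl.
have /size_poly1P[c' c0 ec] : size b' == 1%N.
  by rewrite -coprimepp; apply: coprimep_dvdr db _; rewrite coprimep_expl.
exists (c'^-1 *: a'); rewrite exab; apply: (canLR (mulfK tb)).
rewrite -tofracM; congr tofrac.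
by rewrite ec -mul_polyC mulrAC -polyCM mulVf // mul1r.
Qed.

Section Normality.
Variables (k : closedFieldType) (F : fieldType) (iota : {rmorphism k -> F}).
Variable E : set (set F).
Hypothesis hE : elliptic_curve iota E.
Variable D : set F -> int.
Local Notation K := {fraction {poly F}}.
Local Notation pt := (closed_points E).
Implicit Types (P : set F) (x : F) (a b : {poly F}).
Let hS : smooth_projective_curve iota E := hE.1.
Let dv P : pt P -> dvr P := @pt_dvr _ _ _ _ hS P.
Local Notation S := (section_algebra D).

(* the polynomials in m_P ^ j * S_P *)
Definition section_filtration P (j : int) : set {poly F} :=
  [set a | forall n : nat, val_ge P (j - multiple D n P) a`_n].

Section AtPoint.
Variable P : set F.
Hypothesis hP : pt P.
Let dP := dv hP.
Local Notation I := (section_filtration P).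

Lemma section_filtration_le i j a : i <= j -> I j a -> I i a.
Proof. by move=> ij h n; apply: val_ge_le (h n); rewrite lerD2r. Qed.

Lemma section_filtration_sum j (T : Type) (r : seq T) (Q : pred T) (f : T -> {poly F}) :
  (forall i, Q i -> I j (f i)) -> I j (\sum_(i <- r | Q i) f i).
Proof.
move=> h n; rewrite coef_sum; apply: (val_ge_sum dP) => i Qi; exact: h.
Qed.

Lemma section_filtrationM i j a b : I i a -> I j b -> I (i + j) (a * b).
Proof.
move=> ha hb n; rewrite coefM; apply: (val_ge_sum dP) => l _.
have -> : i + j - multiple D n P = (i - multiple D l P) + (j - multiple D (n - l) P).
  by rewrite /multiple -subzn ?leq_ord //; ring.
exact: (val_geM dP).
Qed.

Lemma section_filtration1 : I 0 1.
Proof.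
move=> n; rewrite coef1; case: eqP => [->|_]; last by left.
by right; rewrite (ord_one dP) /multiple mul0r subrr.
Qed.

Lemma section_filtrationX j n a : (0 < n)%N -> I j a -> I (n%:Z * j) (a ^+ n).
Proof.
move=> n0 ha; elim: n n0 => // -[_ _|n IH _]; first by rewrite mul1r expr1.
rewrite exprS; have -> : n.+2%:Z * j = j + n.+1%:Z * j by lia.
by apply: section_filtrationM => //; apply: IH.
Qed.

Lemma section_filtrationC (c : F) : I (ord P c) c%:P.
Proof.
move=> n; rewrite coefC; case: eqP => [->|_]; last by left.
by right; rewrite /multiple mul0r subr0.
Qed.

(* Gauss's lemma *)
Lemma section_filtration_prime a b : I 0 a -> I 0 b -> I 1 (a * b) -> I 1 a \/ I 1 b.
Proof.
move=> ha hb hab; apply: contrapT => /not_orP[na nb].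
pose bad (c : {poly F}) n := `[< ~ val_ge P (1 - multiple D n P) c`_n >].
have exbad c : ~ I 1 c -> exists n, bad c n.
  by move=> /existsNP[n hn]; exists n; apply/asboolP.
(* With [i] and [j] the first degrees where the coefficients have exact order, every other product
   contributing to degree [i + j] has a factor of degree below [i] or [j], hence strictly larger
   order. *)
have [i /asboolP bi mi] := ex_minnP (exbad a na).
have [j /asboolP bj mj] := ex_minnP (exbad b nb).
have low c n m : (forall l, bad c l -> (m <= l)%N) -> (n < m)%N ->
    val_ge P (1 - multiple D n P) c`_n.
  move=> hm nm; apply: contrapT => h; have /hm : bad c n by apply/asboolP.
  by rewrite leqNgt nm.
have exact_ord c n : I 0 c -> ~ val_ge P (1 - multiple D n P) c`_n ->
    c`_n != 0 /\ ord P c`_n = - multiple D n P.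
  move=> hc nc; have c0 : c`_n != 0 by apply/eqP => c0; apply: nc; rewrite c0; left.
  split=> //; have := val_ge_ord c0 (hc n); rewrite sub0r => h1.
  have h2 : ~ (1 - multiple D n P <= ord P c`_n) by move=> h; apply: nc; right.
  lia.
have [a0 oa] := exact_ord _ _ ha bi; have [b0 ob] := exact_ord _ _ hb bj.
have : val_ge P (1 - multiple D (i + j) P) (a`_i * b`_j).
  have iij : (i < (i + j).+1)%N by rewrite ltnS leq_addr.
  have -> : a`_i * b`_j = (a * b)`_(i + j) -
      \sum_(l < (i + j).+1 | l != Ordinal iij) a`_l * b`_(i + j - l).
    by rewrite coefM (bigD1 (Ordinal iij)) //= addKn addrK.
  apply: (val_geB dP); first exact: hab.
  apply: (val_ge_sum dP) => l nl.
  have split_m : 1 - multiple D (i + j) P =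
      (1 - multiple D l P) + (0 - multiple D (i + j - l) P).
    by rewrite /multiple -subzn ?leq_ord // ; ring.
  have split_m' : 1 - multiple D (i + j) P =
      (0 - multiple D l P) + (1 - multiple D (i + j - l) P).
    by rewrite /multiple -subzn ?leq_ord // ; ring.
  have [li|il] := ltnP l i.
    by rewrite split_m; apply: (val_geM dP); [apply: low li|apply: hb].
  rewrite split_m'; apply: (val_geM dP); [apply: ha|apply: low mj _].
  have : l != i :> nat by apply: contraNneq nl => li; apply/eqP/val_inj.
  by move: il (leq_ord l) => /=; lia.
move=> /(val_ge_ord (mulf_neq0 a0 b0)); rewrite (ordM dP) // oa ob /multiple PoszD.
by rewrite mulrDl; lia.
Qed.

Lemma section_filtration_exp a n : I 0 a -> I 1 (a ^+ n) -> I 1 a.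
Proof.
move=> ha; elim: n => [|n IH].
  rewrite expr0 => h; have := h 0%N; rewrite coef1 eqxx /multiple mul0r subr0.
  by move=> /(val_ge_ord (oner_neq0 _)); rewrite (ord_one dP).
rewrite exprS => h; have hn : I 0 (a ^+ n).
  case: n {IH h} => [|n]; first exact: section_filtration1.
  by rewrite -(mulr0 n.+1%:Z); apply: section_filtrationX.
by have [] := section_filtration_prime ha hn h.
Qed.

(** An integral element is a polynomial [a]. Take the least [m] with [u ^ m a] in the stalk. If
    [m > 0], the integral equation puts a power of [u ^ m a] into [m_P S_P], which is prime by
    Gauss's lemma, so one factor [u] can be removed. *)
Lemma section_algebra_integrally_closed (z : K) : integral_over (S P) z -> S P z.
Proof.
move=> [n [c [n0 hc ez]]].
have {}hc i : {a | c i = tofrac a & I 0 a}.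
  apply: cid2; have /section_algebraP[a -> ha] := hc i.
  by exists a => // m; rewrite sub0r; apply: ha.
pose c' i := s2val (hc i).
have {}ez : z ^+ n = \sum_(i < n) tofrac (c' i) * z ^+ i.
  by rewrite ez; apply: eq_bigr => i _; rewrite /c' -(s2valP (hc i)).
have Ic' i : I 0 (c' i) := s2valP' (hc i).
have [a ea] := poly_integrally_closed n0 ez; rewrite {}ea in ez *.
have {}ez : a ^+ n = \sum_(i < n) c' i * a ^+ i.
  apply/eqP; rewrite -tofrac_eq tofracXn ez rmorph_sum; apply/eqP.
  by apply: eq_bigr => i _ /=; rewrite tofracM tofracXn.
suff Ia : I 0 a.
  by apply/section_algebraP; exists a => // m; have := Ia m; rewrite sub0r.
have [u u0 ou] := ord_uniformizer dP.
have ou' m : ord P (u ^+ m) = m%:Z by rewrite exprnP ou.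
have exm : exists m : nat, `[< I 0 ((u ^+ m)%:P * a) >].
  have [N hN] := section_algebra_scale hE D a hP; exists N; apply/asboolP.
  have := hN (u ^+ N); rewrite ou' lexx => /(_ isT).
  rewrite /mono expr0 alg_polyC -tofracM => /section_algebraP[b].
  by move=> /eqP; rewrite tofrac_eq => /eqP -> hb l; rewrite sub0r; apply: hb.
have [m /asboolP hm minm] := ex_minnP exm.
case: m hm minm => [|m] hm minm; first by rewrite expr0 mul1r in hm.
set x0 := (u ^+ m.+1)%:P * a in hm *.
have I1 : I 1 x0.
  apply: (@section_filtration_exp _ n hm).
  have -> : x0 ^+ n = \sum_(i < n) c' i * (((u ^+ m.+1) ^+ (n - i))%:P * x0 ^+ i).
    rewrite /x0 exprMn ez mulr_sumr; apply: eq_bigr => i _.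
    have -> : ((u ^+ m.+1)%:P : {poly F}) ^+ n =
        ((u ^+ m.+1) ^+ (n - i))%:P * (u ^+ m.+1)%:P ^+ i.
      by rewrite -!polyC_exp -polyCM -exprD subnK // ltnW.
    by rewrite exprMn; ring.
  apply: section_filtration_sum => i _; rewrite -[1 : int]add0r.
  apply: section_filtrationM => //; rewrite -[1 : int]addr0.
  apply: section_filtrationM; last first.
    case: (val i) => [|j]; first by rewrite expr0; apply: section_filtration1.
    by rewrite -(mulr0 j.+1%:Z); apply: section_filtrationX.
  apply: section_filtration_le (section_filtrationC _).
  by rewrite -exprM ou'; have := ltn_ord i; nia.
have : (m.+1 <= m)%N.
  apply: minm; apply/asboolP => l.
  have := I1 l; rewrite /x0 exprS polyCM -mulrA coefCM => h.
  have -> : ((u ^+ m)%:P * a)`_l = u^-1 * (u * ((u ^+ m)%:P * a)`_l) by rewrite mulKf.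
  have -> : 0 - multiple D l P = -1 + (1 - multiple D l P) by lia.
  apply: (val_geM dP) h; right.
  by rewrite (ordV dP) // -[u]expr1 ou'.
by rewrite ltnn.
Qed.

End AtPoint.

Lemma relative_spec_normal : normalization (relative_spec E D) = relative_spec E D.
Proof.
have sS P : pt P -> subring (S P) by apply: (section_algebra_subring hE).
have yE y : relative_spec E D y -> integral_closure y = y.
  move=> [P hP hy]; have [ly Sy ey] := affE (sS P hP) hy.
  apply/seteqP; split; last exact/sub_integral_closure/ly.1.
  move=> x /(integral_closure_over ly.1); rewrite ey.
  apply: (centre_integrally_closed ly.1 (sS P hP) Sy).
  exact: section_algebra_integrally_closed.
apply/seteqP; split=> y.
  move=> [z rz]; rewrite (yE z rz) => zy; have [P hP hz] := rz.
  by exists P => //; apply: (aff_trans (sS P hP) hz).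
move=> ry; exists y => //; rewrite (yE y ry); have [P hP hy] := ry.
by apply: aff_refl; have [] := affE (sS P hP) hy.
Qed.

End Normality.

(** * Frobenius push-forwards and blowups *)

Section FrobeniusModules.
Variables (K : fieldType) (p : nat) (hp : p \in [pchar K]) (e : nat).
Local Notation q := (p ^ e)%N.
Implicit Types (A O R V z : set K).

Lemma frob_pullbackP O A (v : K) :
  tf_pullback O (A : set (frob_push hp e)) v <->
  exists (n : nat) (a m : 'I_n -> K),
    (forall i, O (a i) /\ A (m i)) /\ v = \sum_i a i ^+ q * m i.
Proof. by []. Qed.

Definition frob_comb n (c b : 'I_n -> K) : K := \sum_i c i ^+ q * b i.

Lemma frob_combD n (c d b : 'I_n -> K) :
  frob_comb (fun i => c i + d i) b = frob_comb c b + frob_comb d b.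
Proof.
by rewrite -big_split; apply: eq_bigr => i _; rewrite frobD // mulrDl.
Qed.

Lemma frob_combB n (c d b : 'I_n -> K) :
  frob_comb (fun i => c i - d i) b = frob_comb c b - frob_comb d b.
Proof.
by rewrite -sumrB; apply: eq_bigr => i _; rewrite frobD // frobN // mulrBl.
Qed.

Lemma frob_combM n (c b : 'I_n -> K) a :
  frob_comb (fun i => a * c i) b = a ^+ q * frob_comb c b.
Proof.
by rewrite mulr_sumr; apply: eq_bigr => i _; rewrite exprMn mulrA.
Qed.

Lemma frob_expn_gt0 : (0 < q)%N.
Proof. by rewrite expn_gt0 prime_gt0 ?(pcharf_prime hp). Qed.

Lemma frob_comb0 n (b : 'I_n -> K) : frob_comb (fun=> 0) b = 0.
Proof.
apply: big1 => i _; have := frob_expn_gt0; case: (q) => // m _.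
by rewrite expr0n mul0r.
Qed.

Lemma frob_comb_comp n m (c : 'I_n -> K) (g : 'I_m -> K) (H : 'I_n -> 'I_m -> K) :
  frob_comb c (fun i => frob_comb (H i) g) = frob_comb (fun j => \sum_i c i * H i j) g.
Proof.
rewrite /frob_comb; under eq_bigr do rewrite mulr_sumr.
rewrite exchange_big; apply: eq_bigr => j _.
by rewrite frob_sum // mulr_suml; apply: eq_bigr => i _; rewrite exprMn mulrA.
Qed.

Definition frob_free n (b : 'I_n -> K) : Prop :=
  forall c : 'I_n -> K, frob_comb c b = 0 -> forall i, c i = 0.

Lemma frob_free_inj n (b c d : 'I_n -> K) : frob_free b ->
  frob_comb c b = frob_comb d b -> forall i, c i = d i.
Proof.
move=> fb h i; apply/eqP; rewrite -subr_eq0; apply/eqP.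
by apply: (fb (fun i => c i - d i)); rewrite frob_combB h subrr.
Qed.

Definition frob_span O n (b : 'I_n -> K) : set K :=
  [set v | exists2 c : 'I_n -> K, (forall i, O (c i)) & v = frob_comb c b].

Lemma frob_spanD O n (b : 'I_n -> K) v w : subring O ->
  frob_span O b v -> frob_span O b w -> frob_span O b (v + w).
Proof.
move=> sO [c hc ->] [d hd' ->]; exists (fun i => c i + d i).
  by move=> i; apply: subringD.
by rewrite frob_combD.
Qed.

Lemma frob_span0 O n (b : 'I_n -> K) : subring O -> frob_span O b 0.
Proof.
by move=> sO; exists (fun=> 0); rewrite ?frob_comb0 // => i; apply: subring0.
Qed.

Lemma frob_spanM O n (b : 'I_n -> K) a v : subring O -> O a ->
  frob_span O b v -> frob_span O b (a ^+ q * v).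
Proof.
move=> sO Oa [c hc ->]; exists (fun i => a * c i); last by rewrite frob_combM.
by move=> i; apply: subringM.
Qed.

Lemma frob_span_sum O n (b : 'I_n -> K) (I : Type) (r : seq I) (S : pred I) (f : I -> K) :
  subring O -> (forall i, S i -> frob_span O b (f i)) ->
  frob_span O b (\sum_(i <- r | S i) f i).
Proof.
by move=> sO h; apply: big_ind => //; [apply: frob_span0|move=> v w; apply: frob_spanD].
Qed.

Lemma frob_span_sub O O' n (b : 'I_n -> K) : O `<=` O' -> frob_span O b `<=` frob_span O' b.
Proof. by move=> h v [c hc ->]; exists c => // i; apply: h. Qed.

Section Basis.
Variables (A : set K) (n : nat) (b : 'I_n -> K).
Hypotheses (Ab : forall i, A (b i)) (fb : frob_free b).

Lemma frob_pullback_span O : subring O -> A `<=` frob_span O b ->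
  forall v, tf_pullback O (A : set (frob_push hp e)) v <-> frob_span O b v.
Proof.
move=> sO AO v; rewrite frob_pullbackP; split=> [[m [a [x [h ->]]]]|[c hc ->]].
  apply: frob_span_sum => // i _; have [Oa Ax] := h i.
  by apply: frob_spanM => //; apply: AO.
by exists n, c, b; split=> // i; split.
Qed.

Lemma frob_free_module O : subring O -> A `<=` frob_span O b ->
  free_module O (tf_pullback O (A : set (frob_push hp e))).
Proof.
move=> sO AO; exists n, b; split=> [i|v].
  apply/(frob_pullback_span sO AO); exists (fun j => (j == i)%:R).
    by move=> j; case: eqP => _; [apply: subring1|apply: subring0].
  rewrite /frob_comb (bigD1 i) //= eqxx expr1n mul1r big1 ?addr0 // => j /negPf ->.
  by have := frob_expn_gt0; case: (q) => // m _; rewrite expr0n mul0r.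
move=> /(frob_pullback_span sO AO)[c hc ->]; exists [ffun i => c i]; split.
  split=> [i|]; first by rewrite ffunE.
  by apply: eq_bigr => i _; rewrite ffunE.
move=> d [hd' ed]; apply/ffunP => i; rewrite ffunE.
exact: (frob_free_inj fb (d := d)).
Qed.

(** The determinant of [G] lies in [R] and its inverse, the determinant of [H], in [V]; domination
    makes it a unit of [R], and the adjugate gives the inverse matrix. *)
Lemma inverse_matrix_in R V m l (G : 'M[K]_(m, l)) (H : 'M[K]_(l, m)) : subring R ->
  subring V -> dominates V R -> (forall i j, R (G i j)) -> (forall i j, V (H i j)) ->
  G *m H = 1%:M -> H *m G = 1%:M -> forall i j, R (H i j).
Proof.
move=> sR sV [RV dom] hG hH GH HG.
have eml : m = l by apply/eqP; rewrite eqn_leq (mulmx1_min GH) (mulmx1_min HG).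
case: l / eml in G H hG hH GH {HG} *.
have det_in T l (M : 'M[K]_l) : subring T -> (forall i j, T (M i j)) -> T (\det M).
  move=> sT hM; apply: subring_sum => // s _; apply: subringM => //.
    by apply: subringX => //; apply: subringN => //; apply: subring1.
  by apply: subring_prod.
have dGH : \det G * \det H = 1 by rewrite -det_mulmx GH det1.
have dG0 : \det G != 0 by apply: contra_eq_neq dGH => ->; rewrite mul0r eq_sym oner_neq0.
have Rd : R (\det G)^-1.
  apply: dom; first exact: det_in.
  have -> : (\det G)^-1 = \det H by rewrite -[RHS](mulKf dG0) dGH mulr1.
  exact: det_in.
have -> : H = (\det G)^-1 *: \adj G.
  have GadjG : \adj G *m G = (\det G)%:M by rewrite mul_adj_mx.
  rewrite -[RHS]mulmx1 -GH mulmxA -scalemxAl GadjG scale_scalar_mx.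
  by rewrite mulVf // mul1mx.
move=> i j; rewrite mxE mxE /cofactor; apply: subringM => //; apply: subringM => //.
  by apply: subringX => //; apply: subringN => //; apply: subring1.
by apply: det_in => // i' j'; rewrite !mxE.
Qed.

(* If [V] dominates [z], a basis over [V] taken from [A] is already a basis over
   [z]: the change of basis matrix has entries in [z] and a determinant which
   is a unit in [V]. *)
Lemma frob_basis_descent z V : subring z -> subring V -> dominates V z -> A `<=` z ->
  (forall x, centre setT z x) ->
  free_module z (tf_pullback z (A : set (frob_push hp e))) ->
  A `<=` frob_span V b -> A `<=` frob_span z b.
Proof.
move=> sz sV Vz Az fracz [r [g [gz hg]]] AV; have [zV _] := Vz.
have unit_in x : A x -> tf_pullback z (A : set (frob_push hp e)) x.
  move=> Ax; apply/frob_pullbackP; exists 1%N, (fun=> 1), (fun=> x); split=> [_|].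
    by split=> //; apply: subring1.
  by rewrite big_ord1 expr1n mul1r.
(* [free_module] gives uniqueness only for coefficients in [z]. Since [K] is the fraction field of
   [z], clearing denominators extends it to coefficients in [K]. *)
have fg : frob_free (g : 'I_r -> K).
  move=> c hc.
  pose c' i := if insub i is Some i' then c i' else 0.
  have [s [zs s0 _ hs]] := centre_common_denominator r (@subring_setT K) sz
    (@subsetT _ z) (fun i => fracz (c' i)).
  have hsc i : z (s * c i).
    have := hs i (ltn_ord i); rewrite /c'; case: insubP => [j _ ej|]; last by rewrite ltn_ord.
    by have -> : j = i by apply: val_inj.
  have z0 : tf_pullback z (A : set (frob_push hp e)) (0 : K).
    by apply/frob_pullbackP; exists 0%N, (fun=> 0), (fun=> 0); split=> [[]//|]; rewrite big_ord0.
  have [d [_ ud]] := hg _ z0.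
  have conv (f : {ffun 'I_r -> K}) (f' : 'I_r -> K) : f =1 f' ->
      \sum_i f i *: g i = frob_comb f' g.
    by move=> ff'; apply: eq_bigr => i _; rewrite ff'.
  have e1 : d = [ffun=> 0].
    apply: ud; split=> [i|]; first by rewrite ffunE; apply: subring0.
    by rewrite (conv _ (fun=> 0)) ?frob_comb0 // => i; rewrite ffunE.
  have e2 : d = [ffun i => s * c i].
    apply: ud; split=> [i|]; first by rewrite ffunE.
    rewrite (conv _ (fun i => s * c i)) => [|i]; last by rewrite ffunE.
    by rewrite frob_combM hc mulr0.
  move=> i; have /ffunP/(_ i) : [ffun=> 0] = [ffun i => s * c i] by rewrite -e1.
  by rewrite !ffunE => /esym/eqP; rewrite mulf_eq0 (negPf s0) => /eqP.
have z_coord v : tf_pullback z (A : set (frob_push hp e)) v -> frob_span z (g : 'I_r -> K) v.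
  by move=> /hg[c [[hc ->] _]]; exists c.
have bG i : {c : 'I_r -> K | (forall j, z (c j)) & b i = frob_comb c g}.
  by apply: cid2; apply: z_coord; apply: unit_in.
have gH j : {c : 'I_n -> K | (forall i, V (c i)) & (g j : K) = frob_comb c b}.
  apply: cid2; have /frob_pullbackP[m [a [x [h ->]]]] := gz j.
  apply: frob_span_sum => // i _; have [za Ax] := h i.
  by apply: frob_spanM => //; [apply: zV|apply: AV].
pose G i := s2val (bG i); pose H j := s2val (gH j).
have zG i j : z (G i j) := s2valP (bG i) j.
have VH j i : V (H j i) := s2valP (gH j) i.
have eG i : b i = frob_comb (G i) g := s2valP' (bG i).
have eH j : (g j : K) = frob_comb (H j) b := s2valP' (gH j).
have delta m (c : 'I_m -> K) i : frob_comb (fun j => (j == i)%:R) c = c i.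
  rewrite /frob_comb (bigD1 i) //= eqxx expr1n mul1r big1 ?addr0 // => j /negPf ->.
  by have := frob_expn_gt0; case: (q) => // m' _; rewrite expr0n mul0r.
have comb_ext m (c d d' : 'I_m -> K) : d =1 d' -> frob_comb c d = frob_comb c d'.
  by move=> h; apply: eq_bigr => i _; rewrite h.
pose MG := \matrix_(i < n, j < r) G i j; pose MH := \matrix_(j < r, i < n) H j i.
have GH : MG *m MH = 1%:M.
  apply/matrixP => i i'; rewrite !mxE; under eq_bigr do rewrite !mxE.
  rewrite eq_sym.
  apply: (frob_free_inj fb (c := fun i' => \sum_j G i j * H j i')
    (d := fun i' => (i' == i)%:R)).
  by rewrite delta -frob_comb_comp -(comb_ext _ _ _ _ eH) -eG.
have HG : MH *m MG = 1%:M.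
  apply/matrixP => i i'; rewrite !mxE; under eq_bigr do rewrite !mxE.
  rewrite eq_sym.
  apply: (frob_free_inj fg (c := fun i' => \sum_j H i j * G j i')
    (d := fun i' => (i' == i)%:R)).
  by rewrite delta -frob_comb_comp -(comb_ext _ _ _ _ eG) -eH.
move=> x /unit_in/z_coord[c zc ->].
rewrite (comb_ext _ c _ _ eH) frob_comb_comp.
have zH j i : z (H j i).
  have -> : H j i = MH j i by rewrite mxE.
  by apply: (inverse_matrix_in sz sV Vz _ _ GH HG) => i' j'; rewrite mxE.
exists (fun i => \sum_j c j * H j i) => // i.
by apply: subring_sum => // j _; apply: subringM.
Qed.

End Basis.
End FrobeniusModules.

(** * Uniqueness of models and of the universal flattening *)

Section Blowups.
Variables (K : fieldType) (W : lmodType K).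
Implicit Types (A : set K) (M : set W) (Y Z : set (set K)).

(** [centre setT y] is the fraction field of [y], because every nonzero element is invertible in
    [setT]. *)
Lemma model_local A Y (y : set K) : complete_model A Y -> Y y ->
  [/\ is_local y, A `<=` y & forall x, centre setT y x].
Proof.
move=> [[l [-> hl]] _] [s /= sl hy].
have [ly By ey] := affE (adjoin_subring A s) hy; split=> //.
  exact: subset_trans (@adjoin_sub _ _ _) By.
move=> x; have : localization (adjoin A s) [set 0] x by rewrite hl.
case=> a Ba [t [Bt t0] <-]; apply/centreP; [exact: ly.1|by []|].
by exists a, t; split=> //; [apply: By|apply: By|apply/eqP].
Qed.

Lemma exists_dominating (z : set K) : is_local z ->
  exists2 V, valuation_ring V & dominates V z.
Proof.
move=> lz; have sz := lz.1.
have iz : is_ideal z (nonunit z).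
  split; [by move=> x []|exact: nonunit0|by move=> x y; apply: localD|].
  by move=> a x za; apply: nonunitM.
have [|V [vV zV IV]] := chevalley sz iz; first exact: nonunit1.
exists V => //; split=> // x zx Vx; have [->|x0] := eqVneq x 0.
  by rewrite invr0; apply: subring0.
apply: contrapT => nx; have : nonunit z x by split=> //; right.
by move=> /IV; apply: unit_not_nonunit.
Qed.

(** From [y] one passes to a dominated [z] in [Z] and then to [y'] in [Y]. A valuation ring
    dominating [y] also dominates [y']; uniqueness of its centre gives [y = y'], and [z] is caught
    in between. *)
Lemma model_dominates_antisym A Y Z : complete_model A Y ->
  model_dominates Y Z -> model_dominates Z Y -> Y `<=` Z.
Proof.
move=> mY YZ ZY y Yy; have [ly Ay _] := model_local mY Yy.
have [z Zz yz] := YZ y Yy; have [y' Yy' zy'] := ZY z Zz.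
have [V vV Vy] := exists_dominating ly.
have [y0 [_ uy]] := mY.2 V vV (subset_trans Ay Vy.1).
have e1 : y0 = y by apply: uy.
have e2 : y0 = y' by apply: uy; split=> //; apply: dominates_trans Vy (dominates_trans yz zy').
suff -> : y = z by [].
by apply/seteqP; split; [rewrite -e1 e2; apply: zy'.1|apply: yz.1].
Qed.

Lemma blowup_at_eq A M Y : universal_flattening A M Y -> blowup_at A M = Y.
Proof.
move=> uY; rewrite /blowup_at; case: xgetP => [Z _ uZ|/(_ Y)//].
have [[fY hY] [fZ hZ]] := (uY, uZ).
apply/seteqP; split; apply: model_dominates_antisym; eauto.
- exact: fZ.1.
- exact: fY.1.
Qed.

End Blowups.

(** * Local bases of the Frobenius push-forward *)

Lemma coef_frob (F : fieldType) (p e : nat) (a : {poly F}) (n : nat) : p \in [pchar F] ->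
  (a ^+ (p ^ e))`_n = if (p ^ e %| n)%N then a`_(n %/ p ^ e) ^+ (p ^ e) else 0.
Proof.
move=> hp; set q := (p ^ e)%N.
have q0 : (0 < q)%N by rewrite expn_gt0 prime_gt0 ?(pcharf_prime hp).
have hpP : p \in [pchar {poly F}] := rmorph_pchar (@polyC F) hp.
have -> : a ^+ q = \sum_(i < size a) (a`_i ^+ q) *: 'X^(i * q).
  rewrite -{1}[a]coefK poly_def frob_sum //; apply: eq_bigr => i _.
  by rewrite exprZn -exprM.
rewrite coef_sum; case: ifPn => [/dvdnP[m ->]|nd]; last first.
  apply: big1 => i _; rewrite coefZ coefXn; case: eqP => [en|_]; last by rewrite mulr0.
  by rewrite en dvdn_mull in nd.
rewrite mulnK //; have [lt_m|le_m] := ltnP m (size a); last first.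
  rewrite nth_default // expr0n gtn_eqF //; apply: big1 => i _.
  rewrite coefZ coefXn eqn_pmul2r //; case: eqP => [em|_]; last by rewrite mulr0.
  by have := ltn_ord i; rewrite -em ltnNge le_m.
rewrite (bigD1 (Ordinal lt_m)) //= coefZ coefXn eqxx mulr1 big1 ?addr0 // => i ni.
rewrite coefZ coefXn eqn_pmul2r //; case: eqP => [em|_]; last by rewrite mulr0.
by case/eqP: ni; apply: val_inj.
Qed.

Lemma divr_scale (K : fieldType) (a h b : K) : b != 0 -> a / h = (a * b) / (h * b).
Proof. by move=> b0; rewrite -mulf_div divff // mulr1. Qed.

Lemma divr_scaler (K : fieldType) (a h b : K) : b != 0 -> a / h = (a * b) / (b * h).
Proof. by move=> b0; rewrite [b * h]mulrC -mulf_div divff // mulr1. Qed.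

Section LocalBasis.
Variables (k : closedFieldType) (F : fieldType) (iota : {rmorphism k -> F}).
Variable E : set (set F).
Hypothesis hE : elliptic_curve iota E.
Variable D : set F -> int.
Hypotheses (hD : divisor E D) (hd : 2%:Z <= deg E D).
Variables (p e : nat).
Hypotheses (hp : p \in [pchar k]) (e0 : (0 < e)%N).
Local Notation q := (p ^ e)%N.
Local Notation K := {fraction {poly F}}.
Local Notation pt := (closed_points E).
Local Notation A := (section_ring E D).
Local Notation S := (section_algebra D).
Local Notation mD := (multiple D).
Implicit Types (P : set F) (x : F).
Let hS : smooth_projective_curve iota E := hE.1.
Let dv P : pt P -> dvr P := @pt_dvr _ _ _ _ hS P.
Let hpF : p \in [pchar F] := rmorph_pchar iota hp.
Let hpK : p \in [pchar K] := pchar_ratfun iota hp.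
Let q1 : (1 < q)%N := frob_gt1 hp e0.

(** The bound says that [L ^ n (- (j + 1) P)] has positive degree, so the next order at [P] can be
    prescribed. *)
Lemma section_of_order P n j : pt P -> j%:Z < n%:Z * deg E D - 1 -> exists s,
  [/\ sec E (mD n) s, s != 0 & ord P s = - mD n P + j%:Z].
Proof.
move=> hP jn.
have hG := has_degreeD (multiple_degree hD n)
  (has_degreeN (has_degreeZ (j%:Z + 1) (has_degree_point hP))).
have n0 : 0 < n%:Z * deg E D + - ((j%:Z + 1) * 1) by lia.
have [s [ss s0 os]] := h1_zero_pole hE (h1_zero_deg hE hG n0) hP.
exists s; split=> //.
  by apply: sec_le ss => Q _; rewrite /point_div; case: eqP => _ /=; lia.
by rewrite os /point_div eqxx /=; lia.
Qed.

Section AtPoint.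
Variable P : set F.
Hypothesis hP : pt P.
Let dP := dv hP.

(* the shift is 0 when L ^ i has a section of order j at P, and q times 1
   otherwise: then L ^ (i + q) has one *)
Definition shift (i j : 'I_q) : nat :=
  if `[< exists s, [/\ sec E (mD i) s, s != 0 & ord P s = - mD i P + j%:Z] >] then 0 else 1.

Lemma shift_le1 i j : (shift i j <= 1)%N.
Proof. by rewrite /shift; case: asboolP. Qed.

Lemma basis_section_exists (i j : 'I_q) : exists s,
  [/\ sec E (mD (i + shift i j * q)) s, s != 0 &
      ord P s = - mD (i + shift i j * q) P + j%:Z].
Proof.
rewrite /shift; case: asboolP => [h|_]; first by rewrite mul0n addn0.
rewrite mul1n; apply: section_of_order => //.
(* After the shift the degree is [(i + q) d], at least [2 q] because [d >= 2], and [j < q]. *)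
by have := ltn_ord j; move: q1 hd; rewrite PoszD; nia.
Qed.

Definition basis_section (i j : 'I_q) : F := sval (cid (basis_section_exists i j)).

Lemma basis_section_sec (i j : 'I_q) : sec E (mD (i + shift i j * q)) (basis_section i j).
Proof. by rewrite /basis_section; case: cid => s []. Qed.

Lemma basis_section_neq0 (i j : 'I_q) : basis_section i j != 0.
Proof. by rewrite /basis_section; case: cid => s []. Qed.

Lemma basis_section_ord (i j : 'I_q) :
  ord P (basis_section i j) = - mD (i + shift i j * q) P + j%:Z.
Proof. by rewrite /basis_section; case: cid => s []. Qed.

Lemma basis_section_adapted (i : 'I_q) : adapted P (- mD i P) (basis_section i).
Proof.
move=> j; split; first exact: basis_section_neq0.
exists (- (shift i j)%:Z * D P); rewrite basis_section_ord /multiple PoszD PoszM; ring.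
Qed.

Lemma shift_high (i j : 'I_q) : q%:Z < i%:Z * deg E D -> shift i j = 0%N.
Proof.
move=> qi; rewrite /shift; case: asboolP => // -[].
apply: section_of_order => //; have := ltn_ord j; lia.
Qed.

(** Leading terms at [P] are removed one order at a time. A section of order [j] is itself the
    witness that [shift i j] is 0, and the ratio of leading coefficients, lying in [k], is a [q]-th
    power. The process ends at order [q], where negative degree leaves only zero. *)
Lemma low_expansion (i : 'I_q) x : i%:Z * deg E D < q%:Z -> sec E (mD i) x ->
  exists c : 'I_q -> F, (forall j, shift i j != 0%N -> c j = 0) /\
    x = \sum_j c j ^+ q * basis_section i j.
Proof.
move=> iq; have q0F (y : F) : (0 : F) ^+ q * y = 0 by rewrite expr0n gtn_eqF ?mul0r // ltnW.
suff main m : (m <= q)%N -> forall x, sec E (mD i) x ->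
    val_ge P (- mD i P + (q - m)%N%:Z) x ->
    exists c : 'I_q -> F, (forall j, shift i j != 0%N -> c j = 0) /\
      x = \sum_j c j ^+ q * basis_section i j.
  by move=> sx; apply: (main q) => //; rewrite subnn addr0; apply: sx.
elim: m => [_|m IH mq] {}x sx vx.
  exists (fun=> 0); split=> //; rewrite big1 => [|j _]; last exact: q0F.
  have hG := has_degreeD (multiple_degree hD i)
    (has_degreeN (has_degreeZ q%:Z (has_degree_point hP))).
  apply: (sec_deg_lt0 hE hG); first by rewrite mulr1; lia.
  move=> Q hQ; rewrite /point_div; have [->|_] := eqVneq Q P.
    by move: vx; rewrite subn0; congr (val_ge _ _ _); lia.
  by rewrite mulr0 subr0; apply: sx.
have mq' : (m <= q)%N by apply: ltnW.
have [v1|nv] := pselect (val_ge P (- mD i P + (q - m)%N%:Z) x); first exact: IH.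
have jq : (q - m.+1 < q)%N by lia.
pose j := Ordinal jq.
have x0 : x != 0 by apply/eqP => x0; apply: nv; left.
have ox : ord P x = - mD i P + j%:Z.
  have := val_ge_ord x0 vx; have : ~ (- mD i P + (q - m)%N%:Z <= ord P x).
    by move=> h; apply: nv; right.
  by rewrite /j /=; lia.
have sh0 : shift i j = 0%N.
  by rewrite /shift; case: asboolP => // -[]; exists x.
set s := basis_section i j.
have ss : sec E (mD i) s by have := basis_section_sec i j; rewrite sh0 mul0n addn0.
have s0 : s != 0 := basis_section_neq0 i j.
have os : ord P s = - mD i P + j%:Z.
  by have := basis_section_ord i j; rewrite sh0 mul0n addn0.
have Pxs : P (x / s).
  apply: (ord_ge0 dP); first by rewrite mulf_neq0 ?invr_eq0.
  by rewrite (ordM dP) ?invr_eq0 // (ordV dP) // ox os subrr.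
have [c hc] := residue_const hS hP Pxs.
have [d hd'] := frob_root c (ltnW q1).
have [c' [hc' ec']] : exists c' : 'I_q -> F, (forall j, shift i j != 0%N -> c' j = 0) /\
    x - iota c * s = \sum_j c' j ^+ q * basis_section i j.
  apply: IH => //; first by apply: (secB hE) => //; apply: (secC hE).
  have -> : x - iota c * s = (x / s - iota c) * s by field.
  have -> : - mD i P + (q - m)%N%:Z = 1 + (- mD i P + j%:Z) by rewrite /j /=; lia.
  by apply: (val_geM dP hc); right; rewrite os.
exists (fun l => c' l + (if l == j then iota d else 0)); split.
  move=> l nl; rewrite hc' // add0r; case: eqP => // lj.
  by rewrite lj sh0 in nl.
under eq_bigr do rewrite frobD // mulrDl.
rewrite big_split /= -ec' (bigD1 j) //= eqxx -rmorphXn hd' big1 ?addr0; last first.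
  by move=> l /negPf ->; apply: q0F.
by rewrite -/s subrK.
Qed.

Hypothesis hdp : forall m : nat, deg E D <> (p ^ m)%N%:Z.

Lemma slope_neq (i : nat) : i%:Z * deg E D <> q%:Z.
Proof.
move=> h; have /eqP := h; have [d0|] := leP 0 (deg E D); last by lia.
rewrite -(gez0_abs d0) -PoszM => /eqP [] hi.
have /dvdn_pfactor : (`|deg E D| %| p ^ e)%N by rewrite -hi dvdn_mull.
move=> /(_ (pcharf_prime hp))[m _ em]; apply: (hdp (m := m)).
by rewrite -em gez0_abs.
Qed.

(** Above the slope no section is shifted. Below it [low_expansion] avoids the shifted ones, and
    coordinates in an adapted family are unique. *)
Lemma expansion_shift (i : 'I_q) (c : 'I_q -> F) :
  sec E (mD i) (\sum_j c j ^+ q * basis_section i j) ->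
  forall j, shift i j != 0%N -> c j = 0.
Proof.
move=> sx j nj; have [lo|hi|/slope_neq //] := ltrgtP (i%:Z * deg E D) q%:Z; last first.
  by rewrite shift_high in nj.
have [c' [hc' ec']] := low_expansion lo sx.
suff <- : c' j = c j by apply: hc'.
apply/eqP; rewrite -subr_eq0; apply/eqP.
apply: (adapted_free hE hp e0 (c := fun j => c' j - c j) hP (basis_section_adapted i)).
under eq_bigr do rewrite frobD // frobN // mulrBl.
by rewrite sumrB -ec' subrr.
Qed.

Definition basis_elt (i j : 'I_q) : K := mono (i + shift i j * q) (basis_section i j).

Lemma basis_elt_in (i j : 'I_q) : A (basis_elt i j).
Proof. exact/section_ring_mono/basis_section_sec. Qed.

Lemma basis_elt_comb (i : 'I_q) (c : 'I_q -> F) n : (forall j, (n < shift i j)%N -> c j = 0) ->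
  mono (i + n * q) (\sum_j c j ^+ q * basis_section i j) =
  \sum_j mono (n - shift i j) (c j) ^+ q * basis_elt i j.
Proof.
move=> hc; rewrite mono_sum; apply: eq_bigr => j _.
have [le_s|lt_s] := leqP (shift i j) n.
  rewrite monoX /basis_elt monoM; congr mono.
  by rewrite mulnBl addnCA subnK // leq_mul2r le_s orbT.
by rewrite hc // !mono0 !expr0n gtn_eqF ?mul0r ?mono0 // ltnW.
Qed.

Lemma section_ring_span a : A a -> exists C : 'I_q -> 'I_q -> K,
  (forall i j, S P (C i j)) /\ a = \sum_i \sum_j C i j ^+ q * basis_elt i j.
Proof.
have sS := section_algebra_subring hE D hP.
move=> /section_ringP[al -> hal].
rewrite tofrac_mono; elim/big_ind: _ => [|x y [C [hC ->]] [C' [hC' ->]]|[n /= _] _].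
- exists (fun _ _ => 0); split=> [i j|]; first exact: subring0.
  rewrite big1 // => i _; rewrite big1 // => j _.
  by rewrite expr0n gtn_eqF ?mul0r // ltnW.
- exists (fun i j => C i j + C' i j); split=> [i j|]; first exact: subringD.
  rewrite -big_split; apply: eq_bigr => i _ /=; rewrite -big_split.
  by apply: eq_bigr => j _ /=; rewrite frobD // mulrDl.
have iq : (n %% q < q)%N by rewrite ltn_mod ltnW.
pose i0 := Ordinal iq; pose m := (n %/ q)%N.
have en : n = (i0 + m * q)%N by rewrite /= addnC -divn_eq.
have [c ec] := adapted_span hE hp e0 al`_n hP (basis_section_adapted i0).
(* The exponent [m - shift i0 j] would be negative only for [m = 0], where the coefficient is a
   section of [L ^ i0] and [expansion_shift] applies. *)
have c0 j : (m < shift i0 j)%N -> c j = 0.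
  move=> mj; have m0 : m = 0%N by have := shift_le1 i0 j; lia.
  apply: (expansion_shift (i := i0)); last by case: (shift i0 j) mj.
  by rewrite -ec; have := hal n; rewrite en m0 mul0n addn0.
exists (fun i j => if i == i0 then mono (m - shift i0 j) (c j) else 0); split.
  move=> i j; case: eqP => _; last exact: subring0.
  have [ms|sm] := ltnP m (shift i0 j); first by rewrite c0 // mono0; apply: subring0.
  apply: section_algebra_mono; have [->|cj] := eqVneq (c j) 0; first by left.
  right; have := adapted_val_ge hE hp e0 (c := c) (n := - mD n P) hP (basis_section_adapted i0).
  rewrite -ec => /(_ (hal n P hP) j) /val_ge_ord.
  rewrite mulf_neq0 ?expf_neq0 ?basis_section_neq0 // => /(_ isT).
  rewrite (ordM dP) ?expf_neq0 ?basis_section_neq0 // (ordX dP) // basis_section_ord.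
  rewrite /multiple [in X in X -> _]en -subzn // !PoszD !PoszM.
  move: (ord P (c j)) (D P) (ltn_ord j) => o d; move: (m) (shift i0 j) => m' s' jq h.
  (* Because [j < q], the order of the term bounds a multiple of [q] strictly below by [- q]. That
     multiple is therefore nonnegative, which is exactly the condition for the stalk in degree
     [m - shift i0 j]. *)
  have : - (q%:Z) < q%:Z * (o + (m'%:Z - s'%:Z) * d) by lia.
  by move: q1; nia.
rewrite (bigD1 i0) //= eqxx [X in _ + X]big1 => [|i /negPf ni]; last first.
  by apply: big1 => j _; rewrite ni expr0n gtn_eqF ?mul0r // ltnW.
by rewrite addr0 -basis_elt_comb // -ec -en.
Qed.

Lemma basis_poly_free (c : 'I_q -> 'I_q -> {poly F}) :
  \sum_i \sum_j c i j ^+ q * (basis_section i j *: 'X^(i + shift i j * q)) = 0 ->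
  forall i j, c i j = 0.
Proof.
move=> h i0 j0; apply/polyP => l; rewrite coef0.
(* Only terms of residue [i0] reach degree [i0 + m q], each through the [q]-th power of one
   coefficient; [m] is chosen so that [c i0 j0] contributes its coefficient of index [l]. *)
pose m := (l + shift i0 j0)%N.
have q0 : (0 < q)%N by apply: ltnW.
pose c' j := if (shift i0 j <= m)%N then (c i0 j)`_(m - shift i0 j) else 0.
suff /(_ j0) : forall j, c' j = 0 by rewrite /c' /m leq_addl addnK.
apply: (adapted_free hE hp e0 hP (basis_section_adapted i0)).
move/(congr1 (fun a : {poly F} => a`_(i0 + m * q))): h.
rewrite coef0 coef_sum (bigD1 i0) //= [X in _ + X]big1 => [|i ni]; last first.
  rewrite coef_sum big1 // => j _; rewrite -scalerAr coefZ coefMXn coef_frob //.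
  case: ifP => [_|/negbT]; first by rewrite mulr0.
  rewrite -leqNgt => le_i; case: ifP => [|_]; last by rewrite mulr0.
  move=> /dvdnP[r er]; case/eqP: ni; apply: val_inj => /=.
  have e1 : (i0 + m * q = i + (shift i j + r) * q)%N.
    by rewrite mulnDl addnA -er subnKC.
  have : ((i0 + m * q) %% q = (i + (shift i j + r) * q) %% q)%N by rewrite e1.
  by rewrite [(i0 + _)%N]addnC [(i + _)%N]addnC !modnMDl !modn_small.
rewrite addr0 coef_sum => h; rewrite -[RHS]h; apply: eq_bigr => j _.
rewrite -scalerAr coefZ coefMXn ltn_add2l ltn_pmul2r // mulrC /c'.
case: (ltnP m (shift i0 j)) => [_|le_m].
  by rewrite expr0n gtn_eqF ?mulr0.
rewrite subnDl -mulnBl coef_frob // dvdn_mull // mulnK //.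
Qed.

Lemma common_denominator n (C : 'I_n -> K) : exists (h : {poly F}) (c : 'I_n -> {poly F}),
  h != 0 /\ forall t, C t = tofrac (c t) / tofrac h.
Proof.
elim: n C => [|n IH] C; first by exists 1, (fun=> 0); split; [apply: oner_neq0|case].
have [h [c [h0 hc]]] := IH (fun t => C (lift ord0 t)).
have [a [b [b0 ea]]] := fraction_split (C ord0).
exists (h * b), (fun t => if unlift ord0 t is Some t' then c t' * b else a * h).
split; first by rewrite mulf_neq0.
have th : tofrac h != 0 by rewrite tofrac_eq0.
have tb : tofrac b != 0 by rewrite tofrac_eq0.
move=> t; case: unliftP => [t' ->|->].
  by rewrite hc !tofracM; apply: divr_scale.
rewrite ea.
rewrite [tofrac (a * h)]tofracM.
rewrite [tofrac (h * b)]tofracM.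
exact: (divr_scaler _ _ th).
Qed.

Definition basis_index : finType := ('I_q * 'I_q)%type.

(** Pairs are enumerated because [free_module] indexes bases by ordinals. *)
Definition local_basis (t : 'I_#|basis_index|) : K :=
  basis_elt (enum_val t).1 (enum_val t).2.

Lemma local_basis_sum (c : 'I_q -> 'I_q -> K) :
  frob_comb p e (fun t : 'I_#|basis_index| => c (enum_val t).1 (enum_val t).2) local_basis =
  \sum_i \sum_j c i j ^+ q * basis_elt i j.
Proof.
rewrite pair_big /= (reindex _ (onW_bij _ (@enum_val_bij basis_index))).
by [].
Qed.

Lemma local_basis_in t : A (local_basis t).
Proof. exact: basis_elt_in. Qed.

Lemma local_basis_free : frob_free p e local_basis.
Proof.
move=> C hC t; have [h [c [h0 hc]]] := common_denominator C.
have th : tofrac h != 0 by rewrite tofrac_eq0.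
pose c2 i j := c (enum_rank ((i, j) : basis_index)).
suff c20 : forall i j, c2 i j = 0.
  have := c20 (enum_val t).1 (enum_val t).2; rewrite /c2 -surjective_pairing enum_valK hc => ->.
  by rewrite tofrac0 mul0r.
apply: basis_poly_free.
apply/eqP; rewrite -tofrac_eq0; apply/eqP.
have e1 : frob_comb p e (fun t => tofrac (c t)) local_basis = 0.
  have -> : frob_comb p e (fun t => tofrac (c t)) local_basis =
      tofrac h ^+ q * frob_comb p e C local_basis.
    rewrite -frob_combM; apply: eq_bigr => t' _; congr (_ ^+ _ * _).
    by rewrite hc mulrCA divff // mulr1.
  by rewrite hC mulr0.
rewrite -[RHS]e1 rmorph_sum /=.
rewrite (_ : frob_comb p e _ _ = \sum_i \sum_j tofrac (c2 i j) ^+ q * basis_elt i j).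
  apply: eq_bigr => i _; rewrite rmorph_sum; apply: eq_bigr => j _ /=.
  by rewrite tofracM tofracXn.
rewrite -local_basis_sum; apply: eq_bigr => t' _; rewrite /c2.
by rewrite -surjective_pairing enum_valK.
Qed.

Lemma local_basis_span : A `<=` frob_span p e (S P) local_basis.
Proof.
move=> a /section_ring_span[C [hC ->]]; rewrite -local_basis_sum.
by exists (fun t => C (enum_val t).1 (enum_val t).2).
Qed.

End AtPoint.
End LocalBasis.

Arguments local_basis_free {k F iota E} hE {D} hD hd {p e} hp e0 {P} hP.
Arguments local_basis_span {k F iota E} hE {D} hD hd {p e} hp e0 {P} hP hdp.

(** * The universal flattening *)

Section MainTheorem.
Variables (k : closedFieldType) (F : fieldType) (iota : {rmorphism k -> F}).
Variable E : set (set F).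
Hypothesis hE : elliptic_curve iota E.
Variable D : set F -> int.
Hypotheses (hD : divisor E D) (hd : 2%:Z <= deg E D).
Variables (p e : nat).
Hypotheses (hp : p \in [pchar k]) (e0 : (0 < e)%N).
Hypothesis hdp : forall m : nat, deg E D <> (p ^ m)%N%:Z.
Local Notation q := (p ^ e)%N.
Local Notation K := {fraction {poly F}}.
Local Notation pt := (closed_points E).
Local Notation A := (section_ring E D).
Local Notation S := (section_algebra D).
Local Notation hpK := (pchar_ratfun iota hp).
Implicit Types (P : set F) (z V : set K).
Let hS : smooth_projective_curve iota E := hE.1.
Let dv P : pt P -> dvr P := @pt_dvr _ _ _ _ hS P.
Let sS P : pt P -> subring (S P) := section_algebra_subring hE D (P := P).

Lemma relative_spec_flattening :
  flattening A (A : set (frob_push hpK e)) (relative_spec E D).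
Proof.
split; first exact: (relative_spec_model hE hD hd).
move=> y [P hP hy]; have [ly Sy _] := affE (sS hP) hy.
have Ay : A `<=` frob_span p e y (local_basis hE hD hd hp e0 hP).
  move=> a Aa; apply: (frob_span_sub Sy).
  exact: (local_basis_span hE hD hd hp e0 hP hdp).
have fb : frob_free p e (local_basis hE hD hd hp e0 hP) := local_basis_free hE hD hd hp e0 hP.
exact: (frob_free_module hpK (local_basis_in hE hD hd hp e0 hP) fb ly.1 Ay).
Qed.

(* For [i = q - 1] the bundle [F^e_* L ^ i] is generated by its sections, so that
   the coordinates of the sections embed [E]. *)
Lemma high_index : {i : 'I_q | q%:Z < i%:Z * deg E D}.
Proof.
have q1 := frob_gt1 hp e0; have qm : (q.-1 < q)%N by lia.
(* With [d >= 2], the inequality [(q - 1) d > q] fails only for [d = q = 2], which is ruled out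
   since [d] differs from [p ^ e]. *)
exists (Ordinal qm) => /=; have := @hdp e.
have : q.-1%:Z = q%:Z - 1 by lia.
by move=> ->; nia.
Qed.

Lemma flat_contains_chart z V P : is_local z -> A `<=` z ->
  (forall x, centre setT z x) ->
  free_module z (tf_pullback z (A : set (frob_push hpK e))) ->
  valuation_ring V -> dominates V z -> pt P -> S P `<=` V -> S P `<=` z.
Proof.
move=> lz Az fracz free vV Vz hP SV; have sz := lz.1; have dP := dv hP.
have [zV dom] := Vz.
have zspan := frob_basis_descent (local_basis_in hE hD hd hp e0 hP)
  (local_basis_free hE hD hd hp e0 hP)  sz vV.1 Vz Az fracz free
  (subset_trans (local_basis_span hE hD hd hp e0 hP hdp) (frob_span_sub SV)).
have [i hi] := high_index.
have sh j : shift E D P i j = 0%N by exact: (shift_high hE hD hd hp e0 hP j hi).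
pose s := basis_section hE hD hd hp e0 hP i.
have ss j : sec E (multiple D i) (s j).
  by have := basis_section_sec hE hD hd hp e0 hP i j; rewrite sh mul0n addn0.
have os j : s j != 0 /\ ord P (s j) = - multiple D i P + j%:Z.
  split; first exact: basis_section_neq0.
  by have := basis_section_ord hE hD hd hp e0 hP i j; rewrite sh mul0n addn0.
have coord (c : 'I_q -> F) : sec E (multiple D i) (\sum_j c j ^+ q * s j) ->
    forall j, z (mono 0 (c j)).
  move=> sc j.
  pose C (i' j' : 'I_q) : K := if i' == i then mono 0 (c j') else 0.
  have eC : mono i (\sum_j c j ^+ q * s j) = \sum_i' \sum_j' C i' j' ^+ q *
      basis_elt hE hD hd hp e0 hP i' j'.
    have := basis_elt_comb hE hD hd hp e0 hP (i := i) (c := c) (n := 0).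
    rewrite mul0n addn0 => -> => [|j']; last by rewrite sh.
    rewrite [RHS](bigD1 i) //= [X in _ = _ + X]big1 ?addr0 => [|i' /negPf ni].
      by apply: eq_bigr => j' _; rewrite /C eqxx sub0n.
    apply: big1 => j' _; rewrite /C ni expr0n gtn_eqF ?mul0r //.
    exact: frob_expn_gt0 hp _.
  (* Descent gives the section coordinates in [z], the hypothesis gives it the coordinates
     [mono 0 (c j)]; independence over [K] identifies them. *)
  have [B zB eB] := zspan _ (section_ring_mono sc).
  rewrite eC -local_basis_sum in eB.
  have := frob_free_inj hpK (local_basis_free hE hD hd hp e0 hP) eB
    (enum_rank ((i, j) : basis_index p e)).
  by rewrite enum_rankK /C eqxx => ->.
have zF x : P x -> z (mono 0 x).
  (* [immersion] asks for a ring inside [O_P], hence the intersection. It is dominated by [O_P]: an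
     inverse lying in [O_P] lies in [V], and [V] dominates [z]. *)
  move: x; suff h : P `<=` P `&` constants z by move=> x /h [].
  have sC : subring (P `&` constants z).
    have sc := constants_subring sz.
    apply/subringP; split=> [|a b [Pa za] [Pb zb]|a b [Pa za] [Pb zb]].
    - by split; [apply: subring1 dP.1|apply: subring1].
    - by split; [apply: subringB dP.1 _ _|apply: subringB].
    - by split; [apply: subringM dP.1 _ _|apply: subringM].
  apply: (immersion hE hp e0 hP (multiple_degree hD i) hi ss os sC).
  - move=> x kx; split; last exact/Az/(section_ring_const hE).
    by apply: (const_sub hS _ kx); case: (hP).
  - by move=> x [].
  - move=> x [Px zx] Px'; split=> //; rewrite /constants /= -monoV; apply: dom => //.
    rewrite monoV; apply: SV; apply: section_algebra_mono.
    by rewrite /multiple mul0r oppr0; apply/(val_ge0 dP).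
  - move=> c sc j; split; last exact: coord.
    have := adapted_val_ge hE hp e0 (c := c) (n := - multiple D i P) hP
      (basis_section_adapted hE hD hd hp e0 hP i) (sc P hP) j.
    have [sj oj] := os j; rewrite -/(s j).
    have [->|cj] := eqVneq (c j) 0; first by move=> _; apply: subring0 dP.1.
    move=> /val_ge_ord; rewrite mulf_neq0 ?expf_neq0 // => /(_ isT).
    rewrite (ordM dP) ?expf_neq0 // (ordX dP) // oj => h.
    apply: (ord_ge0 dP) => //; have := ltn_ord j; nia.
have [w [sw w0 ow]] := generator_at hE hD hd hP.
by apply: (section_algebra_gen hE hP sz zF w0 ow); apply/Az/section_ring_mono.
Qed.

Lemma relative_spec_universal_flattening :
  universal_flattening A (A : set (frob_push hpK e)) (relative_spec E D).
Proof.
split; first exact: relative_spec_flattening.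
move=> Z [mZ fZ] z Zz; have [lz Az fracz] := model_local mZ Zz.
have [V vV Vz] := exists_dominating lz.
have [P [hP SV]] := valuation_center hE hD hd vV (subset_trans Az Vz.1).
have Sz := flat_contains_chart lz Az fracz (fZ z Zz) vV Vz hP SV.
exists (centre z (S P)); first exact: (relative_spec_centre hE).
exact: centre_dominated lz (sS hP) Sz.
Qed.

Lemma Fblowup_section_ring : Fblowup hpK e A = relative_spec E D.
Proof. exact: blowup_at_eq relative_spec_universal_flattening. Qed.

End MainTheorem.

Theorem theorem4p7 (k : closedFieldType) (p : nat) (hp : p \in [pchar k])
    (F : fieldType) (iota : {rmorphism k -> F})
    (E : set (set F)) (hE : elliptic_curve iota E)
    (D : set F -> int) (hD : divisor E D)
    (hpure : F_pure (pchar_ratfun iota hp) (section_ring E D))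
    (hE2 : self_intersection E D <= - 2%:Z)
    (hdp : forall m : nat, - self_intersection E D <> (p ^ m)%N%:Z) :
  (forall e : nat, (0 < e)%N ->
     normalization (Fblowup (pchar_ratfun iota hp) e (section_ring E D))
       = relative_spec E D) /\
  (self_intersection E D <= - 3%:Z ->
     forall e : nat, (0 < e)%N ->
       Fblowup (pchar_ratfun iota hp) e (section_ring E D)
         = relative_spec E D).
Proof.
have hd : 2%:Z <= deg E D by move: hE2; rewrite /self_intersection lerN2.
have {}hdp m : deg E D <> (p ^ m)%N%:Z.
  by have := hdp m; rewrite /self_intersection opprK.
have FB e : (0 < e)%N ->
    Fblowup (pchar_ratfun iota hp) e (section_ring E D) = relative_spec E D.
  by move=> e0; exact: (Fblowup_section_ring hE hD hd hp e0 hdp).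
split=> [e e0|_]; last exact: FB.
by rewrite FB // (relative_spec_normal hE).
Qed.
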